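(* Let $V$ be a $C_2$-cofinite simple vertex operator algebra of CFT-type and let $G\le \mathrm{Aut}(V)$ be a finite solvable group of automorphisms. Then the fixed point vertex operator subalgebra $V^{G}=\{v\in V\mid g(v)=v \text{ for all } g\in G\}$ is also $C_2$-cofinite.
   Context: A vertex operator algebra (VOA) is a quadruple $(V,Y,\mathbf 1,\omega)$ over $\mathbb C$ in the usual sense, with grading $V=\bigoplus_n V_n$ by $L(0)$-weights, vertex operators $Y(v,z)=\sum_{m\in\mathbb Z}v_mz^{-m-1}$, vacuum $\mathbf 1\in V_0$ and Virasoro element $\omega\in V_2$, $Y(\omega,z)=\sum_{n}L(n)z^{-n-2}$; $\mathrm{wt}(v)=n$ for $v\in V_n$. $V$ is of CFT-type if $V=\bigoplus_{n\ge 0}V_n$ and $V_0=\mathbb C\mathbf 1$. Automorphisms fix $\mathbf 1$ and $\omega$. For a VOA $V$ and a $V$-module $W$ put $C_2(W)=\mathrm{Span}_{\mathbb C}\{v_{-2}u\mid v\in V,\ u\in W,\ \mathrm{wt}(v)>0\}$ ($v$ homogeneous); $W$ is called $C_2$-cofinite if $\dim W/C_2(W)<\infty$. A VOA is $C_2$-cofinite if it is $C_2$-cofinite as a module over itself. *)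

(* Defs.v *)
From HB Require Import structures.
From mathcomp Require Import all_boot all_order all_algebra all_fingroup all_solvable.
From mathcomp Require Import boolp classical_sets reals.
From mathcomp.real_closed Require Import complex.

Set Implicit Arguments.
Unset Strict Implicit.
Unset Printing Implicit Defensive.

Import Order.TTheory GRing.Theory Num.Theory.
Local Open Scope classical_set_scope.
Local Open Scope ring_scope.
Local Open Scope complex_scope.

Section LinearSpan.
Context {K : fieldType} {W : lmodType K}.
Implicit Types (S P : set W).

Definition span S : set W :=
  [set w | exists s : seq (K * W),
     (forall p, p \in s -> S p.2) /\ w = \sum_(p <- s) p.1 *: p.2].

Definition subspace P := P 0 /\ forall a u v, P u -> P v -> P (a *: u + v).

Definition finite_dim P := exists B : seq W, P = span [set` B].

(* For a subspace [P], this says that dim W/P is finite: finitely many vectors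
   span W modulo P. *)
Definition finite_codim P := exists B : seq W, span (P `|` [set` B]) = setT.

Definition eigenspace_int (T : W -> W) (n : int) : set W :=
  [set w | T w = n%:~R *: w].

Lemma subspace_span S : subspace (span S).
Proof.
split; first by exists [::]; rewrite big_nil.
move=> a u v [su [Su ->]] [sv [Sv ->]].
exists ([seq (a * p.1, p.2) | p <- su] ++ sv); split.
  move=> p; rewrite mem_cat => /orP[/mapP[q /Su Sq ->]|/Sv] //.
rewrite big_cat big_map /= scaler_sumr; congr (_ + _).
by apply: eq_bigr => p _; rewrite scalerA.
Qed.

Lemma sub_span S : S `<=` span S.
Proof.
move=> w Sw; exists [:: (1, w)]; rewrite big_seq1 scale1r; split=> // p.
by rewrite inE => /eqP ->.
Qed.

Lemma subspaceZ P a u : subspace P -> P u -> P (a *: u).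
Proof. by case=> P0 PD Pu; rewrite -[_ *: _]addr0; exact: PD. Qed.

Lemma subspaceD P u v : subspace P -> P u -> P v -> P (u + v).
Proof. by case=> P0 PD Pu Pv; rewrite -[u]scale1r; exact: PD. Qed.

Lemma subspaceB P u v : subspace P -> P u -> P v -> P (u - v).
Proof. by case=> P0 PD Pu Pv; rewrite addrC -scaleN1r; exact: PD. Qed.

Lemma subspace_sum P (I : eqType) (s : seq I) (f : I -> W) : subspace P ->
  (forall i, i \in s -> P (f i)) -> P (\sum_(i <- s) f i).
Proof.
move=> sP Pf; rewrite big_seq; elim/big_ind : _ => //; first by case: sP.
by move=> u v; exact: subspaceD.
Qed.

Lemma span_sub S P : subspace P -> S `<=` P -> span S `<=` P.
Proof.
move=> sP SP w [s [Ss ->]]; apply: subspace_sum => // p /Ss Sp.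
by apply: subspaceZ => //; exact: SP.
Qed.

Lemma subspaceI P Q : subspace P -> subspace Q -> subspace (P `&` Q).
Proof.
move=> [P0 PD] [Q0 QD]; split=> // a u v [Pu Qu] [Pv Qv].
by split; [exact: PD|exact: QD].
Qed.

Lemma finite_dim_sub P (B : seq W) :
  subspace P -> P `<=` span [set` B] -> finite_dim P.
Proof.
elim: B P => [|b B IH] P sP PB.
  exists [::]; apply/seteqP; split=> //.
  by apply: span_sub.
have sQ := subspaceI sP (subspace_span [set` B]).
have [C PC] := IH _ sQ (@subIsetr _ _ _).
have CP c : c \in C -> P c.
  by move=> cC; have [] : (P `&` span [set` B]) c by rewrite PC; exact: sub_span.
have split_b w : P w -> exists a, span [set` B] (w - a *: b).
  move=> /PB [s [sB ->]].
  exists (\sum_(p <- s | p.2 == b) p.1).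
  rewrite (bigID (fun p => p.2 == b)) /= scaler_suml.
  rewrite (eq_bigr (fun p => p.1 *: b)); last by move=> p /eqP ->.
  rewrite addrAC subrr add0r -big_filter.
  apply: subspace_sum; first exact: subspace_span.
  move=> p; rewrite mem_filter => /andP[pb /sB /=].
  rewrite inE (negbTE pb) /= => pB.
  by apply: subspaceZ; [exact: subspace_span|exact: sub_span].
have [[p [a [Pp a0 pa]]]|nob] :=
    pselect (exists p a, [/\ P p, a != 0 & span [set` B] (p - a *: b)]).
  exists (p :: C); apply/seteqP; split; last first.
    apply: span_sub => // c /=; rewrite inE => /orP[/eqP -> //|]; exact: CP.
  move=> w Pw; have [d wd] := split_b _ Pw.
  pose z := w - (d / a) *: p.
  have Cz : span [set` C] z.
    rewrite -PC; split.
      by apply: subspaceB => //; exact: subspaceZ.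
    have -> : z = (w - d *: b) - (d / a) *: (p - a *: b).
      by rewrite /z scalerBr scalerA divfK // opprB addrA subrK.
    apply: subspaceB => //; first exact: subspace_span.
    by apply: subspaceZ => //; exact: subspace_span.
  have -> : w = z + (d / a) *: p by rewrite subrK.
  apply: subspaceD; first exact: subspace_span.
    apply: span_sub Cz; first exact: subspace_span.
    by move=> c /= cC; apply: sub_span; rewrite /= inE cC orbT.
  apply: subspaceZ; first exact: subspace_span.
  by apply: sub_span; rewrite /= inE eqxx.
exists C; rewrite -PC; apply/seteqP; split=> [w Pw|w []//].
split=> //; have [a wa] := split_b _ Pw.
have [a0|a0] := eqVneq a 0; first by rewrite a0 scale0r subr0 in wa.
by case: nob; exists w, a.
Qed.

End LinearSpan.

Lemma graded_subspace (K : numFieldType) (W : lmodType K) (T : W -> W)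
    (P : set W) :
  linear T -> subspace P -> (forall w, P w -> P (T w)) ->
  span (\bigcup_n eigenspace_int T n) = setT ->
  P `<=` span (\bigcup_n (eigenspace_int T n `&` P)).
Proof.
move=> linT sP TP spanT w Pw.
have TZ a u : T (a *: u) = a *: T u.
  have T0 : T 0 = 0.
    have := linT 1 0 0; rewrite !scale1r addr0 => /esym /eqP.
    by rewrite -subr_eq0 addrK => /eqP.
  by have := linT a u 0; rewrite T0 !addr0.
have TD u v : T (u + v) = T u + T v by have := linT 1 u v; rewrite !scale1r.
have eigP n : subspace (eigenspace_int T n).
  split; first by rewrite /eigenspace_int /= -[0](scale0r 0) TZ !scale0r scaler0.
  move=> a u v; rewrite /eigenspace_int /= => Tu Tv.
  by rewrite linT Tu Tv scalerDr !scalerA mulrC.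
have [s [f [us [fT wE]]]] : exists (s : seq int) (f : int -> W),
    uniq s /\ (forall n, eigenspace_int T n (f n)) /\ w = \sum_(n <- s) f n.
  have : span (\bigcup_n eigenspace_int T n) w by rewrite spanT.
  move=> [s [sT ->]].
  have /choice [k kP] : forall p : K * W, exists n : int,
      p \in s -> eigenspace_int T n p.2.
    move=> p; have [ps|ps] := boolP (p \in s); last by exists 0.
    by have [n _ Tn] := sT _ ps; exists n.
  exists (undup (map k s)), (fun n => \sum_(p <- s | k p == n) p.1 *: p.2).
  split; first exact: undup_uniq.
  split.
    move=> n; rewrite -big_filter; apply: subspace_sum => // p.
    rewrite mem_filter => /andP[/eqP <- /kP ?].
    exact: subspaceZ.
  under [RHS]eq_bigr do rewrite big_mkcond.
  rewrite exchange_big /= big_seq [RHS]big_seq; apply: eq_bigr => p ps.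
  have kp : k p \in undup (map k s) by rewrite mem_undup map_f.
  rewrite (bigD1_seq (k p)) ?undup_uniq //= eqxx big1 ?addr0 // => n.
  by rewrite eq_sym => /negbTE ->.
have Pf : forall n, n \in s -> P (f n).
  elim: s w f us fT wE Pw => // m s IH w f /= /andP[ms us] fT wE Pw.
  pose g n := (n - m)%:~R *: f n.
  have Pg n : n \in s -> P (g n).
    apply: (IH (T w - m%:~R *: w) g us).
    - by move=> k; exact: subspaceZ.
    - have TS (r : seq int) : T (\sum_(n <- r) f n) = \sum_(n <- r) n%:~R *: f n.
        elim: r => [|k r IHr].
          by rewrite !big_nil -[0](scale0r 0) TZ !scale0r.
        by rewrite !big_cons TD IHr; congr (_ + _); exact: fT.
      rewrite wE TS scaler_sumr -sumrB big_cons subrr add0r.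
      by apply: eq_bigr => k _; rewrite -scalerBl -intrB.
    - by apply: subspaceB; [|exact: TP|exact: subspaceZ].
  have Pfs n : n \in s -> P (f n).
    move=> ns; have nm : (n - m)%:~R != 0 :> K.
      by rewrite intr_eq0 subr_eq0; apply: contraNneq ms => <-.
    by rewrite -[f n](scalerK nm); apply: subspaceZ => //; exact: Pg.
  move=> n; rewrite inE => /orP[/eqP ->|/Pfs//].
  have -> : f m = w - \sum_(n <- s) f n by rewrite wE big_cons addrK.
  by apply: subspaceB => //; exact: subspace_sum.
rewrite wE; apply: subspace_sum; first exact: subspace_span.
by move=> n ns; apply: sub_span; exists n => //; split; [exact: fT|exact: Pf].
Qed.

(* Binomial coefficient z(z-1)...(z-i+1)/i! with an integer upper argument. *)
Definition zbinom (K : fieldType) (z : int) (i : nat) : K :=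
  (\prod_(j < i) (z - j%:Z))%:~R / i`!%:R.

(* [mode u n v] is u_n v, where Y(u,z) = \sum_n u_n z^{-n-1}; in particular
   L(n) = omega_{n+1}.  The Jacobi identity is given by its coefficients
   (the Borcherds identity)
     \sum_i C(p,i) (a_{r+i} b)_{p+q-i} c
       = \sum_i (-1)^i C(r,i)
           (a_{p+r-i} (b_{q+i} c) - (-1)^r b_{q+r-i} (a_{p+i} c));
   by [mode_trunc] both sums have finitely many nonzero terms, and they are
   written as their partial sums with N terms, for all large N.  The weight
   spaces are the L(0)-eigenspaces, so their sum is automatically direct. *)
HB.mixin Record isVOA (R : realType) V of GRing.Lmodule R[i] V := {
  mode : V -> int -> V -> V;
  vacuum : V;
  conformal : V;
  mode_linearl : forall n v, linear (fun u => mode u n v);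
  mode_linearr : forall u n, linear (mode u n);
  mode_trunc : forall u v,
    exists N : int, forall n, N <= n -> mode u n v = 0;
  mode_vacuum : forall n v, mode vacuum n v = if n == -1 then v else 0;
  mode_creation : forall v, mode v (-1) vacuum = v;
  mode_creation0 : forall v n, 0 <= n -> mode v n vacuum = 0;
  mode_borcherds : forall (a b c : V) (p q r : int),
    exists N0 : nat, forall N : nat, (N0 <= N)%N ->
    \sum_(i < N) zbinom R[i] p i *:
        mode (mode a (r + i%:Z) b) (p + q - i%:Z) c
    = \sum_(i < N) ((-1) ^+ i * zbinom R[i] r i) *:
        (mode a (p + r - i%:Z) (mode b (q + i%:Z) c)
         - (-1) ^ r *: mode b (q + r - i%:Z) (mode a (p + i%:Z) c));
  virasoro : exists c : R[i], forall (m n : int) v,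
    let L k := mode conformal (k + 1) in
    L m (L n v) - L n (L m v)
    = (m - n)%:~R *: L (m + n) v
      + (if m + n == 0 then (m ^+ 3 - m)%:~R / 12%:R * c else 0) *: v;
  translation : forall u n v,
    mode (mode conformal 0 u) n v = - (n%:~R *: mode u (n - 1) v);
  grading_span :
    span (\bigcup_n eigenspace_int (mode conformal 1) n) = setT;
  grading_bounded : exists N : int, forall n, n < N ->
    eigenspace_int (mode conformal 1) n = [set 0];
  grading_finite_dim : forall n,
    finite_dim (eigenspace_int (mode conformal 1) n);
  vacuum_weight : eigenspace_int (mode conformal 1) 0 vacuum;
  conformal_weight : eigenspace_int (mode conformal 1) 2 conformal
}.

#[short(type="voaType")]
HB.structure Definition VOA (R : realType) :=
  {V of GRing.Lmodule R[i] V & isVOA R V}.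

Arguments vacuum {R s}.
Arguments conformal {R s}.

Section Notions.
Context {R : realType} (V : voaType R).

Definition weight_space (n : int) : set V :=
  eigenspace_int (mode (conformal : V) 1) n.

(* V is irreducible as a module over itself. *)
Definition simple_voa :=
  (vacuum : V) != 0 /\
  forall I : set V, subspace I ->
    (forall (u : V) (n : int) (v : V), I v -> I (mode u n v)) ->
    I = [set 0] \/ I = setT.

Definition CFT_type :=
  (forall n : int, n < 0 -> weight_space n = [set 0]) /\
  weight_space 0 = span [set vacuum].

(* [YW v n u] is v_n u for v in V and u in the V-module W. *)
Definition C2 (W : lmodType R[i]) (YW : V -> int -> W -> W) : set W :=
  span [set w | exists (v : V) (u : W) (n : int),
          [/\ 0 < n, weight_space n v & w = YW v (- 2) u]].

Definition C2_cofinite_module (W : lmodType R[i]) (YW : V -> int -> W -> W) :=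
  finite_codim (C2 YW).

Definition C2_cofinite := C2_cofinite_module (mode : V -> int -> V -> V).

Record voa_aut := VoaAut {
  voa_aut_fun :> V -> V;
  voa_aut_linear : linear voa_aut_fun;
  voa_aut_bij : bijective voa_aut_fun;
  voa_aut_mode : forall u n v,
    voa_aut_fun (mode u n v) = mode (voa_aut_fun u) n (voa_aut_fun v);
  voa_aut_vacuum : voa_aut_fun vacuum = vacuum;
  voa_aut_conformal : voa_aut_fun conformal = conformal
}.

HB.instance Definition _ := gen_eqMixin voa_aut.
HB.instance Definition _ := gen_choiceMixin voa_aut.

Lemma voa_aut_eq (g h : voa_aut) : (forall v, g v = h v) -> g = h.
Proof.
case: g h => [g g1 g2 g3 g4 g5] [h h1 h2 h3 h4 h5] /= /funext gh.
by case: _ / gh h1 h2 h3 h4 h5 => *; congr VoaAut; exact: Prop_irrelevance.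
Qed.

Definition voa_aut_one : voa_aut.
Proof. by exists id => //; exists id. Defined.

Definition voa_aut_mul (g h : voa_aut) : voa_aut.
Proof.
exists (g \o h) => /=.
- by move=> a u v /=; rewrite !voa_aut_linear.
- exact: bij_comp (voa_aut_bij g) (voa_aut_bij h).
- by move=> u n v /=; rewrite !voa_aut_mode.
- by rewrite /= !voa_aut_vacuum.
- by rewrite /= !voa_aut_conformal.
Defined.

Lemma voa_aut_inv_ex (g : voa_aut) :
  exists h : voa_aut, cancel g h /\ cancel h g.
Proof.
have [h gK hK] := voa_aut_bij g.
have h1 : linear h.
  by move=> a u v; rewrite -{1}(hK u) -{1}(hK v) -voa_aut_linear gK.
have h2 : bijective h by exists g.
have h3 u n v : h (mode u n v) = mode (h u) n (h v).
  by rewrite -{1}(hK u) -{1}(hK v) -voa_aut_mode gK.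
have h4 : h vacuum = vacuum by rewrite -{1}(voa_aut_vacuum g) gK.
have h5 : h conformal = conformal by rewrite -{1}(voa_aut_conformal g) gK.
by exists (VoaAut h1 h2 h3 h4 h5).
Qed.

Definition voa_aut_inv (g : voa_aut) : voa_aut := sval (cid (voa_aut_inv_ex g)).

Fact voa_aut_mulA : associative voa_aut_mul.
Proof. by move=> g h k; exact: voa_aut_eq. Qed.

Fact voa_aut_1mul : left_id voa_aut_one voa_aut_mul.
Proof. by move=> g; exact: voa_aut_eq. Qed.

Fact voa_aut_mul1 : right_id voa_aut_one voa_aut_mul.
Proof. by move=> g; exact: voa_aut_eq. Qed.

Fact voa_aut_Vmul : left_inverse voa_aut_one voa_aut_inv voa_aut_mul.
Proof.
move=> g; apply: voa_aut_eq => v /=; rewrite /voa_aut_inv.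
by case: cid => h /= [gK _].
Qed.

Fact voa_aut_mulV : right_inverse voa_aut_one voa_aut_inv voa_aut_mul.
Proof.
move=> g; apply: voa_aut_eq => v /=; rewrite /voa_aut_inv.
by case: cid => h /= [_ hK].
Qed.

HB.instance Definition _ := isGroup.Build voa_aut
  voa_aut_mulA voa_aut_1mul voa_aut_mul1 voa_aut_Vmul voa_aut_mulV.

(* G is the image of a finite solvable group under an injective homomorphism,
   i.e. G is a subgroup of Aut(V) that is finite and solvable. *)
Definition finite_solvable_subgroup (G : set voa_aut) :=
  exists (gT : finGroupType) (f : {multiplicative gT -> voa_aut}),
    [/\ injective f, range f = G & solvable [set: gT]%SET].

Definition fixed_pred (G : set voa_aut) : {pred V} :=
  [pred v | `[< forall g, G g -> g v = v >]].

End Notions.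

Section FixedVOA.
Context {R : realType} (V : voaType R) (G : set (voa_aut V)).

Fact fixed_pred_submod : submod_closed (fixed_pred G).
Proof.
split=> [|a u v].
  apply/asboolP => g _.
  have := voa_aut_linear g 1 0 0; rewrite !scale1r addr0 => /esym /eqP.
  by rewrite -subr_eq0 addrK => /eqP.
move=> /asboolP Gu /asboolP Gv; apply/asboolP => g Gg.
by rewrite voa_aut_linear Gu ?Gv.
Qed.
HB.instance Definition _ :=
  GRing.isSubmodClosed.Build R[i] V (fixed_pred G) fixed_pred_submod.

Record fixed := Fixed { fixed_val : V; _ : fixed_val \in fixed_pred G }.
HB.instance Definition _ := [isSub for fixed_val].
HB.instance Definition _ := [Choice of fixed by <:].
HB.instance Definition _ := [SubChoice_isSubLmodule of fixed by <:].

Lemma fixed_valP (w : fixed) g : G g -> g (val w) = val w.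
Proof. by move=> Gg; have /asboolP := valP w; exact. Qed.

Fact fixed_mode_subproof (u : fixed) n (v : fixed) :
  mode (val u) n (val v) \in fixed_pred G.
Proof.
by apply/asboolP => g Gg; rewrite voa_aut_mode !fixed_valP.
Qed.
Fact fixed_vacuum_subproof : (vacuum : V) \in fixed_pred G.
Proof. by apply/asboolP => g _; exact: voa_aut_vacuum. Qed.
Fact fixed_conformal_subproof : (conformal : V) \in fixed_pred G.
Proof. by apply/asboolP => g _; exact: voa_aut_conformal. Qed.

Definition fixed_mode (u : fixed) n (v : fixed) : fixed :=
  Fixed (fixed_mode_subproof u n v).
Definition fixed_vacuum : fixed := Fixed fixed_vacuum_subproof.
Definition fixed_conformal : fixed := Fixed fixed_conformal_subproof.

Fact fixed_mode_linearl n v : linear (fun u => fixed_mode u n v).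
Proof. by move=> a u w; apply: val_inj; rewrite /= mode_linearl. Qed.

Fact fixed_mode_linearr u n : linear (fixed_mode u n).
Proof. by move=> a v w; apply: val_inj; rewrite /= mode_linearr. Qed.

Fact fixed_mode_trunc u v :
  exists N : int, forall n, N <= n -> fixed_mode u n v = 0.
Proof.
have [N uv0] := mode_trunc (val u) (val v); exists N => n Nn.
by apply: val_inj; rewrite raddf0 /= uv0.
Qed.

Fact fixed_mode_vacuum n v :
  fixed_mode fixed_vacuum n v = if n == -1 then v else 0.
Proof. by apply: val_inj; rewrite /= mode_vacuum; case: ifP; rewrite ?raddf0. Qed.

Fact fixed_mode_creation v : fixed_mode v (-1) fixed_vacuum = v.
Proof. by apply: val_inj; rewrite /= mode_creation. Qed.

Fact fixed_mode_creation0 v n : 0 <= n -> fixed_mode v n fixed_vacuum = 0.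
Proof. by move=> n0; apply: val_inj; rewrite raddf0 /= mode_creation0. Qed.

Fact fixed_mode_borcherds (a b c : fixed) (p q r : int) :
  exists N0 : nat, forall N : nat, (N0 <= N)%N ->
  \sum_(i < N) zbinom R[i] p i *:
      fixed_mode (fixed_mode a (r + i%:Z) b) (p + q - i%:Z) c
  = \sum_(i < N) ((-1) ^+ i * zbinom R[i] r i) *:
      (fixed_mode a (p + r - i%:Z) (fixed_mode b (q + i%:Z) c)
       - (-1) ^ r *: fixed_mode b (q + r - i%:Z) (fixed_mode a (p + i%:Z) c)).
Proof.
have [N0 NE] := mode_borcherds (val a) (val b) (val c) p q r.
exists N0 => N /NE {}NE; apply: val_inj; rewrite !raddf_sum /=.
exact: NE.
Qed.

Fact fixed_virasoro : exists c : R[i], forall (m n : int) v,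
  let L k := fixed_mode fixed_conformal (k + 1) in
  L m (L n v) - L n (L m v)
  = (m - n)%:~R *: L (m + n) v
    + (if m + n == 0 then (m ^+ 3 - m)%:~R / 12%:R * c else 0) *: v.
Proof.
have [c cE] := @virasoro R V; exists c => m n v L; apply: val_inj.
exact: cE.
Qed.

Fact fixed_translation u n v :
  fixed_mode (fixed_mode fixed_conformal 0 u) n v
  = - (n%:~R *: fixed_mode u (n - 1) v).
Proof. by apply: val_inj; exact: translation. Qed.

Let eigenP n (w : fixed) :
  eigenspace_int (fixed_mode fixed_conformal 1) n w <->
  eigenspace_int (mode (conformal : V) 1) n (val w).
Proof.
rewrite /eigenspace_int /=; by split=> [/(congr1 val)|wE] //; exact: val_inj.
Qed.

Let Vfix : set V := [set v | v \in fixed_pred G].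

Let Vfix_subspace : subspace Vfix.
Proof. by have [] := fixed_pred_submod. Qed.

Let span_val (S : set V) (w : fixed) : S `<=` Vfix -> span S (val w) ->
  span [set x : fixed | S (val x)] w.
Proof.
move=> SV [s [Ss wE]].
have vE p : p \in s -> val (insubd (0 : fixed) p.2) = p.2.
  by move=> /Ss /SV; exact: insubdK.
exists [seq (p.1, insubd (0 : fixed) p.2) | p <- s]; split.
  by move=> _ /mapP[p ps ->] /=; rewrite vE //; exact: Ss.
apply: val_inj; rewrite wE raddf_sum big_map big_seq [RHS]big_seq.
by apply: eq_bigr => p ps; congr (_ *: _); exact/esym/vE.
Qed.

Fact fixed_grading_span :
  span (\bigcup_n eigenspace_int (fixed_mode fixed_conformal 1) n) = setT.
Proof.
apply/seteqP; split=> // w _.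
have : span (\bigcup_n (eigenspace_int (mode (conformal : V) 1) n `&` Vfix))
    (val w).
  apply: graded_subspace; last exact: (valP w).
  - exact: mode_linearr.
  - exact: Vfix_subspace.
  - move=> v Vv; have := valP (fixed_mode fixed_conformal 1 (Fixed Vv)); exact.
  - exact: grading_span.
move=> /span_val H; apply: span_sub (H _); first exact: subspace_span.
  by move=> x [n _ [nx _]]; apply: sub_span; exists n => //; exact/eigenP.
by move=> x [n _ []].
Qed.

Fact fixed_grading_bounded : exists N : int, forall n, n < N ->
  eigenspace_int (fixed_mode fixed_conformal 1) n = [set 0].
Proof.
have [N NP] := @grading_bounded R V; exists N => n /NP nE.
apply/seteqP; split=> w /=.
  by move=> /eigenP; rewrite nE => w0; apply: val_inj; rewrite w0 raddf0.
by move=> ->; apply/eigenP; rewrite nE raddf0.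
Qed.

Fact fixed_grading_finite_dim n :
  finite_dim (eigenspace_int (fixed_mode fixed_conformal 1) n).
Proof.
have [B BE] := @grading_finite_dim R V n.
have sE : subspace (eigenspace_int (mode (conformal : V) 1) n `&` Vfix).
  by apply: subspaceI => //; rewrite BE; exact: subspace_span.
have [C CE] : finite_dim (eigenspace_int (mode (conformal : V) 1) n `&` Vfix).
  by apply: (finite_dim_sub (B := B)) => // v []; rewrite BE.
have CV c : c \in C -> (eigenspace_int (mode (conformal : V) 1) n `&` Vfix) c.
  by move=> cC; rewrite CE; exact: sub_span.
exists [seq insubd (0 : fixed) c | c <- C]; apply/seteqP; split=> w.
  move=> /eigenP nw.
  have : span [set` C] (val w) by rewrite -CE; split=> //; exact: (valP w).
  move=> /span_val H; apply: span_sub (H _); first exact: subspace_span.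
    move=> x /= xC; apply: sub_span; apply/mapP; exists (val x) => //.
    by rewrite valKd.
  by move=> c /CV [].
apply: span_sub => [|_ /mapP[c /CV[nc Vc] ->]].
  split.
    by apply/eigenP; rewrite raddf0; have [[]] := sE.
  move=> a u v /eigenP nu /eigenP nv; apply/eigenP; rewrite linearP.
  by rewrite BE in nu nv *; have [_] := subspace_span [set` B]; exact.
by apply/eigenP; rewrite insubdK.
Qed.

Fact fixed_vacuum_weight :
  eigenspace_int (fixed_mode fixed_conformal 1) 0 fixed_vacuum.
Proof. by apply/eigenP; exact: vacuum_weight. Qed.

Fact fixed_conformal_weight :
  eigenspace_int (fixed_mode fixed_conformal 1) 2 fixed_conformal.
Proof. by apply/eigenP; exact: conformal_weight. Qed.

HB.instance Definition _ := isVOA.Build R fixed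
  fixed_mode_linearl fixed_mode_linearr fixed_mode_trunc
  fixed_mode_vacuum fixed_mode_creation fixed_mode_creation0
  fixed_mode_borcherds fixed_virasoro fixed_translation
  fixed_grading_span fixed_grading_bounded fixed_grading_finite_dim
  fixed_vacuum_weight fixed_conformal_weight.

End FixedVOA.

(* Main.v *)
(* Let g be an automorphism of prime order n, let U = V^g and let C be the span
   of the x_q c with x in U, q <= -2 and c in V.  Averaging over <g> maps C into
   C_2(U), so it suffices that V/C is finite-dimensional; the solvable case
   follows by induction along a chain of normal subgroups of prime index.

   For eigenvectors a_1, ..., a_r of g the correlation function
     Phi = \prod_(i < j) (z_i - z_j)^k Y(a_1, z_1) ... Y(a_r, z_r) 1
   is, by locality, a power series that does not depend on the order of the
   letters.  If the eigenvalues of the letters in S have product 1, then moving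
   the points of S together by t turns them into Y(x, t) with x in U, whose
   positive powers of t have coefficients in C: modulo C, Phi has bounded degree
   in the direction \sum_(i in S) d/dz_i.  If such directions span, then Phi is
   a polynomial modulo C, so a_1(m_1) ... a_r(m_r) 1 lies in C as soon as its
   weight is large.  The directions can always be made to span: by simplicity
   1 = \sum u_m c for any nonzero c, and such factors can be inserted at will.

   As V is C_2-cofinite, it is spanned, up to lower terms of the standard
   filtration, by words with distinct modes in finitely many letters (Gaberdiel
   and Neitzke).  A long one has n letters with high modes, hence a neutral
   subword with high modes; this subword lies in C by the above, and therefore
   so does the whole word up to lower terms.  The remaining words are bounded in
   length, and modulo C in weight. *)

Require Import Defs.
From HB Require Import structures.
From mathcomp Require Import all_boot all_order all_algebra all_fingroup all_solvable.
From mathcomp Require Import boolp classical_sets reals.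
From mathcomp.real_closed Require Import complex.
From mathcomp Require Import zify.

Set Implicit Arguments.
Unset Strict Implicit.
Unset Printing Implicit Defensive.

Import Order.TTheory GRing.Theory Num.Theory.
(* [Defs.span] is shadowed by the [span] of [vector]. *)
Import Defs.
Local Open Scope classical_set_scope.
Local Open Scope ring_scope.
Local Open Scope complex_scope.

(** * Modes *)

(** Two kinds of factors have to be divided out, in different ways. A factor z_i can be cancelled
    because the correlation function has no pole at z_i = 0, and each cancellation lowers the degree
    by one; this keeps the degree bounds independent of the auxiliary powers of z_i that
    associativity introduces, which grow with the modes of the other letters. A factor z_i - z_j is
    divided out by a geometric series that is finite on each coefficient, and this preserves the
    bound on the weight. The order n enters twice: n letters of one charge z form a neutral set
    since z^n = 1, and any n letters contain a neutral segment by a pigeonhole argument on partial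
    products. Induction along the solvable group applies the cyclic case to V^N, which has to be
    simple and of CFT-type again, so simplicity is carried along with cofiniteness. *)

Section Zbinom.
Context {K : numFieldType}.

Lemma zbinom_r0 (z : int) : zbinom K z 0 = 1.
Proof. by rewrite /zbinom big_ord0 fact0 divr1. Qed.

Lemma zbinom_0S i : zbinom K 0 i.+1 = 0.
Proof. by rewrite /zbinom big_ord_recl /= subr0 mul0r mul0r. Qed.

Lemma zbinom_nat (k i : nat) : zbinom K k i = 'C(k, i)%:R.
Proof.
have f0 : i`!%:R != 0 :> K by rewrite pnatr_eq0 -lt0n fact_gt0.
apply: (mulIf f0); rewrite /zbinom divfK // -natrM bin_ffact.
elim: i {f0} => [|i IH]; first by rewrite big_ord0 ffactn0.
rewrite big_ord_recr /= ffactnSr intrM IH natrM.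
have [ki|ik] := ltnP k i.
  by rewrite ffact_small // !mul0r.
by rewrite subzn // -pmulrn.
Qed.

Lemma zbinomN1 i : zbinom K (- 1) i = (-1) ^+ i.
Proof.
have f0 : i`!%:R != 0 :> K by rewrite pnatr_eq0 -lt0n fact_gt0.
apply: (mulIf f0); rewrite /zbinom divfK //.
elim: i {f0} => [|i IH]; first by rewrite big_ord0 fact0 expr0 mul1r.
rewrite big_ord_recr /= intrM IH factS natrM exprS.
have -> : (-1 - i%:Z)%:~R = - (i.+1%:R) :> K.
  by rewrite -opprD -intS rmorphN /= -pmulrn.
by rewrite !mulN1r !mulrN mulrAC mulNr -!mulrA [_ * (i.+1%:R * _)]mulrCA.
Qed.

End Zbinom.

Section Modes.
Context {R : realType} (V : voaType R).
Local Notation K := R[i].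
Implicit Types (a b c u v w : V) (m n p q : int).

HB.instance Definition _ u n :=
  GRing.isLinear.Build K V V _ (mode u n) (mode_linearr u n).

Definition rmode n v u := mode u n v.

HB.instance Definition _ n v :=
  GRing.isLinear.Build K V V _ (rmode n v) (mode_linearl n v).

Lemma mode0r a n : mode a n 0 = 0.
Proof. exact: linear0. Qed.
Lemma mode0l n v : mode 0 n v = 0.
Proof. exact: (linear0 (rmode n v)). Qed.
Lemma modeDr a n u v : mode a n (u + v) = mode a n u + mode a n v.
Proof. exact: linearD. Qed.
Lemma modeDl a b n v : mode (a + b) n v = mode a n v + mode b n v.
Proof. exact: (linearD (rmode n v)). Qed.
Lemma modeBr a n u v : mode a n (u - v) = mode a n u - mode a n v.
Proof. exact: linearB. Qed.
Lemma modeZr a n k v : mode a n (k *: v) = k *: mode a n v.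
Proof. exact: linearZ. Qed.
Lemma modeZl a n k v : mode (k *: a) n v = k *: mode a n v.
Proof. exact: (linearZ_LR (rmode n v)). Qed.
Lemma modeNl a n v : mode (- a) n v = - mode a n v.
Proof. exact: (linearN (rmode n v)). Qed.
Lemma mode_sumr (I : Type) (r : seq I) (F : I -> V) a n :
  mode a n (\sum_(i <- r) F i) = \sum_(i <- r) mode a n (F i).
Proof. exact: linear_sum. Qed.
Lemma mode_suml (I : Type) (r : seq I) (F : I -> V) n v :
  mode (\sum_(i <- r) F i) n v = \sum_(i <- r) mode (F i) n v.
Proof. exact: (linear_sum (rmode n v)). Qed.

Lemma mode_bound a v : exists N : nat, forall n, N%:Z <= n -> mode a n v = 0.
Proof.
have [N H] := mode_trunc a v; exists `|N|%N => n Nn; apply: H; lia.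
Qed.

(* The Borcherds identity at r = 0, p = 0, r = k with a_{k+i} b = 0, and p = k
   with a_{k+i} c = 0. *)
Lemma borcherds_comm a b p q c : exists N0 : nat, forall N, (N0 <= N)%N ->
  mode a p (mode b q c) = mode b q (mode a p c)
    + \sum_(i < N) zbinom K p i *: mode (mode a i%:Z b) (p + q - i%:Z) c.
Proof.
have [N0 H] := mode_borcherds a b c p q 0; exists N0.+1 => -[//|N] /ltnW NN.
have := H N.+1 NN => {H}.
under eq_bigr do rewrite add0r.
move=> ->; rewrite big_ord_recl big1 ?addr0 /=.
  by rewrite expr0 zbinom_r0 mulr1 scale1r expr0z scale1r addrC subrK.
by move=> i _; rewrite /bump leq0n add1n zbinom_0S mulr0 scale0r.
Qed.

Lemma borcherds_assoc a b r q c : exists N0 : nat, forall N, (N0 <= N)%N ->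
  mode (mode a r b) q c = \sum_(i < N) ((-1) ^+ i * zbinom K r i) *:
    (mode a (r - i%:Z) (mode b (q + i%:Z) c)
     - (-1) ^ r *: mode b (q + r - i%:Z) (mode a i%:Z c)).
Proof.
have [N0 H] := mode_borcherds a b c 0 q r; exists N0.+1 => -[//|N] /ltnW NN.
have := H N.+1 NN => {H}.
rewrite big_ord_recl big1 ?addr0 /=; last first.
  by move=> i _; rewrite /bump leq0n add1n zbinom_0S scale0r.
rewrite zbinom_r0 scale1r add0r ?subr0 ?addr0 => ->.
by apply: eq_bigr => i _; rewrite !add0r.
Qed.

Lemma borcherds_local (k : nat) a b p q c :
  (forall i : nat, mode a (k + i)%:Z b = 0) ->
  \sum_(i < k.+1) ((-1) ^+ i * 'C(k, i)%:R) *: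
    (mode a (p + k%:Z - i%:Z) (mode b (q + i%:Z) c)
     - (-1) ^+ k *: mode b (q + k%:Z - i%:Z) (mode a (p + i%:Z) c)) = 0 :> V.
Proof.
move=> ab0; have [N0 H] := mode_borcherds a b c p q k%:Z.
have {H} := H (k.+1 + N0)%N (leq_addl _ _).
rewrite big1; last by move=> i _; rewrite -PoszD ab0 mode0l scaler0.
rewrite big_split_ord /= [X in _ + X]big1 ?addr0; last first.
  by move=> i _; rewrite zbinom_nat bin_small ?mulr0 ?scale0r // ltn_addr.
by move=> /esym H; rewrite -[RHS]H; apply: eq_bigr => i _; rewrite zbinom_nat.
Qed.

Lemma borcherds_weak_assoc (k : nat) a b r q c :
  (forall i : nat, mode a (k + i)%:Z c = 0) ->
  exists N0 : nat, forall N, (N0 <= N)%N ->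
  \sum_(i < k.+1) 'C(k, i)%:R *: mode (mode a (r + i%:Z) b) (k%:Z + q - i%:Z) c
  = \sum_(i < N) ((-1) ^+ i * zbinom K r i) *:
      mode a (k%:Z + r - i%:Z) (mode b (q + i%:Z) c).
Proof.
move=> ac0; have [N0 H] := mode_borcherds a b c k%:Z q r.
exists (N0 + k.+1)%N => N NN.
have Nk : (k.+1 <= N)%N by apply: leq_trans NN; rewrite leq_addl.
have NN0 : (N0 <= N)%N by apply: leq_trans NN; rewrite leq_addr.
have {H} := H N NN0.
under [RHS]eq_bigr do rewrite -PoszD ac0 mode0r scaler0 subr0.
move=> <-; rewrite -(subnKC Nk) big_split_ord /= [X in _ = _ + X]big1 ?addr0.
  by apply: eq_bigr => i _; rewrite zbinom_nat.
by move=> i _; rewrite zbinom_nat bin_small ?scale0r // ltn_addr.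
Qed.

Definition wsp (n : int) : set V := @weight_space R V n.

Lemma wspE n v : wsp n v <-> mode conformal 1 v = n%:~R *: v.
Proof. by []. Qed.

Lemma subspace_wsp n : subspace (wsp n).
Proof.
split; first by apply/wspE; rewrite mode0r scaler0.
by move=> k u v /wspE ue /wspE ve; apply/wspE; rewrite modeDr modeZr ue ve scalerDr !scalerA mulrC.
Qed.

(** As C(1,i) = 0 for i > 1, the commutator with L(0) has two terms: [L(0), a_n] = (L(-1)a)_{n+1} +
    (L(0)a)_n. *)
Lemma mode_wsp p q a b n : wsp p a -> wsp q b -> wsp (p + q - n - 1) (mode a n b).
Proof.
move=> /wspE ae /wspE be; apply/wspE.
have [N0 /(_ N0.+2 (leqW (leqnSn _)))] := borcherds_comm conformal a 1 n b.
rewrite !big_ord_recl big1 ?addr0 /=; last first.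
  move=> i _; rewrite /bump !leq0n !add1n (zbinom_nat 1) bin_small ?scale0r //.
rewrite be modeZr !(zbinom_nat 1) !bin1 !scale1r ?subr0 => ->.
rewrite [bump 0 0]/= translation ae modeZl.
rewrite (_ : 1 + n - 1 = n); last by lia.
rewrite -scaleNr -!scalerDl.

rewrite (_ : p + q - n - 1 = q + (- (1 + n) + p)); last by lia.
by rewrite [in RHS]rmorphD [in RHS]rmorphD [in RHS]rmorphN.
Qed.

Lemma vacuum_wsp : wsp 0 vacuum.
Proof. exact: vacuum_weight. Qed.

Lemma wsp_uniq p q v : wsp p v -> wsp q v -> v != 0 -> p = q.
Proof.
move=> /wspE pe /wspE qe v0; move: qe; rewrite pe => /eqP.
by rewrite -subr_eq0 -scalerBl scaler_eq0 (negbTE v0) orbF -rmorphB intr_eq0 subr_eq0 => /eqP.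
Qed.

(* L(-1) *)
Definition trans v := mode (conformal : V) 0 v.

Lemma trans_mode a n v : trans (mode a n v) = mode a n (trans v) - n%:~R *: mode a (n - 1) v.
Proof.
have [N0 /(_ N0.+1 (leqnSn _))] := borcherds_comm conformal a 0 n v.
rewrite big_ord_recl big1 ?addr0 /=.
  by rewrite zbinom_r0 scale1r add0r /trans => ->; rewrite translation.
by move=> i _; rewrite /bump leq0n add1n zbinom_0S scale0r.
Qed.

Lemma trans_vac : trans vacuum = 0.
Proof. exact: mode_creation0. Qed.

End Modes.
(** * Formal distributions *)

Section Distributions.
Context {K : numFieldType} {V : lmodType K}.
Implicit Types (m : nat -> int) (f h : (nat -> int) -> V) (i j x : nat).
Implicit Types (t : nat * K * nat) (L : seq (nat * K * nat)) (w : seq (K * nat)).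

(* A function f : (nat -> int) -> V stands for the formal distribution
   \sum_m f(m) \prod_i z_i^{-m_i-1}; then f \o up i is its product with z_i. *)
Definition up i m : nat -> int := fun j => m j + (j == i)%:Z.
Definition dn i m : nat -> int := fun j => m j - (j == i)%:Z.

(* Multiplication by z_i + b z_j, for t = (i, b, j). *)
Definition fac t f m := f (up t.1.1 m) + t.1.2 *: f (up t.2 m).
Definition facs L f := foldr fac f L.

(* The derivation \sum_((c, i) <- w) c d/dz_i. *)
Definition deriv w f m := - \sum_(p <- w) (p.1 * (m p.2)%:~R) *: f (dn p.2 m).

Definition coef w i := \sum_(p <- w | p.2 == i) p.1.

Lemma upC i j m : up i (up j m) = up j (up i m).
Proof. by apply: funext => k; rewrite /up addrAC. Qed.

Lemma dnC i j m : dn i (dn j m) = dn j (dn i m).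
Proof. by apply: funext => k; rewrite /dn addrAC. Qed.

Lemma updn i j m : up i (dn j m) = dn j (up i m).
Proof. by apply: funext => k; rewrite /up /dn addrAC. Qed.

Lemma updnK i m : up i (dn i m) = m.
Proof. by apply: funext => k; rewrite /up /dn subrK. Qed.

Lemma dnupK i m : dn i (up i m) = m.
Proof. by apply: funext => k; rewrite /up /dn addrK. Qed.

Lemma facC t t' f : fac t (fac t' f) = fac t' (fac t f).
Proof.
apply: funext => m; rewrite /fac !scalerDr !scalerA (upC t.1.1) (upC t.2).
by rewrite (upC t.1.1 t'.2) (upC t.2 t'.2) [t.1.2 * _]mulrC addrACA.
Qed.

Lemma facs_fac L t f : facs L (fac t f) = fac t (facs L f).
Proof. by elim: L => //= t' L ->; rewrite facC. Qed.

Lemma facs_cat L L' f : facs (L ++ L') f = facs L (facs L' f).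
Proof. by rewrite /facs foldr_cat. Qed.

Lemma facsC L L' f : facs L (facs L' f) = facs L' (facs L f).
Proof. by elim: L' => //= t L' <-; rewrite facs_fac. Qed.

Lemma facs_perm L L' f : perm_eq L L' -> facs L f = facs L' f.
Proof.
move=> pLL'; apply: (catCA_perm_ind (P := fun s => facs L f = facs s f)) pLL' _ => //.
by move=> s1 s2 s3 ->; rewrite !facs_cat facsC.
Qed.

Lemma derivD w f h : deriv w (fun m => f m + h m) = fun m => deriv w f m + deriv w h m.
Proof.
apply: funext => m; rewrite /deriv -opprD -big_split /=; congr (- _).
by apply: eq_bigr => p _; rewrite scalerDr.
Qed.

Lemma derivZ w (c : K) f : deriv w (fun m => c *: f m) = fun m => c *: deriv w f m.
Proof.
apply: funext => m; rewrite /deriv scalerN scaler_sumr; congr (- _).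
by apply: eq_bigr => p _; rewrite !scalerA mulrC.
Qed.

Lemma iter_derivD n w f h : iter n (deriv w) (fun m => f m + h m) =
  fun m => iter n (deriv w) f m + iter n (deriv w) h m.
Proof. by elim: n => //= n ->; rewrite derivD. Qed.

Lemma deriv_up w i f : deriv w (f \o up i) =
  fun m => deriv w f (up i m) + coef w i *: f m.
Proof.
apply: funext => m; rewrite /deriv /coef /= scaler_suml.
rewrite [X in - _ + X]big_mkcond /= -[X in _ + X]opprK -opprD -sumrB; congr (- _).
apply: eq_bigr => p _; rewrite updn (_ : up i m p.2 = m p.2 + (p.2 == i)%:Z) //.
case: eqP => [->|_]; last by rewrite addr0 subr0.
by rewrite rmorphD /= mulrDr scalerDl mulr1 dnupK addrK.
Qed.

Lemma deriv_fac w t f : deriv w (fac t f) = fun m =>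
  fac t (deriv w f) m + (coef w t.1.1 + t.1.2 * coef w t.2) *: f m.
Proof.
rewrite (_ : fac t f = fun m => (f \o up t.1.1) m + t.1.2 *: (f \o up t.2) m) //.
rewrite derivD derivZ !deriv_up; apply: funext => m.
by rewrite /fac scalerDr addrACA scalerA -scalerDl.
Qed.

(** Leibniz rule: a linear form has constant derivative, so only two terms survive. *)
Lemma iter_deriv_fac n w t f : iter n.+1 (deriv w) (fac t f) = fun m =>
  fac t (iter n.+1 (deriv w) f) m
  + (n.+1%:R * (coef w t.1.1 + t.1.2 * coef w t.2)) *: iter n (deriv w) f m.
Proof.
elim: n => [|n IH]; first by rewrite /= deriv_fac mul1r.
rewrite iterS IH derivD derivZ deriv_fac -iterS; apply: funext => m.
rewrite -addrA -iterS -scalerDl; congr (_ + _ *: _).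
by rewrite -[n.+2%:R]natr1 mulrDl mul1r addrC.
Qed.

Lemma deriv_comm w w' f : deriv w (deriv w' f) = deriv w' (deriv w f).
Proof.
apply: funext => m; rewrite /deriv; congr (- _).
under eq_bigr do rewrite scalerN scaler_sumr.
under [RHS]eq_bigr do rewrite scalerN scaler_sumr.
rewrite !sumrN exchange_big /=; congr (- _).
apply: eq_bigr => p _; apply: eq_bigr => q _; rewrite !scalerA dnC.
congr (_ *: _); rewrite mulrACA [RHS]mulrACA [p.1 * q.1]mulrC; congr (_ * _).
rewrite -!intrM /dn; congr (_%:~R); rewrite [q.2 == p.2]eq_sym.
by case: eqP => [->|_]; rewrite ?subr0 // mulrC.
Qed.

Lemma deriv_cat w w' f : deriv (w ++ w') f = fun m => deriv w f m + deriv w' f m.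
Proof. by apply: funext => m; rewrite /deriv big_cat opprD. Qed.

Lemma iter_comm w w' n f : iter n (deriv w') (deriv w f) = deriv w (iter n (deriv w') f).
Proof. by elim: n => //= n ->; rewrite deriv_comm. Qed.

(** * Degree along a derivation, modulo a subspace *)

Section Modulo.
Variables (C : set V) (sC : subspace C) (Q : set (nat -> int)).

(** The restriction to indices in [Q] is needed in [lies_corr]: truncation of a field on a product
    of other fields is uniform only when their modes are bounded below. *)
Definition lies f := forall m, Q m -> C (f m).

Lemma sub0 : C 0. Proof. by case: sC. Qed.
Lemma subZ (c : K) v : C v -> C (c *: v). Proof. exact: subspaceZ. Qed.
Lemma subN v : C v -> C (- v). Proof. by rewrite -scaleN1r; exact: subZ. Qed.
Lemma subD u v : C u -> C v -> C (u + v). Proof. exact: subspaceD. Qed.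

Definition upclosed (s : seq nat) := forall m i, i \in s -> Q m -> Q (up i m).
Definition dnclosed (s : seq nat) := forall m i, i \in s -> Q m -> Q (dn i m).
Definition fidx L := flatten [seq [:: t.1.1; t.2] | t <- L].
Definition didx w := [seq p.2 | p <- w].

Lemma lies_fac t f : upclosed [:: t.1.1; t.2] -> lies f -> lies (fac t f).
Proof.
move=> uQ fC m Qm; apply: subD; last apply: subZ; apply: fC; apply: uQ => //;
by rewrite !inE eqxx ?orbT.
Qed.

Lemma lies_deriv w f : dnclosed (didx w) -> lies f -> lies (deriv w f).
Proof.
move=> dQ fC m Qm; apply: subN; apply: subspace_sum => // p pw.
by apply: subZ; apply: fC; apply: dQ => //; apply: map_f.
Qed.

Lemma lies_iter n w f : dnclosed (didx w) -> lies f -> lies (iter n (deriv w) f).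
Proof. by move=> dQ fC; elim: n => //= n IH; apply: lies_deriv. Qed.

(* Multiplying by a linear form raises the degree along w by at most one. *)
Lemma lies_deg_fac n w t f : upclosed [:: t.1.1; t.2] -> dnclosed (didx w) ->
  lies (iter n (deriv w) f) -> lies (iter n.+1 (deriv w) (fac t f)).
Proof.
move=> uQ dQ fC; rewrite iter_deriv_fac => m Qm; apply: subD.
  by apply: lies_fac => //; apply: lies_deriv.
by apply: subZ; apply: fC.
Qed.

Lemma lies_deg_facs n w L f : upclosed (fidx L) -> dnclosed (didx w) ->
  lies (iter n (deriv w) f) -> lies (iter (size L + n) (deriv w) (facs L f)).
Proof.
move=> uQ dQ fC; elim: L uQ => //= t L IH uQ.
have uL : upclosed (fidx L).
  by move=> m i iL; apply: uQ; rewrite /= !inE iL !orbT.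
apply: lies_deg_fac (IH uL) => // m i; rewrite !inE => it; apply: uQ.
by rewrite /= !inE orbA it.
Qed.

(** Binomial argument for commuting derivations, by induction on n + n': one factor D + D' is split
    off, and the statement is applied to D f and to D' f. *)
Lemma lies_nil_cat n n' w w' f : dnclosed (didx w) -> dnclosed (didx w') ->
  lies (iter n (deriv w) f) -> lies (iter n' (deriv w') f) ->
  lies (iter (n + n') (deriv (w ++ w')) f).
Proof.
move=> dw dw'.
have dww : dnclosed (didx (w ++ w')).
  by move=> m i; rewrite /didx map_cat mem_cat => /orP[/dw|/dw']; apply.
have [s] := ubnP (n + n'); elim: s n n' f => // s IH n n' f; rewrite ltnS => ns fC fC'.
case: n ns fC => [|n] ns fC; first exact: lies_iter.
case: n' ns fC' => [|n'] ns fC'; first exact: lies_iter.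
rewrite addSn iterSr deriv_cat iter_derivD => m Qm; apply: subD.
  apply: IH => //; first by move: fC; rewrite iterSr.
  by rewrite iter_comm; apply: lies_deriv.
rewrite -addSnnS; apply: IH => //; first by rewrite addSnnS.
  by rewrite iter_comm; apply: lies_deriv.
by move: fC'; rewrite iterSr.
Qed.

(** No pole at z_x = 0, since the index m x belongs to the power -(m x) - 1 of z_x. *)
Definition vanishes_above x f := forall m, 0 <= m x -> f m = 0.

Lemma vanishes_fac x t f : vanishes_above x f -> vanishes_above x (fac t f).
Proof.
by move=> fx m mx; rewrite /fac !fx ?scaler0 ?addr0 // /up; case: eqP; lia.
Qed.

Lemma vanishes_deriv x w f : vanishes_above x f -> vanishes_above x (deriv w f).
Proof.
move=> fx m mx; rewrite /deriv big1 ?oppr0 // => p _.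
have [->|px] := eqVneq (m p.2) 0; first by rewrite mulr0 scale0r.
by rewrite fx ?scaler0 // /dn; case: (x =P p.2) px => [<-|]; lia.
Qed.

Lemma vanishes_iter n x w f : vanishes_above x f -> vanishes_above x (iter n (deriv w) f).
Proof. by move=> fx; elim: n => //= n IH; apply: vanishes_deriv. Qed.

(* If z_x f has degree at most n along w, then f, having no pole at z_x = 0,
   has degree at most n - 1. *)
Lemma lies_cancel n w x f : upclosed [:: x] -> dnclosed (didx w) -> coef w x = 1 ->
  vanishes_above x f ->
  lies (iter n.+1 (deriv w) (fac (x, 0, x) f)) -> lies (iter n (deriv w) f).
Proof.
move=> uQ dQ wx fx; rewrite iter_deriv_fac /= wx mul0r addr0 mulr1.
set u := iter n (deriv w) f => uC m.
have ux : vanishes_above x u by apply: vanishes_iter.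
have [k] := ubnP `|m x|%N; elim: k m => // k IH m; rewrite ltnS => mk Qm.
have [mx|mx] := leP 0 (m x); first by rewrite ux //; apply: sub0.
have := uC m Qm; rewrite /fac scale0r addr0 /deriv.
rewrite (bigID (fun p => p.2 == x)) /=.
rewrite (eq_bigr (fun p => (p.1 * (m x + 1)%:~R) *: u m)); last first.
  by move=> p /eqP ->; rewrite dnupK /up eqxx.
rewrite -scaler_suml -mulr_suml -/(coef w x) wx mul1r opprD addrAC -scaleNr -scalerDl => H.
(* The coefficient of [u m] is n - m x, positive because m x < 0. The other terms have m x raised by
   one and are covered by the induction on its absolute value. *)
have n0 : - (m x + 1)%:~R + n.+1%:R != 0 :> K.
  rewrite (_ : - (m x + 1)%:~R + n.+1%:R = (- (m x + 1) + n.+1%:Z)%:~R); last first.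
    by rewrite [in RHS]rmorphD [in RHS]rmorphN.
  by rewrite intr_eq0; lia.
rewrite -[u m](scalerK n0); apply: subZ.
rewrite -[X in C X](subrK
  (\sum_(p <- w | p.2 != x) (p.1 * (up x m p.2)%:~R) *: u (dn p.2 (up x m)))).
rewrite -[X in X + _]addrC addrC.
set S := \sum_(p <- w | _) _ in H *.
have SC : C S.
  rewrite /S -big_filter; apply: subspace_sum => // p; rewrite mem_filter => /andP[px pw].
  apply: subZ; rewrite -updn; apply: IH.
    by rewrite /up /dn eqxx [x == _]eq_sym (negbTE px); lia.
  by apply: uQ; rewrite ?inE //; apply: dQ => //; apply: map_f.
by rewrite addrC [- S + _]addrC; apply: subD.
Qed.

End Modulo.

(* Mod C, a distribution killed by a power of d/dz_i is a polynomial in z_i. *)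
Lemma lies_poly C n i f : subspace C ->
  lies C setT (iter n (deriv [:: (1, i)]) f) -> forall m, m i < - n%:Z -> C (f m).
Proof.
move=> sC; elim: n f => [|n IH] f; first by move=> fC m _; apply: fC.
rewrite iterSr => /IH {}IH m mi.
have := IH (up i m); rewrite /up eqxx => /(_ ltac:(lia)).
rewrite /deriv big_seq1 /= dnupK mul1r -scaleNr => H.
have n0 : - (up i m i)%:~R != 0 :> K by rewrite oppr_eq0 intr_eq0 /up eqxx; lia.
by rewrite -[f m](scalerK n0); apply: subspaceZ.
Qed.

Lemma lies_congr s (Q : set (nat -> int)) n w f h : dnclosed Q s -> {subset didx w <= s} ->
  (forall m, Q m -> f m = h m) ->
  forall m, Q m -> iter n (deriv w) f m = iter n (deriv w) h m.
Proof.
move=> dQ ws fh; elim: n => //= n IH m Qm; rewrite /deriv; congr (- _).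
rewrite big_seq [RHS]big_seq; apply: eq_bigr => p pw; rewrite IH //.
by apply: dQ => //; apply: ws; apply: map_f.
Qed.

Lemma facs_congr s (Q : set (nat -> int)) L f h : upclosed Q s -> {subset fidx L <= s} ->
  (forall m, Q m -> f m = h m) -> forall m, Q m -> facs L f m = facs L h m.
Proof.
move=> uQ Ls fh; elim: L Ls => //= t L IH Ls m Qm.
have Ls' : {subset fidx L <= s} by move=> i iL; apply: Ls; rewrite !inE iL !orbT.
by rewrite /fac !(IH Ls') //; apply: uQ => //; apply: Ls; rewrite !inE eqxx ?orbT.
Qed.

End Distributions.
(** * Words and locality *)

(** Transpositions of neighbours generate all permutations. It serves both for locality of
    correlation functions and for reordering monomials modulo lower filtration. *)
Lemma perm_eq_rel_ind (T : eqType) (P : seq T -> seq T -> Prop) :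
  (forall s, P s s) -> (forall x s s', P s s' -> P (x :: s) (x :: s')) ->
  (forall x y s, P [:: x, y & s] [:: y, x & s]) ->
  (forall s1 s2 s3, P s1 s2 -> P s2 s3 -> P s1 s3) ->
  forall s s', perm_eq s s' -> P s s'.
Proof.
move=> Pr Pc Ps Pt; elim=> [|x s IH] s' ss'.
  by move: ss'; rewrite perm_sym => /perm_nilP ->.
have xs' : x \in s' by rewrite -(perm_mem ss') mem_head.
case/splitPr: xs' ss' => s1 s2; rewrite -(cat1s x s2) perm_sym perm_catCA /= perm_cons perm_sym.
move=> /IH/(Pc x) ss; apply: (Pt _ _ _ ss); elim: (s1) => //= y s0 IH1.
by apply: (Pt _ _ _ (Ps _ _ _)); apply: Pc.
Qed.

Lemma perm_sub (T : eqType) (S l : seq T) : uniq S -> uniq l -> {subset S <= l} ->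
  perm_eq l (S ++ [seq x <- l | x \notin S]).
Proof.
move=> uS ul Sl.
apply: perm_trans (_ : perm_eq ([seq x <- l | x \in S] ++ [seq x <- l | x \notin S]) _).
  by rewrite perm_sym (perm_filterC (mem S)).
rewrite perm_cat2r; apply: uniq_perm => //; first by rewrite filter_uniq.
by move=> x; rewrite mem_filter; case xS : (x \in S) => //=; apply: Sl.
Qed.

Section Words.
Context {R : realType} (V : voaType R).
Local Notation K := R[i].
Implicit Types (m : nat -> int) (f : (nat -> int) -> V) (x y : nat * V) (l : seq (nat * V)).
Implicit Types (a b c v : V) (k : nat) (s : seq nat).

Definition app x f m := mode x.2 (m x.1) (f m).

(** A letter (i, a) stands for the field Y(a, z_i), so this is a product of fields applied to c, as
    a distribution. *)
Definition word l c m := foldr (fun x v => mode x.2 (m x.1) v) c l.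

Definition idx l := [seq x.1 | x <- l].

(** The product of the (z_i + b z_j)^k over j in s, as a list of linear factors. *)
Definition cross k (b : K) (i : nat) s : seq (nat * K * nat) :=
  flatten [seq nseq k (i, b, j) | j <- s].

Fixpoint vander k s : seq (nat * K * nat) :=
  if s is i :: s' then cross k (-1) i s' ++ vander k s' else [::].

(* \prod_(i < j) (z_i - z_j)^k Y(a_1, z_1) ... Y(a_r, z_r) c *)
Definition corr k l c := facs (vander k (idx l)) (word l c).

Lemma word_cons x l c : word (x :: l) c = app x (word l c).
Proof. by []. Qed.

Lemma word_cat l l' c m : word (l ++ l') c m = word l (word l' c m) m.
Proof. by rewrite /word foldr_cat. Qed.

Lemma word_ext l c m m' : {in idx l, m =1 m'} -> word l c m = word l c m'.
Proof.
elim: l => //= x l IH mm'; rewrite mm' ?mem_head // IH // => i il.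
by apply: mm'; rewrite inE il orbT.
Qed.

Lemma word0 l m : word l 0 m = 0.
Proof. by elim: l => //= x l ->; rewrite mode0r. Qed.

Lemma wordD l c c' m : word l (c + c') m = word l c m + word l c' m.
Proof. by elim: l => //= x l ->; rewrite modeDr. Qed.

Lemma wordZ l (k : K) c m : word l (k *: c) m = k *: word l c m.
Proof. by elim: l => //= x l ->; rewrite modeZr. Qed.

Lemma app_fac x t f : x.1 != t.1.1 -> x.1 != t.2 -> app x (fac t f) = fac t (app x f).
Proof.
move=> xi xj; apply: funext => m; rewrite /app /fac modeDr modeZr /up.
by rewrite (negbTE xi) (negbTE xj) !addr0.
Qed.

Lemma app_facs x L f : x.1 \notin fidx L -> app x (facs L f) = facs L (app x f).
Proof.
elim: L => //= t L IH; rewrite !inE !negb_or => /and3P[x1 x2 xL].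
by rewrite app_fac // IH.
Qed.

Lemma fidx_cat (L L' : seq (nat * K * nat)) : fidx (L ++ L') = fidx L ++ fidx L'.
Proof. by rewrite /fidx map_cat flatten_cat. Qed.

Lemma fidx_nseq k t : {subset fidx (nseq k t : seq (nat * K * nat)) <= [:: t.1.1; t.2]}.
Proof. by elim: k => //= k IH i; rewrite !inE orbA => /orP[//|/IH]; rewrite !inE. Qed.

Lemma fidx_cross k (b : K) i s : {subset fidx (cross k b i s) <= i :: s}.
Proof.
elim: s => //= j s IH; rewrite /cross /= fidx_cat => x; rewrite mem_cat.
move=> /orP[/fidx_nseq|/IH]; rewrite !inE; first by rewrite orbA => ->.
by case/orP => ->; rewrite ?orbT.
Qed.

Lemma fidx_vander k s : {subset fidx (vander k s) <= s}.
Proof.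
elim: s => //= i s IH x; rewrite fidx_cat mem_cat => /orP[/fidx_cross //|/IH].
by rewrite inE orbC => ->.
Qed.

Lemma facs_nseq k i (b : K) j f m : facs (nseq k (i, b, j)) f m =
  \sum_(h < k.+1) ('C(k, h)%:R * b ^+ h) *:
    f (fun e => m e + ((k - h) * (e == i))%N%:Z + (h * (e == j))%N%:Z).
Proof.
elim: k m => [|k IH] m.
  rewrite big_ord1 /= expr0 mulr1 bin0 scale1r; congr f.
  by apply: funext => e; rewrite !addr0.
rewrite /= /fac !IH /=.
set G := fun h => f (fun e => m e + ((k.+1 - h) * (e == i))%N%:Z + (h * (e == j))%N%:Z).
transitivity (\sum_(h < k.+1) ('C(k, h)%:R * b ^+ h) *: G h
              + \sum_(h < k.+1) ('C(k, h)%:R * b ^+ h.+1) *: G h.+1).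
  congr (_ + _); last rewrite scaler_sumr.
    apply: eq_bigr => h _; congr (_ *: f _); apply: funext => e; rewrite /up.
    by have := ltn_ord h; case: (e =P i); case: (e =P j); lia.
  apply: eq_bigr => h _; rewrite scalerA mulrCA -exprS; congr (_ *: f _); apply: funext => e.
  by rewrite /up; have := ltn_ord h; case: (e =P i); case: (e =P j); lia.
rewrite [RHS]big_ord_recl /= bin0 expr0 mulr1.
under [X in _ = _ + X]eq_bigr do rewrite /bump leq0n add1n binS natrD mulrDl scalerDl.
rewrite big_split addrA; congr (_ + _).
rewrite [LHS]big_ord_recl /= bin0 expr0 mulr1; congr (_ + _).
rewrite [RHS]big_ord_recr /= bin_small // mul0r scale0r addr0.
by apply: eq_bigr.
Qed.

Definition local k l := forall x y, x \in l -> y \in l ->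
  forall i : nat, mode x.2 (k + i)%:Z y.2 = 0.

(** For even k the factor (z_x - z_y)^k is symmetric, so locality exchanges the two fields without a
    sign. *)
Lemma local_swap k x y l c : ~~ odd k -> x.1 != y.1 ->
  x.1 \notin idx l -> y.1 \notin idx l ->
  (forall i : nat, mode x.2 (k + i)%:Z y.2 = 0) ->
  facs (nseq k (x.1, -1, y.1)) (word [:: x, y & l] c)
  = facs (nseq k (y.1, -1, x.1)) (word [:: y, x & l] c).
Proof.
move=> ek xy xl yl loc; apply: funext => m; rewrite !facs_nseq.
have := @borcherds_local R V k x.2 y.2 (m x.1) (m y.1) (word l c m) loc.
under eq_bigr do rewrite scalerBr.
rewrite sumrB => /eqP; rewrite subr_eq0 => /eqP H.
transitivity (\sum_(i < k.+1) ((-1) ^+ i * 'C(k, i)%:R) *: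
        mode x.2 (m x.1 + k%:Z - i%:Z) (mode y.2 (m y.1 + i%:Z) (word l c m))).
  apply: eq_bigr => h _; rewrite mulrC /=.
  rewrite (@word_ext l c _ m); last first.
    move=> j jl; case: (j =P x.1) => [jx|_]; first by rewrite -jx jl in xl.
    case: (j =P y.1) => [jy|_]; first by rewrite -jy jl in yl.
    by rewrite !muln0 !addr0.
  rewrite !eqxx (negbTE xy) eq_sym (negbTE xy) !muln0 !muln1 !addr0.
  by congr (_ *: mode _ _ _); have := ltn_ord h; lia.
rewrite H -signr_odd (negbTE ek) expr0; apply: eq_bigr => h _; rewrite scale1r mulrC /=.
rewrite [in RHS](@word_ext l c _ m); last first.
  move=> j jl; case: (j =P x.1) => [jx|_]; first by rewrite -jx jl in xl.
  case: (j =P y.1) => [jy|_]; first by rewrite -jy jl in yl.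
  by rewrite !muln0 !addr0.
rewrite !eqxx (negbTE xy) eq_sym (negbTE xy) !muln0 !muln1 !addr0.
by congr (_ *: mode _ _ _); have := ltn_ord h; lia.
Qed.

Lemma cross_perm k (b : K) i s s' : perm_eq s s' -> perm_eq (cross k b i s) (cross k b i s').
Proof. by move=> ss'; apply: perm_flatten; apply: perm_map. Qed.

Lemma corr_perm k l l' c : ~~ odd k -> uniq (idx l) -> local k l -> perm_eq l l' ->
  corr k l c = corr k l' c.
Proof.
move=> ek ul loc pll'.
(* The relation carries [perm_eq] along, so that uniqueness and locality can be transported in the
   transitive case. *)
pose P l l' := perm_eq l l' /\
  (uniq (idx l) -> local k l -> corr k l c = corr k l' c).
suff: P l l' by case=> _; apply.
apply: perm_eq_rel_ind pll' => {l l' ul loc}.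
- by move=> l; split.
- move=> x l l' [pll' IH]; split; first by rewrite perm_cons.
  move=> /= /andP[xl ul] loc; rewrite /corr /= !facs_cat !word_cons.
  have xl' : x.1 \notin idx l' by rewrite -(perm_mem (perm_map fst pll')).
  have nf (l0 : seq (nat * V)) : x.1 \notin idx l0 -> x.1 \notin fidx (vander k (idx l0)).
    by apply: contra; apply: fidx_vander.
  rewrite -[X in facs _ X = _]app_facs ?nf // -[X in _ = facs _ X]app_facs ?nf //.
  rewrite (facs_perm _ (cross_perm _ _ _ (perm_map fst pll'))); congr (facs _ (app _ _)).
  by apply: IH => // y z yl zl; apply: loc; rewrite inE ?yl ?zl orbT.
- move=> x y l; split.
    by rewrite -[x :: _]cat1s -[y :: l]cat1s perm_catCA.
  move=> /= /and3P[]; rewrite inE negb_or => /andP[xy xl] yl ul loc.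
  rewrite /corr /=.
  set A := cross k (-1) x.1 (idx l); set B := cross k (-1) y.1 (idx l); set D := vander k _.
  have E (i j : nat) (L L' : seq (nat * K * nat)) f :
      facs ((nseq k (i, -1, j) ++ L) ++ L' ++ D) f
      = facs L (facs L' (facs D (facs (nseq k (i, -1, j)) f))).
    by rewrite !facs_cat facsC; congr facs; rewrite facsC; congr facs; rewrite facsC.
  rewrite !{1}E local_swap //; first by rewrite facsC.
  by apply: loc; rewrite !inE eqxx ?orbT.
- move=> l1 l2 l3 [p12 H12] [p23 H23]; split; first exact: perm_trans p12 p23.
  move=> u1 loc1; rewrite H12 // H23 //; first by rewrite -(perm_uniq (perm_map fst p12)).
  by move=> x y xl yl; apply: loc1; rewrite (perm_mem p12).
Qed.

Lemma vanishes_facs i L f : vanishes_above i f -> vanishes_above i (facs L f).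
Proof. by move=> fi; elim: L => //= t L IH; apply: vanishes_fac. Qed.

Lemma vanishes_app i x f : vanishes_above i f -> vanishes_above i (app x f).
Proof. by move=> fi m mi; rewrite /app fi // mode0r. Qed.

(* Locality lets any letter be moved next to the vacuum. *)
Lemma vanishes_corr k l x : ~~ odd k -> uniq (idx l) -> local k l -> x \in l ->
  vanishes_above x.1 (corr k l vacuum).
Proof.
move=> ek ul loc xl.
have pl : perm_eq l (rcons (rem x l) x).
  by apply: perm_trans (perm_to_rem xl) _; rewrite perm_sym perm_rcons.
rewrite (@corr_perm k l (rcons (rem x l) x)) //; apply: vanishes_facs.
elim: (rem x l) => [|y l' IH] /=; last exact: vanishes_app.
by move=> m mx; rewrite /word /= mode_creation0.
Qed.

(** Finitely many pairs of letters have a common truncation bound; doubling it makes it even. *)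
Lemma local_ex l : exists k, ~~ odd k /\ local k l.
Proof.
have H x y : exists N : nat, forall n, N%:Z <= n -> mode x.2 n y.2 = 0.
  exact: mode_bound.
have [N NP] := choice (fun xy => H xy.1 xy.2).
pose k := \max_(p <- [seq (x, y) | x <- l, y <- l]) N p.
exists k.*2; split; first by rewrite odd_double.
move=> x y xl yl i; apply: (NP (x, y)).
have : (N (x, y) <= k)%N.
  by apply: (leq_bigmax_seq (F := N)) => //; apply: allpairs_f.
lia.
Qed.

End Words.
(** * Associativity *)

Section Associativity.
Context {R : realType} (V : voaType R).
Local Notation K := R[i].
Implicit Types (m : nat -> int) (f g : (nat -> int) -> V) (x y : nat * V) (l : seq (nat * V)).
Implicit Types (a b c v : V) (k : nat) (s : seq nat).

Definition dirs s : seq (K * nat) := [seq (1, i) | i <- s].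

(** The product of the z_i^k over i in s, where z_i is written as z_i + 0 z_i. *)
Definition shifts k s : seq (nat * K * nat) := flatten [seq nseq k (i, 0, i) | i <- s].

Lemma didx_dirs s : didx (dirs s) = s.
Proof. by rewrite /didx /dirs -map_comp map_id. Qed.

Lemma coef_dirs s i : uniq s -> coef (dirs s) i = (i \in s)%:R.
Proof.
rewrite /coef /dirs big_map /=; elim: s => [|j s IH] /=; first by rewrite big_nil.
case/andP=> js us; rewrite big_cons IH // inE eq_sym.
by case: eqP => [->|_] //=; rewrite (negbTE js) addr0.
Qed.

Lemma facs_shifts k s f m : uniq s ->
  facs (shifts k s) f m = f (fun e => m e + (k * (e \in s))%N%:Z).
Proof.
elim: s m => [|i s IH] m /=.
  by move=> _; congr f; apply: funext => e; rewrite muln0 addr0.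
case/andP=> si us; rewrite /shifts /= facs_cat facs_nseq big_ord_recl big1 ?addr0.
  rewrite bin0 expr0 mulr1 scale1r IH //; congr f; apply: funext => e /=.
  by rewrite inE; case: (e =P i) => [->|_] /=; rewrite ?(negbTE si); lia.
by move=> j _; rewrite expr0n mulr0 scale0r.
Qed.

Lemma size_shifts k s : size (shifts k s) = (size s * k)%N.
Proof. by rewrite /shifts; elim: s => //= i s IH; rewrite size_cat size_nseq IH mulSn. Qed.

Lemma size_cross k (b : K) i s : size (cross k b i s) = (size s * k)%N.
Proof. by rewrite /cross; elim: s => //= j s IH; rewrite size_cat size_nseq IH mulSn. Qed.

Lemma mem_cross k (b : K) i s u :
  u \in cross k b i s -> [/\ u.1.1 = i, u.1.2 = b & u.2 \in s].
Proof.
elim: s => // j s IH; rewrite /cross /= mem_cat => /orP[|/IH[-> -> us]].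
  by rewrite mem_nseq => /andP[_ /eqP ->]; rewrite mem_head.
by rewrite inE us orbT.
Qed.

(** L(-1) kills the vacuum and differentiates each field, hence acts as the simultaneous translation
    of all points. *)
Lemma trans_word l m : uniq (idx l) ->
  trans (word l vacuum m) = deriv (dirs (idx l)) (word l vacuum) m.
Proof.
rewrite /deriv /dirs big_map; elim: l => [|x l IH] /=; first by rewrite big_nil oppr0 trans_vac.
case/andP=> xl ul; rewrite trans_mode IH // big_cons /= mul1r opprD addrC; congr (_ + _).
  rewrite -(@word_ext _ _ l vacuum (dn x.1 m)); last first.
    by move=> j jl; rewrite /dn; case: eqP jl xl => [->|_ _ _]; [move->|rewrite subr0].
  by rewrite /dn eqxx.
rewrite -scaleN1r modeZr scaleN1r mode_sumr; congr (- _).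
rewrite big_seq [RHS]big_seq; apply: eq_bigr => i il; rewrite modeZr /dn.
by case: eqP xl => [->|_]; rewrite ?il // subr0.
Qed.

(** * Weak associativity for a product of fields acting on a vector *)

Section OneVector.
Variables (t : nat) (k : nat) (c : V).

(* Y(Y(a_1, z_1) ... Y(a_s, z_s) 1, z_t) c *)
Definition iterate l m := mode (word l vacuum m) (m t) c.

Definition clear l := facs (cross k 1 t (idx l)) (iterate l).

(** This says f = (z_x + z_t)^k Y(x, z_x + z_t) g, with powers of z_x + z_t expanded in nonnegative
    powers of z_t; the coefficient is C(i-r-1, i) = (-1)^i C(r, i) for r = m x. *)
Definition expands x f g := forall m, exists N0 : nat, forall N, (N0 <= N)%N ->
  f m = \sum_(i < N) ((-1) ^+ i * zbinom K (m x.1) i) *: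
    mode x.2 (k%:Z + m x.1 - i%:Z) (g (fun e => m e + (i * (e == t))%N%:Z)).

Lemma expands_facs x f g s : x.1 != t -> x.1 \notin s -> expands x f g ->
  expands x (facs (cross k 1 t s) f) (facs (cross k 1 t s) g).
Proof.
move=> xt xs fg.
have : forall u, u \in cross k (1 : K) t s -> [/\ u.1.1 = t, u.1.2 = 1 & x.1 != u.2].
  by move=> u /mem_cross[-> -> us]; split=> //; apply: contraNneq xs => ->.
elim: (cross _ _ _ _) => //= u L IH uL.
have {}IH : expands x (facs L f) (facs L g) by apply: IH => v vL; apply: uL; rewrite inE vL orbT.
have [] := uL u (mem_head _ _); case: u {uL} => [[u1 u2] j] /= -> -> xj m.
have [N1 H1] := IH (up t m); have [N2 H2] := IH (up j m).
exists (maxn N1 N2) => N; rewrite geq_max => /andP[/H1 E1 /H2 E2].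
rewrite /fac /= E1 E2 scale1r -big_split; apply: eq_bigr => i _ /=.
rewrite (_ : up t m x.1 = m x.1); last by rewrite /up (negbTE xt) addr0.
rewrite (_ : up j m x.1 = m x.1); last by rewrite /up (negbTE xj) addr0.
rewrite -scalerDr -modeDr scale1r.
by congr (_ *: mode _ _ (facs L g _ + facs L g _)); apply: funext => e; rewrite /up addrAC.
Qed.

(** The factor (z_t + z_x)^k of the new letter is consumed by weak associativity; the other factors
    do not involve z_x and pass through. *)
Lemma expands_cons x l : x.1 != t -> x.1 \notin idx l -> t \notin idx l ->
  (forall i : nat, mode x.2 (k + i)%:Z c = 0) ->
  expands x (clear (x :: l)) (clear l).
Proof.
move=> xt xl tl xc; rewrite /clear {1}/cross /= facs_cat facsC.
apply: expands_facs => // m.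
have [N0 H] := borcherds_weak_assoc (word l vacuum m) (m x.1) (m t) xc.
have E i j : word l vacuum (fun e => m e + (i * (e == t))%N%:Z + (j * (e == x.1))%N%:Z)
             = word l vacuum m.
  apply: word_ext => e el; case: (e =P t) => [et|_]; first by rewrite -et el in tl.
  case: (e =P x.1) => [ex|_]; first by rewrite -ex el in xl.
  by rewrite !muln0 !addr0.
exists N0 => N /H {}H; rewrite facs_nseq; transitivity (\sum_(i < k.+1)
  'C(k, i)%:R *: mode (mode x.2 (m x.1 + i%:Z) (word l vacuum m)) (k%:Z + m t - i%:Z) c).
  apply: eq_bigr => i _; rewrite expr1n mulr1 /iterate /= E !eqxx.
  rewrite (negbTE xt) eq_sym (negbTE xt) !muln0 !muln1 !addr0.
  by congr (_ *: mode _ _ _); have := ltn_ord i; lia.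
rewrite H; apply: eq_bigr => i _; rewrite /iterate.
have := E i 0%N; rewrite (_ : (fun e => _ + (0 * _)%N%:Z) =
  (fun e => m e + (i * (e == t))%N%:Z)); last by apply: funext => e; rewrite mul0n addr0.
by move=> ->; rewrite eqxx muln1.
Qed.

(* Weak associativity: (z_t + z_i)^k clears all poles in z_t, and at z_t = 0
   the iterate becomes the product. *)
Lemma clear_poles l : t \notin idx l -> uniq (idx l) ->
  (forall x, x \in l -> forall i : nat, mode x.2 (k + i)%:Z c = 0) ->
  (forall m, 0 <= m t -> clear l m = 0) /\
  (forall m, m t = -1 -> clear l m = facs (shifts k (idx l)) (word l c) m).
Proof.
elim: l => [|x l IH] tl ul lc.
  by split=> m mt; rewrite /clear /= /iterate mode_vacuum ?mt //; case: eqP => //; lia.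
move: tl ul; rewrite /= inE negb_or => /andP[tx tl] /andP[xl ul].
have {IH} [IH1 IH2] : _ := IH tl ul (fun y yl => lc y (mem_behead (s := x :: l) yl)).
have xc := lc x (mem_head _ _).
have xt : x.1 != t by rewrite eq_sym.
have H := expands_cons xt xl tl xc.
split=> m mt; have [N0 /(_ N0.+1 (leqnSn _)) ->] := H m.
  rewrite big1 // => i _; rewrite IH1 ?mode0r ?scaler0 // eqxx muln1; lia.
(* For m t = -1 every term with i > 0 has a nonnegative index at t, where the cleared iterate of the
   shorter word vanishes. *)
rewrite big_ord_recl big1 ?addr0 => [|i _]; last first.
  by rewrite IH1 ?mode0r ?scaler0 //= /bump leq0n eqxx muln1 mt; lia.
rewrite expr0 zbinom_r0 mulr1 scale1r IH2 /=; last by rewrite mul0n addr0.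
rewrite facs_shifts //= facs_shifts /=; last by rewrite xl.
rewrite inE eqxx muln1.
congr (mode _ _ _); [lia|]; apply: word_ext => e el.
by rewrite inE el orbT mul0n addr0.
Qed.

(** The cleared iterate depends only on the sums z_t + z_i: on Y(w, z_t) the derivative in z_t is
    that of L(-1)w, a translation of all points, and both derivations take the value 1 on each
    factor z_t + z_i. *)
Lemma deriv_clear l : t \notin idx l -> uniq (idx l) ->
  deriv (dirs [:: t]) (clear l) = deriv (dirs (idx l)) (clear l).
Proof.
move=> tl ul; rewrite /clear.
have : forall u, u \in cross k (1 : K) t (idx l) -> [/\ u.1.1 = t, u.1.2 = 1 & u.2 \in idx l].
  by move=> u /mem_cross.
elim: (cross _ _ _ _) => [_|u L IH uL] /=; last first.
  have {}IH := IH (fun u0 uL0 => uL u0 (mem_behead (s := u :: L) uL0)).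
  have [u1 u2 u3] := uL u (mem_head _ _).
  rewrite !deriv_fac IH; apply: funext => m; congr (_ + _ *: _).
  rewrite u1 u2 -[[:: (_, t)]]/(dirs [:: t]) !coef_dirs // u3 (negbTE tl) !inE eqxx mul1r mulr1.
  by case: eqP u3 tl => [->|_] /=; [move->|rewrite addr0 add0r].
apply: funext => m; rewrite /deriv big_seq1 /= mul1r /iterate.
have -> : word l vacuum (dn t m) = word l vacuum m.
  apply: word_ext => e el; rewrite /dn; case: eqP => [et|_]; last by rewrite subr0.
  by rewrite -et el in tl.
rewrite /dn eqxx -translation -/(trans _) trans_word // /deriv modeNl mode_suml; congr (- _).
rewrite /dirs [LHS]big_map [RHS]big_map big_seq [RHS]big_seq.
apply: eq_bigr => i il /=; rewrite modeZl /dn.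
by case: (t =P i) => [ti|_]; [rewrite ti il in tl|rewrite subr0].
Qed.

(* The translates of S far away act on c through modes below -1, so modulo C
   the product has bounded degree along \sum_{i in S} d/dz_i. *)
Lemma lies_word (C : set V) l : subspace C -> t \notin idx l -> uniq (idx l) ->
  (forall x, x \in l -> forall i : nat, mode x.2 (k + i)%:Z c = 0) ->
  (forall m q, q <= - 2%:Z -> C (mode (word l vacuum m) q c)) ->
  forall m, C (iter (size l * k).+1 (deriv (dirs (idx l)))
                 (facs (shifts k (idx l)) (word l c)) m).
Proof.
move=> sC tl ul lc lC m0.
have [_ HE] := clear_poles tl ul lc.
(* The product does not involve z_t, so the index at t may be set to -1, which amounts to z_t = 0,
   where the cleared iterate equals the product. *)
pose r m : nat -> int := fun e => if e == t then -1 else m e.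
have -> : iter (size l * k).+1 (deriv (dirs (idx l)))
    (facs (shifts k (idx l)) (word l c)) m0
  = iter (size l * k).+1 (deriv (dirs (idx l)))
    (facs (shifts k (idx l)) (word l c)) (r m0).
  elim: (_.+1) m0 => [|n IH] m /=.
    rewrite !facs_shifts //; apply: word_ext => e el; rewrite /r.
    by case: eqP => // et; rewrite -et el in tl.
  rewrite /deriv /dirs [in LHS]big_map [in RHS]big_map; congr (- _).
  rewrite big_seq [RHS]big_seq.
  apply: eq_bigr => i il /=; have it : i != t by apply: contraNneq tl => <-.
  rewrite IH (_ : r m i = m i); last by rewrite /r (negbTE it).
  rewrite (_ : r (dn i m) = dn i (r m)) //; apply: funext => e; rewrite /r /dn.
  by case: eqP => // ->; rewrite eq_sym (negbTE it) subr0.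
set Q : set (nat -> int) := [set m | m t = -1].
have dQ : dnclosed Q (idx l).
  move=> m i il /= mt; rewrite /Q /= /dn mt; have it : i != t by apply: contraNneq tl => <-.
  by rewrite eq_sym (negbTE it) subr0.
rewrite -(@lies_congr _ _ (idx l) Q _ _ (clear l)) ?didx_dirs //; last first.
  by rewrite /Q /= /r eqxx.
have -> n : iter n (deriv (dirs (idx l))) (clear l) = iter n (deriv (dirs [:: t])) (clear l).
  by elim: n => // n IH; rewrite iterS IH -iter_comm -deriv_clear // -iterSr.
(* Each of the size l * k linear factors raises the index at t by at most one, so the threshold -2
   drops by that amount. Each d/dz_t moves the threshold up by one, and (size l * k).+1 of them
   reach -1. *)
have cC m : m t <= - 2%:Z - (size l * k)%:Z -> C (clear l m).
  rewrite /clear -[size l](size_map fst) -(size_cross k (1 : K) t (idx l)).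
  elim: (cross _ _ _ _) m => [|u L IH] m /= mt; first by apply: lC; lia.
  apply: subspaceD => //; last apply: subspaceZ => //; apply: IH; rewrite /up.
    by case: eqP => _; lia.
  by case: eqP => _; lia.
have H n m : m t <= - 2%:Z - (size l * k)%:Z + n%:Z -> C (iter n (deriv (dirs [:: t])) (clear l) m).
  elim: n m => [|n IH] m mt; first by apply: cC; lia.
  rewrite iterS /deriv big_seq1 -scaleNr; apply: subspaceZ => //; apply: IH.
  by rewrite /dn eqxx /=; lia.
by apply: H; rewrite /r eqxx; lia.
Qed.

End OneVector.
End Associativity.
(** * Degree of correlation functions *)

Section Degree.
Context {R : realType} (V : voaType R).
Local Notation K := R[i].
Implicit Types (m : nat -> int) (f g : (nat -> int) -> V) (x y : nat * V) (l : seq (nat * V)).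
Implicit Types (a b c v : V) (k n : nat) (s : seq nat).
Hypothesis cft : CFT_type V.

Definition homog a := exists w : nat, wsp w%:Z a.

Lemma wsp_neg (p : int) v : p < 0 -> wsp p v -> v = 0.
Proof. by move=> p0; case: cft => /(_ p p0) E _; rewrite /wsp E. Qed.

Lemma wsp0 v : wsp 0 v -> exists c : K, v = c *: vacuum.
Proof.
case: cft => _ E; rewrite /wsp E => -[s [sv ->]]; exists (\sum_(p <- s) p.1).
by rewrite scaler_suml big_seq [RHS]big_seq; apply: eq_bigr => p /sv /= ->.
Qed.

Lemma word_wsp l : {in l, forall x, homog x.2} -> exists w : nat,
  forall m, wsp (w%:Z - \sum_(i <- idx l) (m i + 1)) (word l vacuum m).
Proof.
elim: l => [|x l IH] lh; first by exists 0%N => m; rewrite big_nil; exact: vacuum_wsp.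
have [w1 w1P] := lh x (mem_head _ _).
have [w2 w2P] := IH (fun y yl => lh y (mem_behead (s := x :: l) yl)).
exists (w1 + w2)%N => m; rewrite big_cons /= -/(idx l).
have := mode_wsp (m x.1) w1P (w2P m); congr (wsp _ _).
by set S := bigop.body _ _ _; lia.
Qed.

(** Lower bounds on the modes of l' bound the weight of its word from above, and a mode leading to
    negative weight vanishes. Hence one k serves infinitely many m. *)
Lemma bounded_trunc l l' (M : nat) : {in l, forall x, homog x.2} ->
  {in l', forall x, homog x.2} ->
  exists k, forall m, {in idx l', forall j, - M%:Z <= m j} ->
  forall x, x \in l -> forall i : nat, mode x.2 (k + i)%:Z (word l' vacuum m) = 0.
Proof.
move=> lh /word_wsp[w wP].
have /choice [wt wtP] : forall x, exists p : nat, x \in l -> wsp p%:Z x.2.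
  by move=> x; have [/lh[p pP]|] := boolP (x \in l); [exists p|exists 0%N].
exists (\max_(x <- l) wt x + w + size l' * M)%N => m mM x xl i.
apply: wsp_neg (mode_wsp _ (wtP x xl) (wP m)).
have h1 : (wt x <= \max_(x <- l) wt x)%N by apply: leq_bigmax_seq.
have h2 : - (size l' * M)%:Z <= \sum_(j <- idx l') (m j + 1).
  move: mM {wP}; elim: (l') => [|y r IH] mM; first by rewrite big_nil.
  rewrite big_cons /= -/(idx r); have := mM y.1 (mem_head _ _).
  have := IH (fun j jr => mM j (mem_behead (s := idx (y :: r)) jr)).
  by set S := bigop.body _ _ _; rewrite mulSn; lia.
move: h1 h2; set S := bigop.body _ _ _; set T := bigop.body _ _ _; lia.
Qed.

Lemma lies_cancel_shifts (C : set V) (Q : set (nat -> int)) n s f (L : seq (nat * K * nat)) :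
  subspace C -> uniq s -> upclosed Q s -> dnclosed Q s ->
  {in s, forall i, vanishes_above i f} ->
  {in L, forall u, u.1.1 \in s /\ u = (u.1.1, 0, u.1.1)} ->
  lies C Q (iter (size L + n) (deriv (dirs s)) (facs L f)) ->
  lies C Q (iter n (deriv (dirs s)) f).
Proof.
move=> sC us uQ dQ fs; elim: L => [//|u L IH] uL.
have [us1 ->] := uL u (mem_head _ _); rewrite [size _]/= addSn => H.
apply: IH; first by move=> u0 u0L; apply: uL; rewrite inE u0L orbT.
apply: lies_cancel H => //.
- by move=> m i; rewrite inE => /eqP -> ; exact: uQ.
- by rewrite didx_dirs.
- by rewrite coef_dirs // us1.
- by apply: vanishes_facs; apply: fs.
Qed.

Lemma fresh s : exists t, t \notin s.
Proof.
exists (\max_(i <- s) i).+1; apply/negP => H.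
by have := @leq_bigmax_seq _ s xpredT id _ H isT; rewrite ltnn.
Qed.

(** With the modes of J bounded below by -M, associativity applies after multiplication by powers
    z_i^h, i in S, with h depending on M. Cancelling these powers lowers the degree by exactly what
    they contributed, so the final bound is independent of M and holds for all m. *)
Lemma lies_corr (C : set V) k l S J : subspace C -> ~~ odd k -> uniq (idx l) -> local k l ->
  {in l, forall x, homog x.2} -> perm_eq l (S ++ J) ->
  (forall m q c, q <= - 2%:Z -> C (mode (word S vacuum m) q c)) ->
  lies C setT (iter (size (vander k (idx l) : seq (nat * K * nat))).+1
                 (deriv (dirs (idx S))) (corr k l vacuum)).
Proof.
move=> sC ek ul loc lh pl SC.
have ul' : uniq (idx (S ++ J)) by rewrite -(perm_uniq (perm_map fst pl)).
have dis i : i \in idx J -> i \notin idx S.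
  move: ul'; rewrite /idx map_cat cat_uniq => /and3P[_ /hasPn H _]; exact: H.
have uS : uniq (idx S) by move: ul'; rewrite /idx map_cat cat_uniq => /and3P[].
rewrite (corr_perm _ ek ul loc pl).
have -> : size (vander k (idx l) : seq (nat * K * nat))
        = size (vander k (idx (S ++ J)) : seq (nat * K * nat)).
  have : size (idx l) = size (idx (S ++ J)) by rewrite (perm_size (perm_map fst pl)).
  elim: (idx l) (idx (S ++ J)) => [|i s IH] [|i' s'] //= [ss].
  by rewrite !size_cat !size_cross ss (IH s').
set L := vander _ _.
have Sh : {in S, forall x, homog x.2}.
  by move=> x xS; apply: lh; rewrite (perm_mem pl) mem_cat xS.
have Jh : {in J, forall x, homog x.2}.
  by move=> x xJ; apply: lh; rewrite (perm_mem pl) mem_cat xJ orbT.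
suff H M : lies C [set m | {in idx J, forall j, - M%:Z <= m j}]
    (iter (size L).+1 (deriv (dirs (idx S))) (corr k (S ++ J) vacuum)).
  move=> m _; apply: (H (\max_(j <- idx J) `|m j|%N)) => j jJ.
  have : (`|m j| <= \max_(j <- idx J) `|m j|)%N.
    by apply: (leq_bigmax_seq (F := fun j => `|m j|%N)).
  lia.
set Q := mkset _.
have uQ s : upclosed Q s by move=> m i _ mQ j /mQ; rewrite /up; lia.
have dQ : dnclosed Q (idx S).
  move=> m i iS mQ j jJ; rewrite /dn; case: (j =P i) => [ji|_]; last by rewrite subr0; apply: mQ.
  by have := dis j jJ; rewrite ji iS.
have [h hP] := bounded_trunc M Sh Jh.
apply: (lies_cancel_shifts (L := shifts h (idx S))) => //.
- move=> i /mapP[x xS ->]; apply: vanishes_corr => //; last by rewrite mem_cat xS.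
  by move=> y z yl zl; apply: loc; rewrite (perm_mem pl).
- move=> u; rewrite /shifts; elim: (idx S) => //= i s IH; rewrite mem_cat => /orP[|/IH[us ue]].
    by rewrite mem_nseq => /andP[_ /eqP ->] /=; rewrite mem_head.
  by rewrite inE us orbT.
rewrite /corr facsC size_shifts addnS -addSn addnC.
apply: lies_deg_facs => //; first by rewrite didx_dirs.
move=> m mQ.
(* Neither the derivation nor the powers of z_i touch indices outside S; these are frozen, so that
   the product over J becomes one fixed vector. *)
set Q' : set (nat -> int) := [set m' | forall j, j \notin idx S -> m' j = m j].
have uQ' : upclosed Q' (idx S).
  move=> m' i iS m'Q j jS; rewrite /up; case: (j =P i) => [ji|_]; last by rewrite addr0; exact: m'Q.
  by rewrite ji iS in jS.
have dQ' : dnclosed Q' (idx S).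
  move=> m' i iS m'Q j jS; rewrite /dn; case: (j =P i) => [ji|_]; last by rewrite subr0; exact: m'Q.
  by rewrite ji iS in jS.
have shS : {subset fidx (shifts h (idx S) : seq (nat * K * nat)) <= idx S}.
  rewrite /shifts; elim: (idx S) => //= i s IH j; rewrite fidx_cat mem_cat => /orP[/fidx_nseq|/IH].
    by rewrite !inE orbb => ->.
  by rewrite inE => ->; rewrite orbT.
rewrite (@lies_congr _ _ (idx S) Q' _ _ _ (facs (shifts h (idx S)) (word S (word J vacuum m)))).
- have [t tS] := fresh (idx S).
  rewrite size_map; apply: (lies_word (t := t)) => //; first exact: (hP m mQ).
  by move=> m' q; apply: SC.
- exact: dQ'.
- by rewrite didx_dirs.
- apply: (facs_congr uQ' shS) => m' m'Q; rewrite word_cat; congr (word _ _ _).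
  by apply: word_ext => j jJ; apply: m'Q; apply: dis.
- by [].
Qed.

Lemma mem_vander k s (u : nat * K * nat) : u \in vander k s ->
  u.1.2 = -1 /\ exists s1 s2, s = s1 ++ u.2 :: s2 /\ u.1.1 \in s1.
Proof.
elim: s => //= i s IH; rewrite mem_cat => /orP[/mem_cross[<- ->]|/IH[-> [s1 [s2 [-> us]]]]].
  move=> us; split=> //; case/splitPr: us => s1 s2.
  by exists (u.1.1 :: s1), s2; rewrite mem_head.
by split=> //; exists (i :: s1), s2; rewrite inE us orbT.
Qed.

(** Composition with [slide i j n] is multiplication by (z_j / z_i)^n, a term of the geometric
    series for 1 / (z_i - z_j). *)
Definition slide (i j n : nat) m : nat -> int :=
  fun e => m e - (n * (e == i))%N%:Z + (n * (e == j))%N%:Z.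

Definition truncates i j f := forall m, exists N, forall n, (N <= n)%N -> f (slide i j n m) = 0.

Lemma truncates_fac i j u f : truncates i j f -> truncates i j (fac u f).
Proof.
move=> fT m; have [N1 H1] := fT (up u.1.1 m); have [N2 H2] := fT (up u.2 m).
have E e n : up e (slide i j n m) = slide i j n (up e m).
  by apply: funext => e'; rewrite /up /slide; lia.
exists (maxn N1 N2) => n; rewrite geq_max => /andP[/H1 E1 /H2 E2].
by rewrite /fac !E E1 E2 scaler0 addr0.
Qed.

(** Raising the mode at j eventually annihilates the vector to its right, which stays unchanged; the
    mode being lowered belongs to a letter further left. *)
Lemma truncates_word l s1 s2 i j c : uniq (idx l) -> idx l = s1 ++ j :: s2 -> i \in s1 ->
  truncates i j (word l c).
Proof.
move=> ul le is1 m.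
have [l1 [x [l2 [lE l1E xj l2E]]]] : exists l1 x l2,
    [/\ l = l1 ++ x :: l2, idx l1 = s1, x.1 = j & idx l2 = s2].
  exists (take (size s1) l).
  move: (congr1 (take (size s1)) le) (congr1 (drop (size s1)) le).
  rewrite take_size_cat // drop_size_cat // /idx -map_take -map_drop.
  case E : (drop (size s1) l) => [|x l2] //= t1 [xj l2E].
  by exists x, l2; rewrite -E cat_take_drop.
move: ul; rewrite le cat_uniq /= negb_or -andbA => /and5P[us1 js1 hs js2 us2].
have is2 : i \notin s2 by apply: contraNN hs => is2; apply/hasP; exists i.
have ij : i != j by apply: contraNneq js1 => <-.
have [N NP] := mode_bound x.2 (word l2 c m).
exists (N + `|m j|)%N => n nN; rewrite lE word_cat /= xj.
rewrite (@word_ext _ _ l2 c _ m); last first.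
  move=> e; rewrite l2E => e2; rewrite /slide.
  case: (e =P i) => [ei|_]; first by rewrite -ei e2 in is2.
  case: (e =P j) => [ej|_]; first by rewrite -ej e2 in js2.
  by rewrite muln0 subr0 addr0.
rewrite NP ?word0 // /slide eqxx eq_sym (negbTE ij); lia.
Qed.

Definition low (C : set V) (M : nat) s f := forall m, \sum_(i <- s) m i <= - M%:Z -> C (f m).

Lemma sum_up s i m : uniq s -> i \in s -> \sum_(e <- s) (m e + (e == i)%:Z) = \sum_(e <- s) m e + 1.
Proof.
move=> us is1; rewrite big_split /=; congr (_ + _).
rewrite (bigD1_seq i) //= eqxx big1 ?addr0 // => e /negbTE ->; exact: erefl.
Qed.

Lemma sum_dn s i m : uniq s -> i \in s -> \sum_(e <- s) dn i m e = \sum_(e <- s) m e - 1.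
Proof.
move=> us is1; rewrite -[in RHS](updnK i m) /up sum_up // addrK //.
Qed.

(* Division by z_i - z_j, expanded in the region |z_i| > |z_j|. *)
Lemma low_fac (C : set V) M s i j f : subspace C -> uniq s -> i \in s -> j \in s ->
  truncates i j f -> low C M s (fac (i, -1, j) f) -> low C M s f.
Proof.
move=> sC us is1 js fT fM m; have [N] := fT m.
elim: N m => [|N IH] m H mM.
  have <- : slide i j 0 m = m by apply: funext => e; rewrite /slide !mul0n subr0 addr0.
  by rewrite H //; case: sC.
have := fM (dn i m); rewrite sum_dn // => /(_ ltac:(lia)).
rewrite /fac /= updnK => fC.
rewrite -[f m](subrK (f (up j (dn i m)))); apply: subspaceD => //.
  by move: fC; rewrite scaleN1r.
apply: IH.
  move=> n nN; have := H n.+1 nN; congr (f _ = 0); apply: funext => e.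
  by rewrite /slide /up /dn; lia.
by rewrite sum_up // sum_dn //; lia.
Qed.

(** Modulo C the degree in each variable is at most some n, and a total mode below -n * size l
    forces a single mode below -n. Dividing out the Vandermonde factors does not change the
    bound. *)
Lemma low_word (C : set V) k l : subspace C -> uniq (idx l) ->
  (forall x, x \in l -> exists n, lies C setT (iter n (deriv [:: (1, x.1)]) (corr k l vacuum))) ->
  exists M, low C M (idx l) (word l vacuum).
Proof.
move=> sC ul lC.
have /choice [N NP] : forall x, exists n, x \in l ->
    lies C setT (iter n (deriv [:: (1, x.1)]) (corr k l vacuum)).
  by move=> x; have [/lC[n nP]|] := boolP (x \in l); [exists n|exists 0%N].
pose n := \max_(x <- l) N x.
have H m i : i \in idx l -> m i < - n%:Z -> C (corr k l vacuum m).
  move=> /mapP[x xl ->] mx; apply: (lies_poly sC (NP x xl)).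
  have : (N x <= n)%N by apply: leq_bigmax_seq.
  lia.
exists (n * size l).+1.
have : low C (n * size l).+1 (idx l) (corr k l vacuum).
  move=> m mM; have [/hasP[i il mi]|/hasPn nl] := boolP (has (fun i => m i < - n%:Z) (idx l)).
    exact: H mi.
  suff : - (n * size l)%:Z <= \sum_(i <- idx l) m i by lia.
  move: nl {mM H}; rewrite -(size_map fst l) -/(idx l); elim: (idx l) => [|i s IH] nl.
    by rewrite big_nil muln0.
  rewrite big_cons /=.
  have := IH (fun e es => nl e (mem_behead (s := i :: s) es)).
  have := nl i (mem_head _ _); rewrite -leNgt mulnS PoszD opprD; exact: lerD.
have : {subset (vander k (idx l) : seq (nat * K * nat))
        <= (vander k (idx l) : seq (nat * K * nat))} by [].
rewrite /corr; elim: {1 3}(vander _ _) => //= u L IH uL fM.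
have [u2 [s1 [s2 [le us]]]] := mem_vander (uL u (mem_head _ _)).
apply: IH; first by move=> u' u'L; apply: uL; rewrite inE u'L orbT.
have tr : truncates u.1.1 u.2 (facs L (word l vacuum)).
  by elim: (L) => [|u0 L0 IH0] /=; [apply: truncates_word le us|apply: truncates_fac].
move: fM; case: u u2 us tr {uL} le => [[i b] j] /= -> us tr le; apply: low_fac tr => //;
by rewrite le mem_cat ?mem_head ?us ?orbT.
Qed.

End Degree.
(** * Charges and insertions *)

Section Charges.
Context {R : realType} (V : voaType R).
Local Notation K := R[i].
Implicit Types (m : nat -> int) (f : (nat -> int) -> V) (x y : nat * V) (l : seq (nat * V)).
Implicit Types (a b c u v : V) (k : nat) (s : seq nat) (z : K).
Hypotheses (cft : CFT_type V) (simpleV : simple_voa V).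
Variables (g : voa_aut V) (n : nat).
Hypotheses (n_prime : prime n) (gn : forall v, iter n g v = v).

HB.instance Definition _ := GRing.isLinear.Build K V V _ (voa_aut_fun g) (voa_aut_linear g).

Definition chg z a := g a = z *: a.

(* The U-module version of C_2(V), for U the fixed points of g. *)
Definition C2g : set V :=
  span [set w | exists a q c, [/\ g a = a, q <= - 2%:Z & w = mode a q c]].

Lemma subspace_C2g : subspace C2g. Proof. exact: subspace_span. Qed.

Lemma C2g_mode a q c : g a = a -> q <= - 2%:Z -> C2g (mode a q c).
Proof. by move=> ga q2; apply: sub_span; exists a, q, c. Qed.

Lemma n_neq0 : n%:R != 0 :> K.
Proof. by rewrite pnatr_eq0 -lt0n prime_gt0. Qed.

Lemma iter_g (q : nat) a v w (p : int) :
  iter q g (mode v p w) = mode (iter q g v) p (iter q g w).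
Proof. by elim: q => //= q ->; rewrite voa_aut_mode. Qed.

Lemma wsp_g p v : wsp p v -> wsp p (g v).
Proof.
move=> /wspE ve; apply/wspE; rewrite -[in LHS](voa_aut_conformal g) -voa_aut_mode ve.
by rewrite linearZ.
Qed.

Lemma chg_word (zc : nat * V -> K) l m : {in l, forall x, chg (zc x) x.2} ->
  chg (\prod_(x <- l) zc x) (word l vacuum m).
Proof.
rewrite /chg; elim: l => [|x l IH] lz; first by rewrite big_nil scale1r /= voa_aut_vacuum.
rewrite big_cons /= voa_aut_mode IH; last by move=> y yl; apply: lz; rewrite inE yl orbT.
by rewrite lz ?mem_head // modeZr modeZl scalerA mulrC.
Qed.

Definition proj z v : V := n%:R^-1 *: \sum_(k < n) (z ^- k *: iter k g v).

Lemma iter_gP (q : nat) (c : K) u v : iter q g (c *: u + v) = c *: iter q g u + iter q g v.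
Proof. by elim: q => //= q ->; rewrite linearP. Qed.

Lemma proj_linear z : linear (proj z).
Proof.
move=> c u v; rewrite /proj scalerA mulrC -scalerA -scalerDr; congr (_ *: _).
rewrite scaler_sumr -big_split; apply: eq_bigr => k _ /=.
by rewrite iter_gP scalerDr !scalerA mulrC.
Qed.

HB.instance Definition _ z := GRing.isLinear.Build K V V _ (proj z) (proj_linear z).

Lemma unity_neq0 z : z ^+ n = 1 -> z != 0.
Proof.
move=> zn; apply/eqP => z0; move: zn; rewrite z0 expr0n (gtn_eqF (prime_gt0 n_prime)).
by move/eqP; rewrite eq_sym oner_eq0.
Qed.

Lemma chg_proj z v : z ^+ n = 1 -> chg z (proj z v).
Proof.
move=> zn; have z0 := unity_neq0 zn.
rewrite /chg /proj linearZ /= scalerA mulrC -scalerA; congr (_ *: _).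
rewrite linear_sum scaler_sumr.
pose F k := z ^- k *: (z *: iter k g v).
have E : \sum_(k < n) F k.+1 = \sum_(k < n) F k.
  case: n (prime_gt0 n_prime) zn gn @F => // n' _ zn gn' F.
  rewrite big_ord_recr [RHS]big_ord_recl /= addrC; congr (_ + _).
  by rewrite /F zn gn' expr0.
transitivity (\sum_(k < n) F k.+1); last first.
  by rewrite E; apply: eq_bigr => k _; rewrite /F !scalerA mulrC.
apply: eq_bigr => k _; rewrite /F linearZ scalerA -iterS; congr (_ *: _).
by rewrite exprS invfM mulrAC mulVf // mul1r.
Qed.

Lemma iter_chg z v (q : nat) : chg z v -> iter q g v = z ^+ q *: v.
Proof.
move=> gv; elim: q => [|q /= ->]; first by rewrite scale1r.
by rewrite linearZ /= gv scalerA exprSr.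
Qed.

Lemma sum_unity z : z ^+ n = 1 -> z != 1 -> \sum_(k < n) z ^+ k = 0.
Proof.
move=> zn z1; have := subrX1 z n; rewrite zn subrr => /esym/eqP.
by rewrite mulf_eq0 subr_eq0 (negbTE z1) => /eqP.
Qed.

Lemma proj1_chg z v : z ^+ n = 1 -> chg z v -> proj 1 v = if z == 1 then v else 0.
Proof.
move=> zn gv; rewrite /proj.
under eq_bigr do rewrite expr1n invr1 scale1r (iter_chg _ gv).
rewrite -scaler_suml; case: eqP => [->|/eqP z1].
  under eq_bigr do rewrite expr1n.
  by rewrite sumr_const card_ord scalerA mulVf ?scale1r // n_neq0.
by rewrite sum_unity // scale0r scaler0.
Qed.

Lemma proj1_fixed v : g v = v -> proj 1 v = v.
Proof. by move=> gv; rewrite (@proj1_chg 1) ?expr1n ?eqxx // /chg scale1r. Qed.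

Lemma proj1_fixes v : g (proj 1 v) = proj 1 v.
Proof. by have := @chg_proj 1 v (expr1n _ _); rewrite /chg scale1r. Qed.

Lemma proj1_mode a q c : g a = a -> proj 1 (mode a q c) = mode a q (proj 1 c).
Proof.
move=> gx; rewrite /proj modeZr mode_sumr; congr (_ *: _); apply: eq_bigr => k _.
rewrite modeZr iter_g //; congr (_ *: mode _ _ _).
by elim: {k}(k : nat) => //= k ->.
Qed.

Lemma wsp_proj z p v : wsp p v -> wsp p (proj z v).
Proof.
move=> pv; have sp := @subspace_wsp R V p; apply: subspaceZ => //.
apply: subspace_sum => // k _; apply: subspaceZ => //.
by elim: {k}(k : nat) => //= k; apply: wsp_g.
Qed.

(** A root of 1 + X + ... + X^(n-1) has order dividing the prime n, and it is not 1 because n is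
    nonzero in [K]. *)
Lemma prim_root : exists z : K, n.-primitive_root z.
Proof.
have n1 := prime_gt1 n_prime.
pose p : {poly K} := \poly_(i < n) 1.
have sp : size p = n by rewrite size_poly_eq // oner_eq0.
have /closed_rootP[z pz] : size p != 1%N by rewrite sp neq_ltn n1 orbT.
have p0 : \sum_(i < n) z ^+ i = 0.
  by move: pz => /rootP; rewrite horner_poly; under eq_bigr do rewrite mul1r.
have zn : z ^+ n = 1 by apply/eqP; rewrite -subr_eq0 subrX1 p0 mulr0.
have [k kz kn] := prim_order_exists (prime_gt0 n_prime) zn.
move: (n_prime) => /primeP[_ /(_ k kn)] /orP[/eqP k1|/eqP <-]; last by exists z.
move: kz p0; rewrite k1 => /prim_expr_order; rewrite expr1 => ->.
under eq_bigr do rewrite expr1n.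
by rewrite sumr_const card_ord => /eqP; rewrite (negbTE n_neq0).
Qed.

Lemma sum_proj : exists zs : seq K, {in zs, forall z, z ^+ n = 1} /\
  forall v, v = \sum_(z <- zs) proj z v.
Proof.
have [z zP] := prim_root; have zn := prim_expr_order zP.
have unity j : (z ^+ j) ^+ n = 1 by rewrite -exprM mulnC exprM zn expr1n.
exists [seq z ^+ j | j <- iota 0 n]; split; first by move=> _ /mapP[j _ ->].
move=> v; rewrite big_map (_ : iota 0 n = index_iota 0 n); last by rewrite /index_iota subn0.
rewrite big_mkord /proj -scaler_sumr exchange_big /=.
rewrite (bigD1 (Ordinal (prime_gt0 n_prime))) //= [X in _ + X]big1 ?addr0.
  under eq_bigr do rewrite expr0 invr1 scale1r.
  by rewrite sumr_const card_ord -[v *+ n]scaler_nat scalerA mulVf ?scale1r // n_neq0.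
move=> k k0; rewrite -scaler_suml.
under eq_bigr do rewrite -exprM mulnC exprM -exprVn.
rewrite sum_unity ?scale0r //; first by rewrite exprVn unity invr1.
rewrite invr_eq1 -(prim_order_dvd zP); apply: contra k0 => kn.
apply/eqP/val_inj => /=; apply/eqP; rewrite eqn0Ngt; apply/negP => k0.
by have := dvdn_leq k0 kn; rewrite leqNgt ltn_ord.
Qed.

Definition bihomog a := homog a /\ exists z, z ^+ n = 1 /\ chg z a.

Lemma span_homog v : span (@homog R V) v.
Proof.
have : span (\bigcup_p eigenspace_int (mode (conformal : V) 1) p) v by rewrite grading_span.
apply: span_sub; first exact: subspace_span.
move=> u [[p|p] _ up]; first by apply: sub_span; exists p.
rewrite (@wsp_neg R V cft (Negz p) u) //; by case: (@subspace_span K V (@homog R V)).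
Qed.

Lemma span_bihomog v : span bihomog v.
Proof.
apply: span_sub (span_homog v); first exact: subspace_span.
move=> u [p pu]; have [zs [zn uE]] := sum_proj; rewrite (uE u).
apply: subspace_sum => [|z zzs]; first exact: subspace_span.
apply: sub_span; split; first by exists p; apply: wsp_proj.
by exists z; split; [exact: zn|apply: chg_proj; exact: zn].
Qed.

Lemma subspace_preim (T : {linear V -> V}) (P : set V) : subspace P -> subspace [set v | P (T v)].
Proof.
move=> [P0 PD]; split; first by rewrite /= linear0.
by move=> c u v /= Pu Pv; rewrite linearP; apply: PD.
Qed.

(** Weak associativity at b expresses u_p w_q b through products (u_r w)_s b and terms u_{p-i}
    w_{q+i} b with i > 0; the latter are handled by induction, as w_q b = 0 for large q. *)
Lemma submodule_gen b : let I := span [set w | exists u p, w = mode u p b] in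
  forall u p v, I v -> I (mode u p v).
Proof.
move=> I u p v.
have sI : subspace I by apply: subspace_span.
move=> Iv; pose P := [set v | I (mode u p v)].
suff : P v by [].
apply: span_sub Iv.
  split; first by rewrite /P /= mode0r; case: sI.
  by move=> k v1 v2 P1 P2; rewrite /P /= modeDr modeZr; case: sI => _; apply.
move=> _ [w [q ->]]; rewrite /P /= {P}.
have [k kP] := mode_bound u b; have [N NP] := mode_bound w b.
have uk i : mode u (k + i)%:Z b = 0 by apply: kP; lia.
have [t tq] : exists t : nat, N%:Z - q <= t%:Z by exists (N + `|q|)%N; lia.
elim: t p q tq => [|t IH] p q tq.
  by rewrite NP ?mode0r; [case: sI|lia].
have [Nq|qN] := leP N%:Z q; first by rewrite NP // mode0r; case: sI.
have [N0 /(_ N0.+1 (leqnSn _))] := borcherds_weak_assoc w (p - k%:Z) q uk.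
rewrite [X in _ = X]big_ord_recl expr0 zbinom_r0 mulr1 scale1r subr0 addr0.
rewrite (_ : k%:Z + (p - k%:Z) = p); last by lia.
move=> /esym /(canRL (addrK _)) ->.
apply: subspaceB => //; apply: subspace_sum => // i _; apply: subspaceZ => //.
  by apply: sub_span; eexists; eexists.
apply: IH; rewrite /= /bump leq0n add1n; lia.
Qed.

(** By simplicity the vacuum is a combination of products u_p b. Splitting u into eigenvectors and
    projecting onto the fixed vectors leaves only those u whose charge is inverse to that of b. *)
Lemma gen_vacuum b z : b != 0 -> z ^+ n = 1 -> chg z b ->
  span [set w | exists u p, [/\ homog u, chg z^-1 u & w = mode u p b]] vacuum.
Proof.
move=> b0 zn gb.
have z0 := unity_neq0 zn.
have [I0|IT] := simpleV.2 _ (subspace_span _) (@submodule_gen b).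
  move: b0; suff : [set 0] b by move=> -> /eqP.
  by rewrite -I0; apply: sub_span; exists vacuum, (-1); rewrite mode_vacuum.
set T := span _; have sT : subspace T by apply: subspace_span.
have Iv : span [set w | exists u p, w = mode u p b] vacuum by rewrite IT.
rewrite -(proj1_fixed (voa_aut_vacuum g)).
suff H : [set w | exists u p, w = mode u p b] `<=` [set v | T (proj 1 v)].
  exact: (span_sub (subspace_preim (proj 1) sT) H Iv).
move=> _ [u [p ->]] /=.
have sP : subspace [set u | T (proj 1 (mode u p b))].
  split; first by rewrite /= mode0l linear0; case: sT.
  by move=> k u1 u2 /= P1 P2; rewrite modeDl modeZl linearP; case: sT => _; apply.
suff H : bihomog `<=` [set u | T (proj 1 (mode u p b))].
  exact: (span_sub sP H (span_bihomog u)).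
move=> {}u [hu [y [yn gu]]] /=.
have yzn : (y * z) ^+ n = 1 by rewrite exprMn yn zn mulr1.
rewrite (proj1_chg yzn); last first.
  by rewrite /chg voa_aut_mode gu gb modeZl modeZr scalerA.
case: eqP => [yz|_]; last by case: sT.
apply: sub_span; exists u, p; split=> //.
by rewrite (_ : z^-1 = y) //; apply: (mulIf z0); rewrite mulVf.
Qed.

Definition bounded l := exists M, low C2g M (idx l) (word l vacuum).

Definition nilp k l (w : seq (K * nat)) :=
  exists q, lies C2g setT (iter q (deriv w) (corr k l vacuum)).

Lemma nilp_neutral k l S (zc : nat * V -> K) : ~~ odd k -> uniq (idx l) -> local k l ->
  {in l, forall x, homog x.2} -> uniq S -> {subset S <= l} ->
  {in S, forall x, chg (zc x) x.2} -> \prod_(x <- S) zc x = 1 ->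
  nilp k l (dirs (idx S)).
Proof.
move=> ek ul loc lh uS Sl Sz z1.
have pl := perm_sub uS (map_uniq ul) Sl.
eexists; apply: (lies_corr cft subspace_C2g ek ul loc lh pl) => m q c q2.
apply: C2g_mode => //; have := chg_word m Sz.
by rewrite z1 /chg scale1r.
Qed.

Lemma dnT (s : seq nat) : dnclosed setT s. Proof. by []. Qed.

Lemma nilp_cat k l w w' : nilp k l w -> nilp k l w' -> nilp k l (w ++ w').
Proof.
move=> [p pP] [q qP]; exists (p + q)%N.
exact: (lies_nil_cat subspace_C2g (@dnT _) (@dnT _)).
Qed.

(** Different lists may represent the same derivation; with c = 1 this replaces one list by
    another. *)
Lemma nilp_scale k l w w' (c : K) :
  (forall f, deriv w' f = fun m => c *: deriv w f m) -> nilp k l w -> nilp k l w'.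
Proof.
move=> ww' [p pP]; exists p.
have -> : iter p (deriv w') (corr k l vacuum)
    = fun m => c ^+ p *: iter p (deriv w) (corr k l vacuum) m.
  elim: p {pP} => [|p IH]; first by apply: funext => m; rewrite scale1r.
  rewrite iterS IH derivZ ww'; apply: funext => m.
  by rewrite scalerA -exprSr.
by move=> m _; apply: subspaceZ; [exact: subspace_C2g|exact: pP].
Qed.

Definition linked l x := exists z y (cs : seq (nat * V)),
  [/\ uniq (y :: cs), {subset y :: cs <= l}, size cs = n,
      [/\ z ^+ n = 1, {in cs, forall e, chg z e.2} & chg z^-1 y.2]
    & chg z x.2 \/ chg z^-1 x.2].

Lemma linked_cat l l' x : linked l x -> linked (l ++ l') x.
Proof.
move=> [z [u [cs [us ul sz zP xP]]]]; exists z, u, cs; split=> // y /ul.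
by rewrite mem_cat => ->.
Qed.

(* With n letters c_1, ..., c_n of charge z and one letter u of charge 1/z,
   n d_u = \sum_j (d_{c_j} + d_u) - \sum_j d_{c_j} is a combination of
   derivations along neutral sets. *)
Lemma nilp_linked k l x : ~~ odd k -> uniq (idx l) -> local k l ->
  {in l, forall x, homog x.2} -> x \in l -> linked l x -> nilp k l [:: (1, x.1)].
Proof.
move=> ek ul loc lh xl [z [u [cs [/= /andP[ucs uncs] ucl szc [zn cz uz] xz]]]].
have cl : {subset cs <= l} by move=> c ccs; apply: ucl; rewrite inE ccs orbT.
have uul : u \in l by apply: ucl; rewrite mem_head.
have z0 := unity_neq0 zn.
have pair y y' (w : K) : y \in l -> y' \in l -> y != y' -> chg w y.2 -> chg w^-1 y'.2 -> w != 0 ->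
    nilp k l [:: (1, y.1); (1, y'.1)].
  move=> yl y'l yy' yw y'w w0.
  apply: (@nilp_neutral k l [:: y; y'] (fun e => if e == y then w else w^-1)) => //=.
  - by rewrite inE yy'.
  - by move=> e; rewrite !inE => /orP[] /eqP ->.
  - move=> e; rewrite !inE => /orP[] /eqP ->; first by rewrite eqxx.
    by rewrite eq_sym (negbTE yy').
  - by rewrite !big_cons big_nil eqxx eq_sym (negbTE yy') mulr1 mulfV.
have all_c : nilp k l (dirs (idx cs)).
  apply: (nilp_neutral (zc := fun=> z)) => //.
  by rewrite big_const_seq count_predT szc iter_mulr mulr1.
have sumc : nilp k l (flatten [seq [:: (1, e.1); (1, u.1)] | e <- cs]).
  have : {subset cs <= cs} by [].
  elim: {1 3}cs => [_|c s IH sc] /=.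
    by exists 1%N => m _; rewrite /= /deriv big_nil oppr0; case: subspace_C2g.
  apply: (@nilp_cat k l [:: (1, c.1); (1, u.1)]); last first.
    by apply: IH => e es; apply: sc; rewrite inE es orbT.
  have cc := sc c (mem_head _ _); apply: (@pair c u z) => //; [exact: cl| |exact: cz].
  by apply: contraNneq ucs => <-.
have nu : nilp k l [:: (1, u.1)].
  have allN : nilp k l [seq (-1, e.1) | e <- cs].
    apply: (@nilp_scale k l _ _ (-1) _ all_c) => f; apply: funext => m.
    rewrite /deriv /dirs /idx !big_map scalerN scaler_sumr; congr (- _).
    by apply: eq_bigr => c _; rewrite scalerA mulrA mulr1.
  apply: (@nilp_scale k l _ _ n%:R^-1 _ (nilp_cat sumc allN)) => f; apply: funext => m.
  rewrite deriv_cat /deriv big_seq1 big_flatten /= !big_map.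
  under eq_bigr do rewrite !big_cons big_nil addr0 !mul1r.
  rewrite big_split /= [X in - (_ + X)]big_const_seq count_predT szc iter_addr addr0.
  under [in X in _ - X]eq_bigr do rewrite mulN1r scaleNr.
  rewrite sumrN opprK opprD addrAC addNr add0r scalerN.
  by rewrite -scalerMnr -[n%:R^-1 *: _ *+ n]scaler_nat !scalerA mulfV ?mul1r // n_neq0.
have sub1 y y' : nilp k l [:: (1, y.1)] -> nilp k l [:: (1, y'.1); (1, y.1)] ->
    nilp k l [:: (1, y'.1)].
  move=> ny nyy; have nyN : nilp k l [:: (-1, y.1)].
    apply: (@nilp_scale k l _ _ (-1) _ ny) => f; apply: funext => m.
    by rewrite /deriv !big_seq1 /= mulN1r mul1r scalerN scaleNr scaleN1r.
  apply: (@nilp_scale k l _ _ 1 _ (nilp_cat nyy nyN)) => f; apply: funext => m.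
  rewrite scale1r /deriv !big_cons !big_nil /= !addr0 mulN1r !mul1r scaleNr.
  by rewrite subrr addr0.
have nc e : e \in cs -> nilp k l [:: (1, e.1)].
  move=> ccs; apply: (sub1 u) => //; apply: (@pair e u z) => //; [exact: cl| |exact: cz].
  by apply: contraNneq ucs => <-.
(* According to its charge, x forms a neutral pair with u or with one of the c's, whose derivation
   is then subtracted; x may itself be that letter. *)
case: xz => xz.
  have [->//|xu] := eqVneq x u.
  by apply: (sub1 u) => //; apply: (@pair x u z).
case: cs szc {sumc all_c ucl uncs ucs} cl cz nc => [|c cs] szc cl cz nc.
  by move: (prime_gt0 n_prime); rewrite -szc.
have [->|xc] := eqVneq x c; first by apply: nc; rewrite mem_head.
apply: (sub1 c); first by apply: nc; rewrite mem_head.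
apply: (@pair x c z^-1) => //; first by apply: cl; rewrite mem_head.
  by rewrite invrK; apply: cz; rewrite mem_head.
by rewrite invr_eq0.
Qed.

Lemma bounded_linked l : uniq (idx l) -> {in l, forall x, homog x.2} ->
  {in l, forall x, linked l x} -> bounded l.
Proof.
move=> ul lh ll; have [k [ek loc]] := local_ex l.
apply: (low_word subspace_C2g ul) => x xl; exact: (nilp_linked ek ul loc lh xl (ll x xl)).
Qed.

(** The vacuum is a finite combination of vectors u_q b = u_q b_{-1} 1, so a word in l is a
    combination of words with two more letters at the fixed modes q and -1; this only shifts the
    bound. *)
Lemma bounded_insert l b z N : {in idx l, forall i, (i < N)%N} ->
  b != 0 -> z ^+ n = 1 -> chg z b ->
  (forall u, homog u -> chg z^-1 u -> bounded (l ++ [:: (N, u); (N.+1, b)])) -> bounded l.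
Proof.
move=> lN b0 zn gb H.
have [s [sP vE]] := gen_vacuum b0 zn gb.
have /choice [M MP] : forall p : K * V, exists M : nat, p \in s ->
    forall m, \sum_(i <- idx l) m i <= - M%:Z -> C2g (word l p.2 m).
  move=> p; have [ps|] := boolP (p \in s); last by exists 0%N.
  have [u [q [hu gu ->]]] := sP p ps; have [M MP] := H u hu gu.
  exists (M + `|q|)%N => _ m mM.
  pose m' i : int := if (i < N)%N then m i else if i == N then q else -1.
  have mm' : {in idx l, m =1 m'} by move=> i /lN iN; rewrite /m' iN.
  have := MP m'; rewrite word_cat /= /m' ltnn ltnNge leqnSn eqxx (gtn_eqF (ltnSn N)) /=.
  rewrite mode_creation -(word_ext _ mm'); apply; rewrite /idx map_cat big_cat /=.
  rewrite !big_cons big_nil /= ltnn ltnNge leqnSn eqxx (gtn_eqF (ltnSn N)) /=.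
  rewrite -/(idx l) big_seq; under eq_bigr => i il do rewrite (lN i il).
  by rewrite -big_seq; move: mM; set S := bigop.body _ _ _; clear; lia.
exists (\max_(p <- s) M p) => m mM; rewrite vE.
have -> : word l (\sum_(p <- s) p.1 *: p.2) m = \sum_(p <- s) p.1 *: word l p.2 m.
  elim: (s) => [|p r IH]; first by rewrite !big_nil word0.
  by rewrite !big_cons wordD wordZ IH.
apply: subspace_sum => [|p ps]; first exact: subspace_C2g.
apply: subspaceZ; first exact: subspace_C2g.
apply: MP => //; apply: le_trans mM _.
have : (M p <= \max_(p <- s) M p)%N by apply: leq_bigmax_seq.
lia.
Qed.

(** Pairs u, b on consecutive variables starting at N. Below, [insb] extracts the copies of b, which
    become the n letters of equal charge. *)
Fixpoint ins (N : nat) b (us : seq V) : seq (nat * V) :=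
  if us is u :: us' then (N, u) :: (N.+1, b) :: ins N.+2 b us' else [::].

Fixpoint insb (N : nat) b (us : seq V) : seq (nat * V) :=
  if us is u :: us' then (N.+1, b) :: insb N.+2 b us' else [::].

Lemma idx_ins N b us : idx (ins N b us) = iota N (size us).*2.
Proof. by elim: us N => //= u us IH N; rewrite IH. Qed.

Lemma mem_insb N b us : {subset insb N b us <= ins N b us}.
Proof.
elim: us N => //= u us IH N x; rewrite !inE => /orP[->|/IH ->]; by rewrite !orbT.
Qed.

Lemma insb_b N b us x : x \in insb N b us -> x.2 = b /\ (N < x.1)%N.
Proof.
elim: us N => //= u us IH N; rewrite inE => /orP[/eqP ->//|/IH[-> Nx]]; split=> //.
by apply: leq_trans Nx; rewrite leqW.
Qed.

Lemma ins_us N b us x : x \in ins N b us -> x.2 = b \/ x.2 \in us.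
Proof.
elim: us N => //= u us IH N; rewrite !inE => /or3P[/eqP ->|/eqP ->|/IH[->|xus]]; try by left.
  by right; rewrite /= eqxx.
by right; rewrite xus orbT.
Qed.

Lemma uniq_insb N b us : uniq (insb N b us).
Proof.
elim: us N => //= u us IH N; rewrite IH andbT; apply/negP => /insb_b[_ /=].
by rewrite ltnNge leqnSn.
Qed.

Lemma size_insb N b us : size (insb N b us) = size us.
Proof. by elim: us N => //= u us IH N; rewrite IH. Qed.

Lemma bounded_ins (q : nat) l b z N : {in idx l, forall i, (i < N)%N} ->
  b != 0 -> z ^+ n = 1 -> chg z b ->
  (forall us, size us = q -> {in us, forall u, homog u /\ chg z^-1 u} ->
     bounded (l ++ ins N b us)) -> bounded l.
Proof.
move=> + b0 zn gb; elim: q l N => [|q IH] l N lN H.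
  by have := H [::] erefl; rewrite cats0; apply.
apply: (bounded_insert lN b0 zn gb) => u hu gu; apply: (IH _ N.+2).
  move=> i; rewrite /idx map_cat mem_cat !inE => /orP[/lN iN|/orP[] /eqP -> //=].
  by rewrite ltnW // ltnW.
move=> us usq usP; rewrite -catA; apply: (H (u :: us)); first by rewrite /= usq.
by move=> v; rewrite inE => /orP[/eqP -> //|/usP].
Qed.

Lemma bounded_todo (todo : seq V) l N : uniq (idx l) -> {in idx l, forall i, (i < N)%N} ->
  {in l, forall x, homog x.2} -> {in todo, forall b, bihomog b /\ b != 0} ->
  {in l, forall x, linked l x \/ x.2 \in todo} -> bounded l.
Proof.
elim: todo l N => [|b todo IH] l N ul lN lh tP lP.
  by apply: bounded_linked => // x /lP[].
have [[hb [z [zn gb]]] b0] := tP b (mem_head _ _).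
apply: (bounded_ins (q := n) lN b0 zn gb) => us usn usP.
have lk x : chg z x.2 \/ chg z^-1 x.2 -> linked (l ++ ins N b us) x.
  case: us usn usP => [|u us] usn usP xz; first by move: (prime_gt0 n_prime); rewrite -usn.
  exists z, (N, u), (insb N b (u :: us)); split=> //.
  - rewrite cons_uniq uniq_insb andbT; apply/negP => /insb_b[_ /=].
    by rewrite ltnn.
  - move=> y; rewrite inE mem_cat => /orP[/eqP ->|/mem_insb ->]; last by rewrite orbT.
    by rewrite mem_head orbT.
  - by rewrite size_insb.
  - by split=> //; [move=> y /insb_b[->]|exact: (usP u (mem_head _ _)).2].
apply: (IH _ (N + (size us).*2)%N).
- rewrite /idx map_cat cat_uniq -/(idx l) -/(idx (ins N b us)) ul idx_ins iota_uniq andbT /=.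
  apply/hasPn => i; rewrite mem_iota => /andP[Ni _]; apply/negP => /lN.
  by rewrite ltnNge Ni.
- move=> i; rewrite /idx map_cat mem_cat -/(idx l) -/(idx (ins N b us)) idx_ins mem_iota.
  by move=> /orP[/lN iN|/andP[]//]; apply: leq_trans iN (leq_addr _ _).
- move=> x; rewrite mem_cat => /orP[/lh //|/ins_us[->//|/usP[]//]].
- by move=> c ct; apply: tP; rewrite inE ct orbT.
- move=> x; rewrite mem_cat => /orP[/lP[xl|]|/ins_us[xb|/usP[_ xz]]].
  + by left; apply: linked_cat.
  + by rewrite inE => /orP[/eqP xb|]; [left; apply: lk; rewrite xb; left|right].
  + by left; apply: lk; rewrite xb; left.
  + by left; apply: lk; right.
Qed.

Lemma bounded_all l : uniq (idx l) -> {in l, forall x, bihomog x.2} -> bounded l.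
Proof.
move=> ul lh; have [/hasP[x xl /eqP x0]|/hasPn nz] := boolP (has (fun x => x.2 == 0) l).
  exists 0%N => m _; case/splitPr: xl => l1 l2; rewrite word_cat /= x0 mode0l word0.
  by case: subspace_C2g.
apply: (@bounded_todo (map snd l) l (\max_(i <- idx l) i).+1) => //.
- by move=> i il; rewrite ltnS; exact: (@leq_bigmax_seq _ (idx l) xpredT id i il isT).
- by move=> x /lh[].
- by move=> _ /mapP[x xl ->]; split; [exact: lh|exact: nz].
- by move=> x xl; right; apply: map_f.
Qed.

End Charges.
(** * The standard filtration *)

Section Filtration.
Context {R : realType} (V : voaType R).
Local Notation K := R[i].
Implicit Types (a b c u v y : V) (d e p q : int).
Hypothesis cft : CFT_type V.

(* The standard filtration: words a_1(n_1) ... a_r(n_r) 1 of total weight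
   wt a_1 + ... + wt a_r at most d. *)
Inductive filt : int -> V -> Prop :=
| filt_vac d : 0 <= d -> filt d vacuum
| filt_cons w a n d v : 0 < w -> wsp w a -> filt d v -> filt (w + d) (mode a n v)
| filt_lin (k : K) d u v : filt d u -> filt d v -> filt d (k *: u + v)
| filt_0 d : filt d 0
| filt_mono d e v : d <= e -> filt d v -> filt e v.

Lemma subspace_filt d : subspace (filt d).
Proof. by split; [exact: filt_0|move=> c u v; exact: filt_lin]. Qed.

Lemma filt_neg d v : filt d v -> d < 0 -> v = 0.
Proof.
elim=> {d v} [d|w a n d v w0 _ _ IH|c d u v _ IHu _ IHv|//|d e v de _ IH] d0; first by lia.
- by rewrite IH ?mode0r //; lia.
- by rewrite IHu // IHv // scaler0 addr0.
- by apply: IH; lia.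
Qed.

Lemma wsp_cases (w : int) a : wsp w a -> [\/ 0 < w, w = 0 /\ exists c : K, a = c *: vacuum | a = 0].
Proof.
move=> wa; have [w0|w0|w0] := ltgtP 0 w; first by constructor 1.
  by constructor 3; apply: (wsp_neg cft w0).
by constructor 2; split=> //; apply: (wsp0 cft); rewrite w0.
Qed.

Lemma filt_mode w a n d v : wsp w a -> filt d v -> filt (w + d) (mode a n v).
Proof.
move=> wa dv; case: (wsp_cases wa) => [w0|[-> [c ->]]|->]; first exact: filt_cons.
  rewrite modeZl mode_vacuum add0r; apply: subspaceZ; first exact: subspace_filt.
  by case: ifP => // _; apply: filt_0.
by rewrite mode0l; apply: filt_0.
Qed.

(** The commutator involves modes of a_i b with i >= 0, whose weight is at most w + w' - 1. *)
Lemma filt_comm w w' a b p q d v : wsp w a -> wsp w' b -> filt d v ->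
  filt (w + w' + d - 1) (mode a p (mode b q v) - mode b q (mode a p v)).
Proof.
move=> wa wb dv; have [N0 /(_ N0 (leqnn _)) ->] := borcherds_comm a b p q v.
rewrite [X in filt _ X]addrAC subrr add0r.
apply: subspace_sum => [|i _]; first exact: subspace_filt.
apply: subspaceZ; first exact: subspace_filt.
by apply: filt_mono (filt_mode _ (mode_wsp _ wa wb) dv); lia.
Qed.

(** A nonnegative mode kills the vacuum, and moving it there past the letters of v only costs
    commutators. *)
Lemma filt_annih w a n d v : wsp w a -> filt d v -> 0 <= n -> filt (w + d - 1) (mode a n v).
Proof.
move=> wa dv n0.
elim: dv => {d v}
  [d d0|w' b q d v w'0 wb dv IH|c d u v _ IHu _ IHv|d|d e v de _ IH].
- by rewrite mode_creation0 //; apply: filt_0.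
- rewrite -(subrK (mode b q (mode a n v)) (mode a n _)); apply: subspaceD.
  + exact: subspace_filt.
  + by apply: filt_mono (filt_comm _ _ wa wb dv); lia.
  + by apply: filt_mono (filt_cons q w'0 wb IH); lia.
- by rewrite modeDr modeZr; apply: filt_lin.
- by rewrite mode0r; apply: filt_0.
- by apply: filt_mono IH; lia.
Qed.

(** Both claims go together by induction on x through associativity. The second one says that
    nonnegative products vanish on the associated graded space. *)
Lemma filt_mul p d (x : V) y n : filt p x -> filt d y ->
  filt (p + d) (mode x n y) /\ (0 <= n -> filt (p + d - 1) (mode x n y)).
Proof.
move=> px; elim: px d y n => {p x}
  [p p0|w a q p x w0 wa px IH|c p u v _ IHu _ IHv|p|p e v pe _ IH] d y n dy.
- rewrite mode_vacuum; case: eqP => [->|_]; last by split=> *; apply: filt_0.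
  by split=> [|//]; apply: filt_mono dy; lia.
- have [N0 /(_ N0 (leqnn _)) ->] := borcherds_assoc a x q n y.
  have sF e := subspace_filt e.
  split=> [|n0]; apply: subspace_sum => // i _; apply: subspaceZ => //; apply: subspaceB => //.
  + by have := filt_mode (q - i%:Z) wa (IH _ _ (n + i%:Z) dy).1; rewrite addrA.
  + apply: subspaceZ => //.
    have [H _] := IH _ _ (n + q - i%:Z) (filt_annih wa dy (leq0n i : 0 <= i%:Z)).
    by apply: filt_mono H; lia.
  + have H := filt_mode (q - i%:Z) wa ((IH _ _ (n + i%:Z) dy).2 ltac:(lia)).
    by apply: filt_mono H; lia.
  + apply: subspaceZ => //.
    have [H _] := IH _ _ (n + q - i%:Z) (filt_annih wa dy (leq0n i : 0 <= i%:Z)).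
    by apply: filt_mono H; lia.
- rewrite modeDl modeZl; have [u1 u2] := IHu _ _ n dy; have [v1 v2] := IHv _ _ n dy.
  by split=> [|n0]; apply: filt_lin => //; [apply: u2|apply: v2].
- by rewrite mode0l; split=> *; apply: filt_0.
- have [H1 H2] := IH _ _ n dy; split=> [|n0]; first by apply: filt_mono H1; lia.
  by apply: filt_mono (H2 n0); lia.
Qed.

Lemma filt_self (w : int) a : wsp w a -> filt w a.
Proof.
move=> wa; rewrite -(mode_creation a) -[w]addr0; apply: filt_mode => //.
exact: filt_vac.
Qed.

Notation letter := ((nat * V) * nat)%type.
Implicit Types (l : seq letter).

(* The letter ((w, b), n) stands for the mode b_{-n-1} of a vector of weight w. *)
Definition monomial l y := foldr (fun x v => mode x.1.2 (Negz x.2) v) y l.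

Definition wt l : int := \sum_(x <- l) x.1.1%:Z.

Definition over (B : seq (nat * V)) l := {in l, forall x, x.1 \in B}.

Lemma over_cons B x l : over B (x :: l) -> x.1 \in B /\ over B l.
Proof.
by move=> H; split=> [|y yl]; apply: H; rewrite inE ?eqxx ?yl ?orbT.
Qed.

Lemma monomial_cat l l' y : monomial (l ++ l') y = monomial l (monomial l' y).
Proof. by rewrite /monomial foldr_cat. Qed.

(** * Spanning by monomials with distinct modes *)

Section Spanning.
Variable B : seq (nat * V).
Hypothesis wtB : {in B, forall x, (0 < x.1)%N /\ wsp x.1%:Z x.2}.
Hypothesis genB : forall (w : nat) a, (0 < w)%N -> wsp w%:Z a -> exists z,
  filt (w%:Z - 1) z /\ span [set x.2 | x in [set x | x \in B /\ x.1 = w]] (a - z).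

Lemma filt_monomial l y d : over B l -> filt d y -> filt (wt l + d) (monomial l y).
Proof.
rewrite /wt; elim: l => [|x l IH] lB dy; first by rewrite big_nil add0r.
have [xB {}lB] := over_cons lB; have [_ wx] := wtB xB.
by rewrite big_cons -addrA; apply: filt_mode => //; apply: IH.
Qed.

Lemma perm_wt l l' : perm_eq l l' -> wt l = wt l'.
Proof. by move=> ll'; rewrite /wt (perm_big _ ll'). Qed.

Lemma monomial_perm l l' y d : over B l -> filt d y -> perm_eq l l' ->
  filt (wt l + d - 1) (monomial l y - monomial l' y).
Proof.
move=> lB dy ll'.
pose P l l' := perm_eq l l' /\
  (over B l -> filt (wt l + d - 1) (monomial l y - monomial l' y)).
suff: P l l' by case=> _; apply.
apply: perm_eq_rel_ind ll' => {l l' lB}.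
- by move=> l; split=> // _; rewrite subrr; apply: filt_0.
- move=> x l l' [pll' IH]; split; first by rewrite perm_cons.
  move=> /over_cons[xB lB]; have [_ wx] := wtB xB.
  rewrite /= -modeBr; have := filt_mode (Negz x.2) wx (IH lB).
  by rewrite /wt big_cons !addrA.
- move=> x y' l; split; first by rewrite -[x :: _]cat1s -[y' :: l]cat1s perm_catCA.
  move=> /over_cons[xB /over_cons[yB lB]]; have [_ wx] := wtB xB; have [_ wy] := wtB yB.
  have := filt_comm (Negz x.2) (Negz y'.2) wx wy (filt_monomial lB dy).
  by rewrite /wt !big_cons !addrA.
- move=> l1 l2 l3 [p12 H12] [p23 H23]; split; first exact: perm_trans p12 p23.
  move=> l1B; rewrite -(subrKA (monomial l2 y)); apply: subspaceD.
  + exact: subspace_filt.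
  + exact: H12.
  + by rewrite (perm_wt p12); apply: H23 => x; rewrite -(perm_mem p12); apply: l1B.
Qed.

(** In the associativity formula for (a_{-n-1} X)_{-1} y every term but the leading a_{-n-1} X_{-1}
    y contains a nonnegative mode acting on y, hence drops in the filtration. *)
Lemma monomial_split l y d : over B l -> filt d y ->
  filt (wt l + d - 1) (monomial l y - mode (monomial l vacuum) (-1) y).
Proof.
move=> lB dy; elim: l lB => [|x l IH] lB.
  by rewrite /= mode_vacuum eqxx subrr; apply: filt_0.
have [xB {}lB] := over_cons lB; have [_ wx] := wtB xB; have {}IH := IH lB.
rewrite /= /wt big_cons -/(wt l).
set X := monomial l vacuum in IH *.
have FX : filt (wt l) X by rewrite -[wt l]addr0; apply: filt_monomial => //; apply: filt_vac.
have [N0 /(_ N0.+1 (leqnSn _)) ->] := borcherds_assoc x.1.2 X (Negz x.2) (- 1) y.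
have sF e := subspace_filt e.
have low (i : nat) : filt (x.1.1%:Z + wt l + d - 1)
    ((-1) ^ Negz x.2 *: mode X (-1 + Negz x.2 - i%:Z) (mode x.1.2 i%:Z y)).
  apply: subspaceZ => //.
  have [H _] := filt_mul (-1 + Negz x.2 - i%:Z) FX (filt_annih wx dy (leq0n i : 0 <= i%:Z)).
  by apply: filt_mono H; lia.
rewrite big_ord_recl expr0 zbinom_r0 mulr1 scale1r subr0 addr0 opprD addrA.
apply: subspaceB => //.
  rewrite opprB addrCA; apply: subspaceD => //.
  by rewrite -modeBr; have := filt_mode (Negz x.2) wx IH; rewrite !addrA.
apply: subspace_sum => // i _; apply: subspaceZ => //; apply: subspaceB => //.
rewrite /= /bump leq0n add1n.
have [_ H] := filt_mul (-1 + i.+1%:Z) FX dy.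
have := filt_mode (Negz x.2 - i.+1%:Z) wx (H ltac:(lia)).
by rewrite !addrA.
Qed.

Definition symbols d : set V :=
  span [set monomial l vacuum | l in [set l | over B l /\ wt l = d]].

Lemma subspace_symbols d : subspace (symbols d).
Proof. exact: subspace_span. Qed.

Definition leading d v := exists r, filt (d - 1) r /\ symbols d (v - r).

Lemma subspace_leading d : subspace (leading d).
Proof.
split; first by exists 0; split; [exact: filt_0|rewrite subr0; case: (subspace_symbols d)].
move=> c u v [r [Fr Sr]] [s [Fs Ss]]; exists (c *: r + s); split; first exact: filt_lin.
rewrite opprD addrACA -scalerBr.
by have [_] := subspace_symbols d; apply.
Qed.

Lemma leading_low d v : filt (d - 1) v -> leading d v.
Proof.
by move=> dv; exists v; split=> //; rewrite subrr; case: (subspace_symbols d).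
Qed.

Lemma leading_monomial l : over B l -> leading (wt l) (monomial l vacuum).
Proof.
move=> lB; exists 0; split; first exact: filt_0.
by rewrite subr0; apply: sub_span; exists l.
Qed.

Lemma filt_leading d v : filt d v -> leading d v.
Proof.
elim=> {d v} [d d0|w a n d v w0 wa dv [r [Fr Sr]]|c d u v _ IHu _ IHv|d|d e v de dv IH].
- have [->|dn0] := eqVneq d 0; last by apply: leading_low; apply: filt_vac; lia.
  by have := @leading_monomial [::] (fun=> _); rewrite /wt big_nil; apply.
- rewrite -(subrK r v) modeDr; apply: subspaceD; first exact: subspace_leading.
    move: Sr {dv}; set u := v - r => Su.
    have sP : subspace [set u | leading (w + d) (mode a n u)].
      split; first by rewrite /= mode0r; apply: leading_low; apply: filt_0.
      move=> c u1 u2 /= P1 P2; rewrite modeDr modeZr.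
      by have [_] := subspace_leading (w + d); apply.
    apply: (span_sub sP _ Su) => _ [l [lB <-] <-] /= {u Su Fr sP}.
    have Fy : filt (wt l) (monomial l vacuum).
      by rewrite -[wt l]addr0; apply: filt_monomial => //; apply: filt_vac.
    case: n => n; first by apply: leading_low; apply: filt_annih.
    case: w w0 wa => // w w0 wa; have [z [Fz Sz]] := genB w0 wa.
    rewrite -(subrK z a) modeDl; apply: subspaceD; first exact: subspace_leading.
      have sP : subspace [set u | leading (w%:Z + wt l) (mode u (Negz n) (monomial l vacuum))].
        split; first by rewrite /= mode0l; apply: leading_low; apply: filt_0.
        move=> c u1 u2 /= P1 P2; rewrite modeDl modeZl.
        by have [_] := subspace_leading (w%:Z + wt l); apply.
      apply: (span_sub sP _ Sz) => _ [b [bB bw] <-] /=.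
      have := @leading_monomial ((b, n) :: l); rewrite /wt big_cons /= bw; apply.
      by move=> x; rewrite inE => /orP[/eqP -> //|]; apply: lB.
    apply: leading_low; have [H _] := filt_mul (Negz n) Fz Fy.
    by apply: filt_mono H; lia.
  by apply: leading_low; have := filt_mode n wa Fr; rewrite addrA.
- by have [_] := subspace_leading d; apply.
- by apply: leading_low; apply: filt_0.
- have [<- //|dne] := eqVneq d e; apply: leading_low; apply: filt_mono dv; lia.
Qed.

(** Termination measure: spreading two equal modes raises the sum of squares, keeps the sum [summ],
    and the former is bounded by the square of the latter. *)
Definition sumsq (l : seq letter) := (\sum_(x <- l) x.2 ^ 2)%N.
Definition summ (l : seq letter) := (\sum_(x <- l) x.2)%N.

Lemma sumsq_le l : (sumsq l <= summ l ^ 2)%N.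
Proof.
rewrite /sumsq /summ; elim: l => [|x l IH]; first by rewrite !big_nil.
rewrite !big_cons; apply: leq_trans (leq_add (leqnn _) IH) _.
by rewrite sqrnD leq_addr.
Qed.

Lemma spread_sq (i q : nat) : (i < (q.*2).+1)%N -> i != q ->
  (q ^ 2 + q ^ 2 < i ^ 2 + (q.*2 - i) ^ 2)%N.
Proof.
move=> i2 iq; have [j jE] : exists j, j = (q.*2 - i)%N by eexists.
rewrite -jE !expnS !expn0 !muln1; have E : (i + j)%N = q.*2 by lia.
have [iq'|qi] := leqP i q; nia.
Qed.

Lemma repeated_mode l : ~~ uniq (map snd l) ->
  exists x1 x2 (q : nat) l', perm_eq l [:: (x1, q), (x2, q) & l'].
Proof.
elim: l => //= -[a q] l IH; rewrite negb_and negbK => /orP[|/IH[a' [b' [q' [l' pl]]]]].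
  move=> /mapP[[b q'] bl /= ->]; exists a, b, q', (rem (b, q') l).
  by rewrite perm_cons; apply: perm_to_rem.
exists a', b', q', ((a, q) :: l').
apply: perm_trans (_ : perm_eq ((a, q) :: [:: (a', q'), (b', q') & l']) _).
  by rewrite perm_cons.
by rewrite -[(a, q) :: l']cat1s -[[:: (a', q'), _ & _]]/([:: (a', q'); (b', q')] ++ _)
  -[(a, q) :: _]cat1s perm_catCA.
Qed.

(* A monomial with two equal modes a_{-q-1} b_{-q-1} is rewritten by means of
   (a_{-1} b)_{-2q-1} into shorter ones and ones whose modes are more spread out. *)
Lemma monomial_in (Y : set V) d : subspace Y -> filt (d - 1) `<=` Y ->
  (forall l, over B l -> uniq (map snd l) -> wt l = d -> Y (monomial l vacuum)) ->
  forall l, over B l -> wt l = d -> Y (monomial l vacuum).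
Proof.
move=> sY Ylow Yuniq l.
have [s] := ubnP (size l); elim: s l => // s IHs l; rewrite ltnS => ls.
have [t] := ubnP (summ l ^ 2 - sumsq l)%N.
elim: t l ls => // t IHt l ls; rewrite ltnS => lt lB ld.
have [ul|/repeated_mode[a [b [q [l' pl]]]]] := boolP (uniq (map snd l)); first exact: Yuniq.
have sF e := subspace_filt e.
have vac0 : filt 0 vacuum by apply: filt_vac.
rewrite -(subrK (monomial [:: (a, q), (b, q) & l'] vacuum) (monomial l _)).
apply: subspaceD => //.
  by apply: Ylow; have := monomial_perm lB vac0 pl; rewrite addr0 ld.
have lB' x : x \in [:: (a, q), (b, q) & l'] -> x.1 \in B.
  by rewrite -(perm_mem pl); apply: lB.
have aB : a \in B by apply: (lB' (a, q)); rewrite mem_head.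
have bB : b \in B by apply: (lB' (b, q)); rewrite !inE eqxx orbT.
have l'B : over B l' by move=> x xl'; apply: lB'; rewrite !inE xl' !orbT.
have [a0 wa] := wtB aB; have [b0 wb] := wtB bB.
have dE : a.1%:Z + b.1%:Z + wt l' = d.
  by rewrite -ld (perm_wt pl) /wt !big_cons /= addrA.
set y := monomial l' vacuum.
have Fy : filt (wt l') y by rewrite -[wt l']addr0; apply: filt_monomial.
have wab : wsp (a.1 + b.1)%N%:Z (mode a.2 (-1) b.2).
  by have := mode_wsp (-1) wa wb; congr (wsp _ _); lia.
(* Up to lower terms, (a_{-1} b)_{-2q-1} y is the sum of the a_{-i-1} b_{-(2q-i)-1} y. The sum is
   cut after i = 2q, beyond which the mode of b is nonnegative; the wanted monomial is the term i =
   q. *)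
have [N0 /(_ ((q.*2).+1 + N0)%N (leq_addl _ _))] := borcherds_assoc a.2 b.2 (- 1) (Negz q.*2) y.
(* Modulo lower filtration a_{-1} b is a combination of generators, so two letters merge into one
   and induction on the length applies. *)
have YL : Y (mode (mode a.2 (-1) b.2) (Negz q.*2) y).
  have ab0 : (0 < a.1 + b.1)%N by rewrite addn_gt0 a0.
  have [z [Fz Sz]] := genB ab0 wab.
  rewrite -(subrK z (mode a.2 _ _)) modeDl; apply: subspaceD => //.
    have sP : subspace [set u | Y (mode u (Negz q.*2) y)].
      split; first by rewrite /= mode0l; case: sY.
      by move=> c u1 u2 /= P1 P2; rewrite modeDl modeZl; case: sY => _; apply.
    apply: (span_sub sP _ Sz) => _ [e [eB ew] <-] /=.
    apply: (IHs ((e, q.*2) :: l')).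
    - by apply: leq_trans ls; rewrite (perm_size pl).
    - by move=> x; rewrite inE => /orP[/eqP -> //|]; apply: l'B.
    - by rewrite /wt big_cons /= ew -dE.
  apply: Ylow; have [H _] := filt_mul (Negz q.*2) Fz Fy.
  by apply: filt_mono H; lia.
have Yba (r : int) (i : nat) : Y (mode b.2 r (mode a.2 i%:Z y)).
  apply: Ylow; have := filt_mode r wb (filt_annih wa Fy (leq0n i : 0 <= i%:Z)).
  by apply: filt_mono; lia.
have coefN1 (i : nat) : (-1) ^+ i * zbinom K (- 1) i = 1.
  by rewrite zbinomN1 -expr2 sqrr_sign.
have E1 (i : nat) : - 1 - i%:Z = Negz i by lia.
have q2 : (q < (q.*2).+1)%N by lia.
rewrite big_split_ord /= (bigD1 (Ordinal q2)) //=.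
rewrite coefN1 scale1r E1 (_ : Negz q.*2 + q%:Z = Negz q); last by lia.
pose Z := mode a.2 (Negz q) (mode b.2 (Negz q) y).
move=> E; change (Y Z); move: E.
rewrite -[mode a.2 (Negz q) (mode _ _ _)]/Z -addrA => /esym/(canRL (addrK _)) E.
rewrite (_ : Z = Z - (-1) ^ (-1) *: mode b.2 (Negz q.*2 - 1 - q%:Z) (mode a.2 q%:Z y)
  + (-1) ^ (-1) *: mode b.2 (Negz q.*2 - 1 - q%:Z) (mode a.2 q%:Z y)); last by rewrite subrK.
apply: subspaceD => //; last exact: subspaceZ.
rewrite E; apply: subspaceB => //; apply: subspaceD => //.
  rewrite -big_filter; apply: subspace_sum => // i; rewrite mem_filter => /andP[iq _].
  rewrite coefN1 scale1r E1; apply: subspaceB => //; last first.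
    exact: subspaceZ.
  rewrite (_ : Negz q.*2 + i%:Z = Negz (q.*2 - i)); last by have := ltn_ord i; lia.
  have i2 := ltn_ord i.
  have iq' : nat_of_ord i != q by apply: contraNneq iq => iq; apply/eqP/val_inj.
  apply: (IHt [:: (a, nat_of_ord i), (b, (q.*2 - i)%N) & l']).
  - by apply: leq_trans ls; rewrite (perm_size pl).
  - apply: leq_trans lt; rewrite /summ /sumsq !(perm_big _ pl) /= !big_cons /=.
    have := sumsq_le [:: (a, nat_of_ord i), (b, (q.*2 - i)%N) & l'].
    rewrite /summ /sumsq !big_cons /=.
    rewrite (_ : i + (q.*2 - i + _) = q + (q + \sum_(j <- l') j.2))%N; last by lia.
    move=> sq; apply: ltn_sub2l; first (apply: leq_trans sq); rewrite !addnA ltn_add2r.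
      exact: spread_sq.
    exact: spread_sq.
  - by move=> x; rewrite !inE => /or3P[/eqP -> //|/eqP -> //|]; apply: l'B.
  - by rewrite /wt !big_cons /= addrA.
apply: subspace_sum => // i _; rewrite coefN1 scale1r; apply: subspaceB => //; last first.
  exact: subspaceZ.
apply: Ylow.
have := filt_mode (- 1 - ((q.*2).+1 + i)%N%:Z) wa
  (filt_annih wb Fy (_ : 0 <= Negz q.*2 + ((q.*2).+1 + i)%N%:Z)).
by move=> /(_ ltac:(lia)); apply: filt_mono; lia.
Qed.

End Spanning.
End Filtration.
(** * Cyclic orbifolds *)

Fixpoint lists (T : Type) k (A : seq T) : seq (seq T) :=
  if k is k'.+1 then [seq x :: l | x <- A, l <- lists k' A] else [:: [::]].

Lemma mem_lists (T : eqType) (A l : seq T) : {subset l <= A} -> l \in lists (size l) A.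
Proof.
elim: l => [|x l IH] lA //=; apply: allpairs_f; first by apply: lA; rewrite mem_head.
by apply: IH => y yl; apply: lA; rewrite inE yl orbT.
Qed.

(** * Projection onto weight spaces *)

Section WeightComponents.
Context {R : realType} (V : voaType R).
Local Notation K := R[i].

(* The operator \prod_{p in s} (L(0) - p) / (w - p) projects onto weight w. *)
Definition wproj (w : int) (s : seq int) : V -> V :=
  foldr (fun p T v => (w - p)%:~R^-1 *: (mode conformal 1 (T v) - p%:~R *: T v)) id s.

Lemma wproj_linear w s : linear (wproj w s).
Proof.
elim: s => //= p s IH c u v; rewrite IH modeDr modeZr [p%:~R *: _]scalerDr opprD addrACA scalerDr.
congr (_ + _); rewrite [p%:~R *: _]scalerA [p%:~R * c]mulrC -scalerA -scalerBr.
by rewrite !scalerA mulrC.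
Qed.

Lemma wproj_wsp w s q (v : V) : wsp q v ->
  wproj w s v = (\prod_(p <- s) ((w - p)%:~R^-1 * (q - p)%:~R)) *: v.
Proof.
move=> qv; elim: s => [|p s IH]; first by rewrite big_nil scale1r.
rewrite big_cons /= IH modeZr (wspE q v).1 // !scalerA -scalerBl scalerA; congr (_ *: _).
by rewrite -mulrA; congr (_ * _); rewrite intrB mulrBl [_ * q%:~R]mulrC.
Qed.

Lemma span_weight (H : set V) w v : (forall h, H h -> exists p, wsp p h) ->
  wsp w v -> span H v -> span (H `&` wsp w) v.
Proof.
move=> Hw wv [s [sH vE]].
have /choice [k kP] : forall e : K * V, exists p, e \in s -> wsp p e.2.
  by move=> e; have [/sH/Hw[p pP]|] := boolP (e \in s); [exists p|exists 0].
pose t := [seq p <- [seq k e | e <- s] | p != w].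
have wproj_v : wproj w t v = v.
  rewrite (wproj_wsp _ _ wv) big_seq big1 ?scale1r // => p; rewrite mem_filter => /andP[pw _].
  by rewrite mulVf // intr_eq0 subr_eq0 eq_sym.
rewrite -wproj_v vE.
have -> : wproj w t (\sum_(e <- s) e.1 *: e.2) = \sum_(e <- s) e.1 *: wproj w t e.2.
  elim: (s) => [|e r IH]; last by rewrite !big_cons wproj_linear IH.
  by rewrite !big_nil (wproj_wsp _ _ (subspace_wsp V 0).1) scaler0.
apply: subspace_sum => [|e es]; first exact: subspace_span.
apply: subspaceZ; first exact: subspace_span.
have ke := kP _ es; have [kw|kw] := eqVneq (k e) w.
  rewrite (wproj_wsp _ _ ke); apply: subspaceZ; first exact: subspace_span.
  by apply: sub_span; split; [exact: sH|rewrite -kw].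
rewrite (wproj_wsp _ _ ke) (big_rem (k e)) /=; last first.
  by rewrite mem_filter kw map_f.
by rewrite subrr mulr0 mul0r scale0r; case: (subspace_span (H `&` wsp w)).
Qed.

End WeightComponents.

(** * Finite codimension of [C2g] *)

Section Cofiniteness.
Context {R : realType} (V : voaType R).
Local Notation K := R[i].
Implicit Types (a c u v : V).
Hypotheses (cft : CFT_type V) (simpleV : simple_voa V) (cofV : C2_cofinite V).
Variables (g : voa_aut V) (n : nat).
Hypotheses (n_prime : prime n) (gn : forall v, iter n g v = v).
Notation letter := ((nat * V) * nat)%type.
Implicit Types (l : seq letter).

(** The vector u_{-2} v has weight wt u + wt v + 1 but lies in filtration degree wt u + wt v; the
    remaining spanning vectors have weight below w and do not contribute in weight w'. *)
Lemma C2_low (w : nat) a : (forall v : V, span (C2 (mode : V -> int -> V -> V) `|`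
     [set h | exists p : nat, (p < w)%N /\ wsp p%:Z h]) v) ->
  forall w' : nat, (w <= w')%N -> wsp w'%:Z a -> filt (w'%:Z - 1) a.
Proof.
move=> spanT w' ww' aw'.
pose H1 : set V := [set h | exists u v (p q : nat),
  [/\ wsp p%:Z u, wsp q%:Z v & h = mode u (- 2) v]].
pose H2 : set V := [set h | exists p : nat, (p < w)%N /\ wsp p%:Z h].
have aH : span (H1 `|` H2) a.
  apply: (span_sub (subspace_span _) _ (spanT a)) => h [|h2]; last by apply: sub_span; right.
  apply: span_sub; first exact: subspace_span.
  move=> _ [u [v [p [p0 pu ->]]]].
  have sP : subspace [set v | span (H1 `|` H2) (mode u (- 2) v)].
    have [S0 SD] := subspace_span (H1 `|` H2).
    by split=> [|k v1 v2 /= P1 P2]; rewrite /= ?mode0r // modeDr modeZr; apply: SD.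
  apply: (span_sub sP _ (span_homog cft v)) => {}v [q qv] /=.
  case: p p0 pu => // p _ pu; apply: sub_span; left; by exists u, v, p, q.
have Hw h : (H1 `|` H2) h -> exists p, wsp p h.
  by case=> [[u [v [p [q [pu qv ->]]]]]|[p [_ ph]]]; eexists; [exact: mode_wsp pu qv|exact: ph].
suff F : ((H1 `|` H2) `&` wsp w'%:Z) `<=` filt (w'%:Z - 1).
  exact: (span_sub (subspace_filt V (w'%:Z - 1)) F (span_weight Hw aw' aH)).
move=> h [[[u [v [p [q [pu qv ->]]]]]|[p [pw ph]]] hw].
  have [->|h0] := eqVneq (mode u (- 2) v) 0; first exact: filt_0.
  have E := wsp_uniq (mode_wsp (- 2) pu qv) hw h0.
  by apply: filt_mono (filt_mode cft (- 2) pu (filt_self cft qv)); lia.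
have [->|h0] := eqVneq h 0; first exact: filt_0.
by have := wsp_uniq ph hw h0; lia.
Qed.

(** Above the weights of a finite complement of C_2(V), [C2_low] applies. Below, B collects the
    eigencomponents of spanning sets of the finitely many positive weight spaces. *)
Lemma generators : exists B : seq (nat * V),
  [/\ {in B, forall x, (0 < x.1)%N /\ wsp x.1%:Z x.2}, {in B, forall x, bihomog g n x.2} &
   forall (w : nat) a, (0 < w)%N -> wsp w%:Z a -> exists z,
     filt (w%:Z - 1) z /\ span [set x.2 | x in [set x | x \in B /\ x.1 = w]] (a - z)].
Proof.
have [B0 B0E] := cofV.
have [w0 w0P] : exists w0 : nat, forall v : V, span (C2 (mode : V -> int -> V -> V) `|`
     [set h | exists p : nat, (p < w0)%N /\ wsp p%:Z h]) v.
  have /choice [k kP] : forall b : V, exists w : nat,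
      span [set h | exists p : nat, (p < w)%N /\ wsp p%:Z h] b.
    move=> b; have [s [sh ->]] := span_homog cft b.
    have /choice [k kP] : forall e : K * V, exists p : nat, e \in s -> wsp p%:Z e.2.
      by move=> e; have [/sh[p pP]|] := boolP (e \in s); [exists p|exists 0%N].
    exists (\max_(e <- s) k e).+1; apply: subspace_sum => [|e es]; first exact: subspace_span.
    apply: subspaceZ; first exact: subspace_span.
    apply: sub_span; exists (k e); split; last exact: kP.
    by rewrite ltnS; apply: leq_bigmax_seq.
  exists (\max_(b <- B0) k b) => v; have : span (C2 (mode : V -> int -> V -> V) `|` [set` B0]) v.
    by rewrite B0E.
  apply: span_sub; first exact: subspace_span.
  move=> h [hC|hB]; first by apply: sub_span; left.
  apply: (span_sub (subspace_span _) _ (kP h)) => e [p [pk ep]].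
  apply: sub_span; right; exists p; split=> //; apply: leq_trans pk _.
  by apply: (leq_bigmax_seq (F := k)).
have /choice [Bw BwP] : forall w : nat, exists Bw : seq V, wsp w%:Z = span [set` Bw].
  by move=> w; apply: grading_finite_dim.
have [zs [zsn projE]] := sum_proj g n_prime.
pose B := [seq (w.1, proj g n w.2.1 w.2.2) |
  w <- [seq (w, zb) | w <- iota 1 w0, zb <- [seq (z, b) | z <- zs, b <- Bw w]]].
have BP x : x \in B -> exists w z b, [/\ (0 < w)%N, z \in zs, b \in Bw w & x = (w, proj g n z b)].
  move=> /mapP[_ /allpairsPdep[w [_ [wi /allpairsP[[z b] [/= zz bb ->]] ->]]] ->].
  by exists w, z, b; move: wi; rewrite mem_iota => /andP[].
have bw w b : b \in Bw w -> wsp w%:Z b by move=> bB; rewrite BwP; apply: sub_span.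
exists B; split.
- by move=> _ /BP[w [z [b [w1 zz bb ->]]]] /=; split=> //; apply: wsp_proj; apply: bw.
- move=> _ /BP[w [z [b [w1 zz bb ->]]]] /=; split.
    by exists w; apply: wsp_proj; apply: bw.
  by exists z; split; [exact: zsn|apply: chg_proj => //; exact: zsn].
move=> w a w1 aw; have [ww0|w0w] := leqP w0 w.
  exists a; split; first exact: (C2_low w0P ww0).
  by rewrite subrr; case: (subspace_span [set x.2 | x in [set x | x \in B /\ x.1 = w]]).
exists 0; split; first exact: filt_0.
rewrite subr0 (projE a); apply: subspace_sum => [|z zz]; first exact: subspace_span.
have : span [set` Bw w] a by rewrite -BwP.
move: {aw} a; apply: (span_sub (subspace_preim (proj g n z) (subspace_span _))) => b /= bb.
apply: sub_span; exists (w, proj g n z b) => //; split=> //.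
apply/mapP; exists (w, (z, b)) => //; apply: allpairs_f_dep; last exact: allpairs_f.
by rewrite mem_iota w1 add1n ltnS ltnW.
Qed.

(** Each letter receives a variable of its own, so that a monomial becomes a single coefficient of a
    [word]. *)
Fixpoint indexed (i : nat) (bs : seq (nat * V)) : seq (nat * V) :=
  if bs is b :: bs' then (i, b.2) :: indexed i.+1 bs' else [::].

Lemma idx_indexed i bs : idx (indexed i bs) = iota i (size bs).
Proof. by elim: bs i => //= b bs IH i; rewrite IH. Qed.

Lemma mem_indexed i bs x : x \in indexed i bs -> exists2 b, b \in bs & x.2 = b.2.
Proof.
elim: bs i => //= b bs IH i; rewrite inE => /orP[/eqP ->|/IH[b' b'bs ->]].
  by exists b; rewrite ?mem_head.
by exists b' => //; rewrite inE b'bs orbT.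
Qed.

Lemma word_indexed i l : monomial l vacuum =
  word (indexed i (map fst l)) vacuum (fun j => Negz (nth 0%N (map snd l) (j - i))).
Proof.
elim: l i => //= x l IH i; rewrite subnn (IH i.+1); congr (mode _ _ _).
apply: word_ext => j; rewrite idx_indexed mem_iota => /andP[ij _].
by rewrite -(subnSK ij).
Qed.

Lemma sum_indexed i (s : seq nat) :
  \sum_(j <- iota i (size s)) Negz (nth 0%N s (j - i)) = - (\sum_(q <- s) q.+1)%N%:Z.
Proof.
elim: s i => [|q s IH] i; first by rewrite !big_nil.
rewrite [iota _ _]/= !big_cons subnn big_seq.
under eq_bigr => j.
  rewrite mem_iota => /andP[ij _]; rewrite -(subnSK ij) [nth _ _ _]/=; over.
by rewrite -big_seq IH PoszD opprD NegzE.
Qed.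

Variable B : seq (nat * V).
Hypothesis wtB : {in B, forall x, (0 < x.1)%N /\ wsp x.1%:Z x.2}.
Hypothesis biB : {in B, forall x, bihomog g n x.2}.
Hypothesis genB : forall (w : nat) a, (0 < w)%N -> wsp w%:Z a -> exists z,
  filt (w%:Z - 1) z /\ span [set x.2 | x in [set x | x \in B /\ x.1 = w]] (a - z).

Definition modes_sum l := (\sum_(q <- map snd l) q.+1)%N.

(** The bound of [bounded_all] depends on the vectors but not on the modes, and there are finitely
    many lists of at most k vectors from B. *)
Lemma bounded_monomial k : exists M, forall l, over B l -> (size l <= k)%N ->
  (M <= modes_sum l)%N -> C2g g (monomial l vacuum).
Proof.
have /choice [M MP] : forall bs : seq (nat * V), exists M : nat, {subset bs <= B} ->
    low (C2g g) M (idx (indexed 0 bs)) (word (indexed 0 bs) vacuum).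
  move=> bs; have [bsB|] := pselect {subset bs <= B}; last by exists 0%N.
  have [|x /mem_indexed[b bbs ->]|M MP] := bounded_all cft simpleV n_prime gn (l := indexed 0 bs).
  - by rewrite idx_indexed iota_uniq.
  - by apply: biB; apply: bsB.
  - by exists M.
pose Ms := [seq M bs | j <- iota 0 k.+1, bs <- lists j B].
exists (\max_(q <- Ms) q) => l lB lk Ml.
have sB : {subset map fst l <= B} by move=> _ /mapP[x xl ->]; apply: lB.
rewrite (word_indexed 0); apply: (MP _ sB).
rewrite idx_indexed size_map -(size_map snd) sum_indexed -/(modes_sum l).
have : M (map fst l) \in Ms.
  apply/allpairsPdep; exists (size l), (map fst l); split=> //; first by rewrite mem_iota.
  by rewrite -(size_map fst); apply: mem_lists.
move=> MMs; have := @leq_bigmax_seq _ Ms xpredT id _ MMs isT.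
by move=> /= H; rewrite lerN2 lez_nat; apply: leq_trans H Ml.
Qed.

(** Averaging turns u into a combination of x_q d with both x and d fixed. The associativity formula
    for (x_q d)_{-1} y then has outer modes x_{q-i} or d_{q-1-i}, all of index at most -2. *)
Lemma C2g_ideal u y : g u = u -> C2g g u -> C2g g (mode u (-1) y).
Proof.
move=> gu uC; rewrite -(proj1_fixed n_prime gu).
have sP : subspace [set u | C2g g (mode (proj g n 1 u) (-1) y)].
  have [C0 CD] := subspace_C2g g.
  split; first by rewrite /= linear0 mode0l.
  by move=> k u1 u2 /= P1 P2; rewrite linearP modeDl modeZl; apply: CD.
apply: (span_sub sP _ uC) => _ [x [q [c [gx q2 ->]]]] /=.
rewrite proj1_mode //; set d := proj g n 1 c; have gd : g d = d by apply: proj1_fixes.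
have [N0 /(_ N0 (leqnn _)) ->] := borcherds_assoc x d q (- 1) y.
have sC := subspace_C2g g.
apply: subspace_sum => // i _; apply: subspaceZ => //; apply: subspaceB => //.
  by apply: C2g_mode => //; lia.
by apply: subspaceZ => //; apply: C2g_mode => //; lia.
Qed.

(** The n + 1 partial products are n-th roots of unity, of which there are at most n; two of them
    agree, and their quotient is the product of a segment. *)
Lemma neutral_segment (zc : letter -> K) (t : seq letter) : size t = n ->
  {in t, forall x, zc x ^+ n = 1} ->
  exists t1 t2 t3, [/\ t = t1 ++ t2 ++ t3, t2 != [::] & \prod_(x <- t2) zc x = 1].
Proof.
move=> tn zt; pose P j := \prod_(x <- take j t) zc x.
have Pn (s : seq letter) : {subset s <= t} -> (\prod_(x <- s) zc x) ^+ n = 1.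
  elim: s => [|x s IH] st; first by rewrite big_nil expr1n.
  rewrite big_cons exprMn IH ?mulr1 ?zt // ?st ?mem_head //.
  by move=> y ys; apply: st; rewrite inE ys orbT.
have n0 := prime_gt0 n_prime.
have : ~~ uniq [seq P j | j <- iota 0 n.+1].
  apply/negP => uP; have := max_unity_roots n0 (rs := [seq P j | j <- iota 0 n.+1]) _ uP.
  rewrite size_map size_iota ltnn => H; suff : false by []; apply: H.
  apply/allP => _ /mapP[j _ ->]; apply/unity_rootP; apply: Pn => x; exact: mem_take.
move=> /(uniqPn 0)[i [j [ij]]]; rewrite size_map size_iota => jn.
rewrite !(nth_map 0%N) ?size_iota ?(ltn_trans ij) // !nth_iota ?(ltn_trans ij) // !add0n => PE.
exists (take i t), (drop i (take j t)), (drop j t).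
have tE : take j t = take i t ++ drop i (take j t).
  by rewrite -[in RHS](take_takel t (ltnW ij)) cat_take_drop.
split; first by rewrite catA -tE cat_take_drop.
  by rewrite -size_eq0 size_drop size_take tn -lt0n; case: ifP; lia.
have H := PE; rewrite /P tE big_cat /= in H.
have Pi0 : \prod_(x <- take i t) zc x != 0.
  apply/eqP => P0; have /eqP := Pn (take i t) (fun x => @mem_take _ _ _ _).
  by rewrite P0 expr0n (gtn_eqF n0) eq_sym oner_eq0.
by apply: (mulfI Pi0); rewrite -H mulr1.
Qed.

Lemma chg_monomial (zc : letter -> K) l : {in l, forall x, chg g (zc x) x.1.2} ->
  chg g (\prod_(x <- l) zc x) (monomial l vacuum).
Proof.
rewrite /chg; elim: l => [|x l IH] lz; first by rewrite big_nil scale1r /= voa_aut_vacuum.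
rewrite big_cons /= voa_aut_mode IH; last by move=> y yl; apply: lz; rewrite inE yl orbT.
by rewrite lz ?mem_head // modeZr modeZl scalerA mulrC.
Qed.

Lemma long_monomial (Y : set V) (d : int) M l : subspace Y -> C2g g `<=` Y ->
  filt (d - 1) `<=` Y ->
  (forall l, over B l -> (size l <= n)%N -> (M <= modes_sum l)%N -> C2g g (monomial l vacuum)) ->
  over B l -> uniq (map snd l) -> wt l = d -> (M + n <= size l)%N -> Y (monomial l vacuum).
Proof.
move=> sY CY FY HM lB ul ld ls.
pose h := [seq x <- l | (M <= x.2)%N].
(* The modes are distinct, so at most M letters have index below M. *)
have sh : (n <= size h)%N.
  suff : (size [seq x <- l | ~~ (M <= x.2)%N] <= M)%N.
    have := count_predC (fun x : letter => (M <= x.2)%N) l.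
    rewrite /h !size_filter -[count (predC _) l]/(count (fun x => ~~ (M <= x.2)%N) l) => E sM.
    by rewrite -(leq_add2l M); apply: leq_trans ls _; rewrite -E addnC leq_add2r.
  rewrite -(size_map snd) -[X in (_ <= X)%N](size_iota 0 M); apply: uniq_leq_size.
    by apply: subseq_uniq ul; apply: map_subseq; apply: filter_subseq.
  by move=> _ /mapP[x + ->]; rewrite mem_filter mem_iota => /andP[+ _]; rewrite -ltnNge.
have /choice [zc zcP] : forall x : letter, exists z : K, x \in l -> z ^+ n = 1 /\ chg g z x.1.2.
  move=> x; have [xl|] := boolP (x \in l); last by exists 0.
  by have [_ [z zP]] := biB (lB x xl); exists z.
have hl : {subset h <= l} by move=> x; rewrite mem_filter => /andP[].
have tl : {subset take n h <= h} by move=> x; apply: mem_take.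
have [t1 [S [t3 [tE S0 S1]]]] : exists t1 t2 t3,
    [/\ take n h = t1 ++ t2 ++ t3, t2 != [::] & \prod_(x <- t2) zc x = 1].
  apply: neutral_segment; first by rewrite size_take; case: ltngtP sh; lia.
  by move=> x /tl/hl/zcP[].
have Sh : {subset S <= h} by move=> x xS; apply: tl; rewrite tE !mem_cat xS orbT.
have uS : uniq S.
  have : uniq (take n h) by apply/take_uniq/filter_uniq/(map_uniq ul).
  by rewrite tE !cat_uniq => /and3P[_ _ /and3P[]].
have pl := perm_sub uS (map_uniq ul) (fun x xS => hl x (Sh x xS)).
set J := filter _ _ in pl.
have SB : over B S by move=> x xS; apply: lB; apply: hl; apply: Sh.
have JB : over B J by move=> x; rewrite mem_filter => /andP[_ xl]; apply: lB.
have vac0 : filt 0 (vacuum : V) by apply: filt_vac.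
have Fy : filt (wt J) (monomial J vacuum).
  by rewrite -[wt J]addr0; apply: (filt_monomial cft wtB).
rewrite -(subrK (monomial (S ++ J) vacuum) (monomial l _)); apply: subspaceD => //.
  by apply: FY; have := monomial_perm cft wtB lB vac0 pl; rewrite addr0 ld.
rewrite monomial_cat -(subrK (mode (monomial S vacuum) (-1) (monomial J vacuum)) (monomial S _)).
apply: subspaceD => //.
  apply: FY; have := monomial_split cft wtB SB Fy.
  by rewrite -ld (perm_wt pl) /wt big_cat.
apply: CY; apply: C2g_ideal.
  have := @chg_monomial zc S (fun x xS => (zcP x (hl x (Sh x xS))).2).
  by rewrite S1 /chg scale1r.
(* The neutral subword has at most n letters and is nonempty, and any one of its letters already
   contributes more than M to [modes_sum]. *)
apply: HM => //.
  by have := size_take n h; rewrite tE !size_cat; case: ifP; lia.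
case: S S0 Sh {uS pl SB J JB Fy tE S1} => // x S _ Sh; rewrite /modes_sum /= big_cons.
by have := Sh x (mem_head _ _); rewrite mem_filter => /andP[Mx _]; lia.
Qed.

Lemma over_lists M l : over B l -> (modes_sum l <= M)%N ->
  l \in lists (size l) [seq (b, q) | b <- B, q <- iota 0 M].
Proof.
move=> lB lM; apply: mem_lists => -[b q] xl; apply: allpairs_f; first exact: (lB _ xl).
rewrite mem_iota /=; apply: leq_trans lM; rewrite /modes_sum big_map (big_rem _ xl) /=.
exact: leq_addr.
Qed.

Lemma cofinite_mod : exists T : seq V, forall v, span (C2g g `|` [set` T]) v.
Proof.
(* [M] serves the neutral subwords of at most n letters; [M'] serves whole words that are too short
   to be treated through such a subword. *)
have [M MP] := bounded_monomial n; have [M' MP'] := bounded_monomial (M + n).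
pose T := [seq monomial l vacuum | l <- [seq l | k <- iota 0 (M + n).+1,
  l <- lists k [seq (b, q) | b <- B, q <- iota 0 M']]].
exists T; set Y := span _; have sY : subspace Y by apply: subspace_span.
have CY : C2g g `<=` Y by move=> v vC; apply: sub_span; left.
suff F k : filt (k%:Z - 1) `<=` Y.
  move=> v; have : span (@homog R V) v by apply: span_homog.
  apply: span_sub => // u [w uw]; apply: (F w.+1).
  by apply: filt_mono (filt_self cft uw); lia.
elim: k => [|k IH] v; first by move=> /filt_neg -> //; case: sY.
move=> Fv; have {Fv} Fv : filt k%:Z v by apply: filt_mono Fv; lia.
have [r [Fr Sr]] := filt_leading cft wtB genB Fv.
rewrite -(subrK r v); apply: subspaceD => //; last exact: IH.
apply: (span_sub sY _ Sr) => _ [l [lB ld] <-].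
apply: (monomial_in cft wtB genB sY IH) lB ld => {v r Fr Sr Fv} l lB ul ld.
have [ls|ls] := leqP (M + n) (size l); first exact: (long_monomial sY CY IH MP lB ul ld ls).
have [Ml|lM] := leqP M' (modes_sum l); first by apply/CY/MP' => //; apply: ltnW.
apply: sub_span; right; apply/mapP; exists l => //; apply/allpairsPdep.
exists (size l), l; split=> //; first by rewrite mem_iota leq0n add0n ltnS ltnW.
by apply: over_lists => //; apply: ltnW.
Qed.

End Cofiniteness.

(** * Automorphisms of prime order *)

Section CyclicOrbifold.
Context {R : realType} (V : voaType R).
Local Notation K := R[i].

(** Cofiniteness of a subalgebra, phrased inside the ambient space so that it can be transported
    along inclusions. By [C2_mode], admitting all x and all q <= -2 stays within the C_2 space under
    CFT-type. *)
Definition C2_in (P : set V) : set V :=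
  span [set w | exists x q c, [/\ P x, P c, q <= - 2%:Z & w = mode x q c]].

Definition cofinite_in (P : set V) := exists T : seq V,
  P `<=` span (C2_in P `|` [set` T]) /\ {in T, forall v, P v}.

Theorem cyclic_cofinite (g : voa_aut V) n : CFT_type V -> simple_voa V -> C2_cofinite V ->
  prime n -> (forall v, iter n g v = v) -> cofinite_in [set v | g v = v].
Proof.
move=> cft simpleV cofV n_prime gn; set U := mkset _.
have [B [wtB biB genB]] := generators cft cofV n_prime gn.
have [T TP] := cofinite_mod cft simpleV n_prime gn wtB biB genB.
exists (map (proj g n 1) T); split; last first.
  by move=> _ /mapP[v _ ->]; apply: proj1_fixes.
move=> u gu; rewrite -(proj1_fixed n_prime gu).
set Y := span _; have sY : subspace Y by apply: subspace_span.
apply: (span_sub (subspace_preim (proj g n 1) sY) _ (TP u)) => v [vC|vT] /=; last first.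
  by apply: sub_span; right => /=; apply: map_f.
apply: sub_span; left.
apply: (span_sub (subspace_preim (proj g n 1) (subspace_span _)) _ vC).
move=> _ [x [q [c [gx q2 ->]]]] /=.
rewrite proj1_mode //; apply: sub_span; exists x, q, (proj g n 1 c); split=> //.
exact: proj1_fixes.
Qed.

End CyclicOrbifold.
(** * Solvable orbifolds *)

Section SubVOA.
Context {R : realType} (V : voaType R).
Local Notation K := R[i].
Implicit Types (u v c : V) (P : set V).

Definition simple_in P := forall I : set V, subspace I -> I `<=` P ->
  (forall u (m : int) v, P u -> I v -> I (mode u m v)) -> I = [set 0] \/ P `<=` I.

(** For a nonzero fixed b in I, [gen_vacuum] with charge 1 writes the vacuum through modes of fixed
    vectors on b. Hence I contains the vacuum, and with it every fixed u = u_{-1} 1. *)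
Lemma cyclic_simple (g : voa_aut V) n : CFT_type V -> simple_voa V ->
  prime n -> (forall v, iter n g v = v) -> simple_in [set v | g v = v].
Proof.
move=> cft simpleV n_prime gn I sI IU Imode.
have [[b [Ib b0]]|nob] := pselect (exists b, I b /\ b != 0); last first.
  left; apply/seteqP; split=> [v Iv|v ->]; last by case: sI.
  by apply/eqP/negPn/negP => v0; apply: nob; exists v.
right=> u gu; rewrite -(mode_creation u); apply: (Imode) => //.
have gb : chg g 1 b by rewrite /chg scale1r; apply: IU.
apply: (span_sub sI _ (gen_vacuum cft simpleV n_prime gn b0 (expr1n _ _) gb)).
by move=> _ [w [p [_ + ->]]]; rewrite /chg invr1 scale1r => gw; apply: (Imode).
Qed.

Lemma full_simple : simple_voa V -> simple_in setT.
Proof.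
move=> [_ H] I sI _ Imode; have [|->|->] := H I sI; [|by left|by right].
by move=> u m v; apply: (Imode).
Qed.

Lemma full_cofinite : C2_cofinite V -> cofinite_in (setT : set V).
Proof.
move=> [B BE]; exists B; split=> // v _.
have : span (C2 (mode : V -> int -> V -> V) `|` [set` B]) v by rewrite BE.
apply: span_sub; first exact: subspace_span.
move=> h [|hB]; last by apply: sub_span; right.
apply: span_sub; first exact: subspace_span.
move=> _ [a [u [p [_ _ ->]]]]; apply: sub_span; left; apply: sub_span.
by exists a, (- 2), u.
Qed.

(** Lower modes come from (L(-1)y)_n = -n y_{n-1}. Weight 0 does no harm, since the modes of the
    vacuum of index at most -2 vanish. *)
Lemma C2_mode (x c : V) (q : int) : CFT_type V -> q <= - 2%:Z ->
  C2 (mode : V -> int -> V -> V) (mode x q c).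
Proof.
move=> cft; set Z := C2 _; have sZ : subspace Z by apply: subspace_span.
have H (p : int) (j : nat) y : wsp p y -> Z (mode y (- 2%:Z - j%:Z) c).
  elim: j p y => [|j IH] p y py; case: (wsp_cases cft py) => [p0|[_ [k ->]]|->].
  - by apply: sub_span; exists y, c, p; rewrite subr0.
  - rewrite modeZl mode_vacuum; case: eqP => [|_]; first by lia.
    by rewrite scaler0; case: sZ.
  - by rewrite mode0l; case: sZ.
  - have k0 : (- 2%:Z - j%:Z)%:~R != 0 :> K by rewrite intr_eq0; lia.
    rewrite (_ : - 2%:Z - j.+1%:Z = - 2%:Z - j%:Z - 1); last by lia.
    rewrite -[mode y _ c](scalerK k0); apply: subspaceZ => //.
    rewrite -[_ *: _]opprK -translation -scaleN1r; apply: subspaceZ => //.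
    exact: IH (mode_wsp 0 (@conformal_weight R V) py).
  - rewrite modeZl mode_vacuum; case: eqP => [|_]; first by lia.
    by rewrite scaler0; case: sZ.
  - by rewrite mode0l; case: sZ.
move=> q2; have [j ->] : exists j : nat, q = - 2%:Z - j%:Z.
  by exists `|(q + 2%:Z)%R|%N; lia.
have sP : subspace [set x | Z (mode x (- 2%:Z - j%:Z) c)].
  split; first by rewrite /= mode0l; case: sZ.
  by move=> k u1 u2 /= P1 P2; rewrite modeDl modeZl; case: sZ => _; apply.
by apply: (span_sub sP _ (span_homog cft x)) => y [p py]; apply: (H p%:Z).
Qed.

End SubVOA.

(** * Transfer between V and its fixed point subalgebra *)

Section FixedTransfer.
Context {R : realType} (V : voaType R) (G : set (voa_aut V)).
Local Notation K := R[i].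
Local Notation W := (fixed G : voaType R).
Local Notation Vfix := [set v : V | v \in fixed_pred G].

Lemma val_lin (k : K) (u v : fixed G) : val (k *: u + v) = k *: val u + val v.
Proof. by []. Qed.

Lemma val0 : val (0 : fixed G) = 0 :> V.
Proof. by []. Qed.

Lemma subspace_val (P : set (fixed G)) : subspace P -> subspace [set val w | w in P].
Proof.
move=> [P0 PD]; split; first by exists 0; [exact: P0|exact: val0].
by move=> k _ _ [u Pu <-] [v Pv <-]; exists (k *: u + v); [exact: PD|exact: val_lin].
Qed.

Lemma subspace_unval (P : set V) : subspace P -> subspace [set w : fixed G | P (val w)].
Proof.
move=> [P0 PD]; split; first exact: P0.
by move=> k u v Pu Pv; apply: PD.
Qed.

Lemma fixed_weight (n : int) (w : fixed G) :
  weight_space (V := W) n w <-> weight_space (V := V) n (val w).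
Proof.
by split=> [/(congr1 val)|wE] //; apply: val_inj.
Qed.

Lemma fixed_CFT : CFT_type V -> CFT_type W.
Proof.
move=> [neg zero]; split=> [n n0|].
  apply/seteqP; split=> [w /fixed_weight|_ ->]; last exact: (subspace_wsp W n).1.
  by rewrite neg // => w0; apply: val_inj.
apply/seteqP; split=> w; last first.
  move=> [s [sv ->]]; apply: subspace_sum; first exact: (subspace_wsp W 0).
  move=> p /sv /= ->; apply: subspaceZ; first exact: (subspace_wsp W 0).
  exact: vacuum_wsp.
move=> /fixed_weight; rewrite zero => -[s [sv wE]].
exists [seq (p.1, vacuum : W) | p <- s]; split; first by move=> _ /mapP[p _ ->].
apply: val_inj; rewrite wE raddf_sum big_map big_seq [RHS]big_seq.
by apply: eq_bigr => p /sv /= ->.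
Qed.

Lemma fixed_C2_cofinite : CFT_type V -> cofinite_in Vfix -> C2_cofinite W.
Proof.
move=> /fixed_CFT cft [T [TP Tfix]].
exists [seq insubd (0 : fixed G) t | t <- T]; apply/seteqP; split=> // w _.
set Y := span _; have sY : subspace Y by apply: subspace_span.
suff [w' Yw' /val_inj <-] : [set val w | w in Y] (val w) by [].
have sV := subspace_val sY.
apply: (span_sub sV _ (TP _ (valP w))) => h [hC|hT].
  apply: (span_sub sV _ hC) => _ [x [q [c [xU cU q2 ->]]]].
  exists (mode (Fixed xU : W) q (Fixed cU : W)) => //.
  by apply: sub_span; left; apply: C2_mode.
exists (insubd (0 : fixed G) h); last by rewrite insubdK //; apply: Tfix.
by apply: sub_span; right; apply: map_f.
Qed.

Lemma fixed_simple : simple_voa V -> simple_in Vfix -> simple_voa W.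
Proof.
move=> [v0 _] H; split.
  by apply: contra_neq v0 => /(congr1 val).
move=> I sI Imode; have [||I0|VI] := H [set val w | w in I] (subspace_val sI).
- by move=> _ [w _ <-]; apply: (valP w).
- by move=> u m _ uU [w Iw <-]; exists (mode (Fixed uU : W) m (w : W)) => //; apply: (Imode).
- left; apply/seteqP; split=> [w Iw|_ ->]; last by case: sI.
  by apply: val_inj; suff : [set 0] (val w) by []; rewrite -I0; exists w.
- by right; apply/seteqP; split=> // w _; have [w' Iw' /val_inj <-] := VI _ (valP w).
Qed.

Lemma cofinite_in_val (P : set W) : cofinite_in P -> cofinite_in [set val w | w in P].
Proof.
move=> [T [TP Tin]]; exists (map val T); split; last first.
  by move=> _ /mapP[w wT ->]; exists w => //; apply: Tin.
set Y := span _; have sY := subspace_unval (subspace_span _ : subspace Y).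
move=> _ [w Pw <-]; apply: (span_sub sY _ (TP w Pw)) => h [hC|hT] /=; last first.
  by apply: sub_span; right; apply: map_f.
apply: sub_span; left.
apply: (span_sub (subspace_unval (subspace_span _)) _ hC) => _ [x [q [c [Px Pc q2 ->]]]].
by apply: sub_span; exists (val x), q, (val c); split=> //; [exists x|exists c].
Qed.

Lemma simple_in_val (P : set W) : simple_in P -> simple_in [set val w | w in P].
Proof.
move=> H I sI IP Imode.
have [||I0|PI] := H _ (subspace_unval sI).
- by move=> w /= /IP[w' Pw' /val_inj <-].
- by move=> u m w Pu /= Iw; apply: (Imode (val u)) => //; exists u.
- left; apply/seteqP; split=> [v Iv|_ ->]; last by case: sI.
  have [w _ wv] := IP v Iv; suff : [set (0 : fixed G)] w by move=> w0; rewrite -wv w0.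
  by rewrite -I0 /= wv.
- by right=> _ [w Pw <-]; apply: PI.
Qed.

End FixedTransfer.

(** * Induction along a solvable group *)

Section Solvable.
Context {R : realType} (V : voaType R) (gT : finGroupType) (f : {multiplicative gT -> voa_aut V}).
Hypotheses (cft : CFT_type V) (simpleV : simple_voa V) (cofV : C2_cofinite V).
Local Open Scope group_scope.

Definition Fix (A : {set gT}) : set V := [set v | forall x, x \in A -> f x v = v].

Lemma morM x y v : f (x * y) v = f x (f y v).
Proof. by rewrite gmulfM. Qed.

Lemma mor1 v : f 1 v = v.
Proof. by apply: (bij_inj (voa_aut_bij (f 1))); rewrite -morM mulg1. Qed.

Lemma morX x (k : nat) v : iter k (f x) v = f (x ^+ k) v.
Proof. by elim: k => [|k IH]; rewrite ?expg0 ?mor1 // expgS morM -IH. Qed.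

Lemma Fix_group (A : {set gT}) : Fix <<A>> = Fix A.
Proof.
apply/seteqP; split=> v vA x xA; first by apply: vA; apply: mem_gen.
pose S : {set gT} := [set y | `[< f y v = v >]]%SET.
have gS : group_set S.
  apply/group_setP; split; first by rewrite finset.in_set; apply/asboolP; exact: mor1.
  by move=> y z; rewrite !finset.in_set => /asboolP yv /asboolP zv; apply/asboolP; rewrite morM zv.
have : <<A>> \subset Group gS.
  by rewrite gen_subG; apply/fintype.subsetP => y yA; rewrite finset.in_set; apply/asboolP/vA.
by move=> /fintype.subsetP/(_ x xA); rewrite finset.in_set => /asboolP.
Qed.

Lemma fixed_predE (A : {set gT}) v :
  v \in fixed_pred [set f x | x in [set x | x \in A]] <-> Fix A v.
Proof.
split; first by move=> /asboolP vA x xA; apply: vA; exists x.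
by move=> vA; apply/asboolP => _ [x xA <-]; apply: vA.
Qed.

(** With N normal in H of prime index p and x in H outside N, the action of x on V^N is an
    automorphism whose p-th power is trivial, and its fixed points are V^H. The cyclic results apply
    to V^N as a vertex operator algebra. *)
Lemma solvable_cofinite (H : {group gT}) : solvable H ->
  cofinite_in (Fix H) /\ simple_in (Fix H).
Proof.
have [k] := ubnP #|H|; elim: k H => // k IH H; rewrite ltnS => Hk solH.
have [H1|H1] := eqVneq (H : {set gT}) 1.
  have -> : Fix H = setT.
    by apply/seteqP; split=> // v _ x; rewrite H1 inE => /eqP ->; apply: mor1.
  by split; [exact: full_cofinite|exact: full_simple].
have [N nNH p_prime] := sol_prime_factor_exists solH H1.
have [NH nN] := andP nNH.
have NpH : ~~ (H \subset N).
  by apply: contraL p_prime => HN; rewrite (_ : #|H : N| = 1%N) //; apply/eqP; rewrite indexg_eq1.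
have Nk : (#|N| < k)%N.
  by apply: leq_trans Hk; apply: proper_card; rewrite properE NH.
have [cofN simN] := IH N Nk (solvableS NH solH).
pose G := [set f x | x in [set x | x \in N]].
have FE : [set v : V | v \in fixed_pred G] = Fix N.
  by apply/seteqP; split=> v /fixed_predE.
have cftW := @fixed_CFT R V G cft.
have cofW : C2_cofinite (fixed G) by apply: fixed_C2_cofinite => //; rewrite FE.
have simW : simple_voa (fixed G) by apply: fixed_simple => //; rewrite FE.
have [x xH xN] : exists2 x, x \in H & x \notin N by apply/fintype.subsetPn.
(* Normality of N makes V^N stable under H. *)
have stab y (w : fixed G) : y \in H -> f y (val w) \in fixed_pred G.
  move=> yH; apply/fixed_predE => z zN; have /fixed_predE wN := valP w.
  by rewrite -morM conjgC morM wN // memJ_norm // (fintype.subsetP nN).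
pose s (w : fixed G) : fixed G := Fixed (stab x w xH).
have s_lin : linear s by move=> k' u v; apply: val_inj; exact: (voa_aut_linear (f x)).
have s_bij : bijective s.
  exists (fun w => Fixed (stab x^-1 w (groupVr xH))) => w; apply: val_inj => /=.
    by rewrite -morM mulVg mor1.
  by rewrite -morM mulgV mor1.
have s_mode (u : fixed G) m (v : fixed G) :
    s (mode (u : (fixed G : voaType R)) m v) = mode (s u : (fixed G : voaType R)) m (s v).
  by apply: val_inj; exact: (voa_aut_mode (f x)).
have s_vac : s (vacuum : (fixed G : voaType R)) = (vacuum : (fixed G : voaType R)).
  by apply: val_inj; exact: (voa_aut_vacuum (f x)).
have s_conf : s (conformal : (fixed G : voaType R)) = (conformal : (fixed G : voaType R)).
  by apply: val_inj; exact: (voa_aut_conformal (f x)).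
pose sigma := @VoaAut R (fixed G) s s_lin s_bij s_mode s_vac s_conf.
have xp : x ^+ #|H : N| \in N.
  have xNN : x \in 'N(N) by rewrite (fintype.subsetP nN).
  apply: coset_idr; first by rewrite groupX.
  by rewrite morphX // -card_quotient // expg_cardG // mem_quotient.
have sigma_p (w : fixed G) : iter #|H : N| sigma w = w.
  apply: val_inj; have -> k' : val (iter k' sigma w) = iter k' (f x) (val w).
    by elim: k' => //= k' <-.
  by rewrite morX; have /fixed_predE := valP w; apply.
pose J := <<(N :|: [set x])%SET>>%G.
(* The index of N in H is prime, so no subgroup lies strictly between them, and N together with x
   generates H. *)
have HE : H :=: J.
  have JH : J \subset H by rewrite gen_subG finset.subUset NH finset.sub1set.
  have NJ : N \subset J by apply: fintype.subset_trans (subset_gen _); apply: finset.subsetUl.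
  have xJ : x \in J by apply: mem_gen; rewrite finset.in_setU finset.set11 orbT.
  apply/eqP; rewrite finset.eqEsubset JH andbT -indexg_eq1.
  have LE := Lagrange_index JH NJ; move: (p_prime) => /primeP[_].
  move=> /(_ #|J : N|); rewrite -{1}LE dvdn_mull // => /(_ isT)/orP[|/eqP JN].
    by rewrite indexg_eq1 => /fintype.subsetP/(_ x xJ); rewrite (negbTE xN).
  by rewrite -(eqn_pmul2r (prime_gt0 p_prime)) mul1n -{1}JN LE.
have FHE : Fix H = [set val w | w in [set w : fixed G | sigma w = w]].
  apply/seteqP; split=> v.
    move=> vH; have vN : v \in fixed_pred G.
      by apply/fixed_predE => y yN; apply: vH; apply: (fintype.subsetP NH).
    by exists (Fixed vN) => //; apply: val_inj; exact: vH.
  move=> [w /(congr1 val) sw <-]; rewrite HE Fix_group => y.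
  rewrite finset.in_setU finset.in_set1 => /orP[yN|/eqP -> //].
  by have /fixed_predE := valP w; apply.
rewrite FHE; split; [apply: cofinite_in_val|apply: simple_in_val].
  exact: (cyclic_cofinite cftW simW cofW p_prime sigma_p).
exact: (cyclic_simple cftW simW p_prime sigma_p).
Qed.

End Solvable.

Theorem theorem1 (R : realType) (V : voaType R) (G : set (voa_aut V)) :
  C2_cofinite V -> simple_voa V -> CFT_type V ->
  finite_solvable_subgroup G ->
  C2_cofinite (fixed G).
Proof.
move=> cofV simpleV cft [gT [f [_ <- sol]]].
have [cofF _] := solvable_cofinite f cft simpleV cofV sol.
apply: fixed_C2_cofinite => //.
rewrite (_ : [set v : V | _] = Fix f [set: gT]%SET) //.
apply/seteqP; split=> v.
  by move=> /asboolP vG x _; apply: vG; exists x.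
by move=> vF; apply/asboolP => _ [x _ <-]; apply: vF; rewrite finset.in_setT.
Qed.
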